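(* Let $N\ge2$ and let $f\in\mathbb{C}[x_0,\dots,x_{N-1}]$ be homogeneous of degree $N$ with the only common zero of its partial derivatives at $0$. Let $\mathrm{LG}_{f,orb}=\widetilde{\mathrm{LG}}_{orb}^{<N}=\bigoplus_{n=0}^{N-1}\Lambda^{ch}\mathcal{T}(\mathbb{C}^N)^{\mathbb{Z}_N}e^{nX^*_{orb}}$ be the Landau-Ginzburg orbifold. The following two $N2$-structures on this space coincide with each other. (a) (Landau-Ginzburg structure) the one given by the fields of $\Lambda^{ch}\mathcal{T}(\mathbb{C}^N)^{\mathbb{Z}_N}$ $$G(z)\mapsto\sum_{i}\partial_{x_i}(z)dx_i(z),\qquad Q(z)\mapsto\sum_{i}\Big(-\tfrac1Nx_i(z)\partial_{dx_i}(z)'-(\tfrac1N-1)x_i(z)'\partial_{dx_i}(z)\Big),$$ $$J(z)\mapsto\sum_i\Big(-\tfrac1N:\partial_{x_i}(z)x_i(z):+(\tfrac1N-1):\partial_{dx_i}(z)dx_i(z):\Big),\qquad L(z)\mapsto\sum_i\Big(:\partial_{x_i}(z)x_i(z)':+:\partial_{dx_i}(z)'dx_i(z):\Big);$$ (b) (geometric structure) the one given by $$G(z)\mapsto\sum_{j}:(X_j^*(z)-\chi_j(z))e^{\chi_j}(z):,\qquad Q(z)\mapsto\sum_{j}:\big(X_j(z)+\tfrac1N\chi_j(z)\big)e^{-\chi_j}(z):,$$ $$J(z)\mapsto\sum_{j}\Big(-\tfrac1NX_j^*(z)+X_j(z)+\chi_j(z)\Big),\qquad L(z)\mapsto\sum_j\Big(:X_j(z)X_j^*(z):+\tfrac12:\chi_j(z)^2:-\tfrac12\chi_j(z)'-X_j(z)'\Big).$$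 (All sums are over indices $0,\dots,N-1$.)
   Context: Fields of vertex (super)algebras are written $a(z)=\sum_na_{(n)}z^{-n-1}$, a prime denotes $d/dz$, and $\delta(z-w)=\sum_nz^nw^{-n-1}$. An $N2$-structure is given by fields $G,Q$ (odd), $L,J$ (even) satisfying the relations of the $N=2$ super-Virasoro algebra (with $C$ central): $[L(z),L(w)]=2\partial_w\delta(z-w)L(w)+\delta(z-w)L(w)'$, $[J(z),J(w)]=\partial_w\delta(z-w)C/3$, $[L(z),G(w)]=2\partial_w\delta(z-w)G(w)+\delta(z-w)G(w)'$, $[J(z),G(w)]=\delta(z-w)G(w)$, $[L(z),Q(w)]=\partial_w\delta(z-w)Q(w)+\delta(z-w)Q(w)'$, $[J(z),Q(w)]=-\delta(z-w)Q(w)$, $[L(z),J(w)]=\partial_w^2\delta(z-w)\frac C6+\partial_w\delta(z-w)J(w)+\delta(z-w)J(w)'$, $[Q(z),G(w)]=\partial_w^2\delta(z-w)\frac C6-\partial_w\delta(z-w)J(w)+\delta(z-w)L(w)$. $\Lambda^{ch}\mathcal{T}(\mathbb{C}^N)$ is the $bc$-$\beta\gamma$-system: the vertex algebra freely generated by even fields $x_i(z),\partial_{x_i}(z)$ and odd fields $dx_i(z),\partial_{dx_i}(z)$, $0\le i\le N-1$, with nonzero brackets $[\partial_{x_i}(z),x_j(w)]=\delta_{ij}\delta(z-w)=[\partial_{dx_i}(z),dx_j(w)]$, with vacuum annihilated by all nonnegative modes. The generator of $\mathbb{Z}_N$ acts by $x_i,dx_i\mapsto e^{2\pi i/N}x_i,e^{2\pi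 i/N}dx_i$ and by the inverse factor on $\partial_{x_i},\partial_{dx_i}$. Let $M=\mathbb{Z}^N$ with basis $X_j$, dual basis $X_j^*$ of $M^*$, $\Lambda=M\oplus M^*$ with the form given by the pairing ($M$, $M^*$ isotropic); $V_\Lambda$ the lattice vertex algebra with cocycle $\epsilon(X+X^*,Y+Y^* )=(-1)^{X^*(Y)}$; $F_\Lambda$ the Clifford vertex algebra of $\mathbb{C}\otimes\Lambda$ with odd fields $\tilde X_j(z),\tilde X_j^*(z)$, $[\tilde X^*_i(z),\tilde X_j(w)]=\delta_{ij}\delta(z-w)$; $\mathbb{B}_\Lambda=V_\Lambda\otimes F_\Lambda$. By boson-fermion correspondence $F_\Lambda\cong V_{\mathbb{Z}^N}$, $\tilde X_j(z)=e^{\chi_j}(z)$, $\tilde X_j^*(z)=e^{-\chi_j}(z)$, $\chi_j(z)=:\tilde X_j(z)\tilde X_j^*(z):$, where $\chi_0,\dots,\chi_{N-1}$ is the orthonormal basis of $\mathbb{Z}^N$. $\Lambda^{ch}\mathcal{T}(\mathbb{C}^N)$ is regarded as a subalgebra of $\mathbb{B}_\Lambda$ via Borisov's embedding $x_i(z)\mapsto e^{X_i}(z)$, $dx_i(z)\mapsto:e^{X_i}(z)\tilde X_i(z):$, $\partial_{x_i}(z)\mapsto:(X_i^*(z)-:\tilde X_i(z)\tilde X_i^*(z):)e^{-X_i}(z):$, $\partial_{dx_i}(z)\mapsto:e^{-X_i}(z)\tilde X_i^*(z):$. With $\mathbb{Z}^N_{orb}=\{(m_j)\in\mathbb{Z}^N:N\mid\sum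 m_j\}$, $\Lambda_{orb}=\mathbb{Z}^N_{orb}\oplus(\mathbb{Z}^N_{orb})^*$ and $X^*_{orb}=\frac1N\sum_jX_j^*$, the spaces $\Lambda^{ch}\mathcal{T}(\mathbb{C}^N)^{\mathbb{Z}_N}e^{nX^*_{orb}}$ lie in $\mathbb{B}_{\Lambda_{orb}}$ (defined like $\mathbb{B}_\Lambda$ with $\mathbb{Z}^N_{orb}$ in place of $\mathbb{Z}^N$), and both structures act on them by fields of $\mathbb{B}_{\Lambda_{orb}}$. *)

(* Defs.v *)
From HB Require Import structures.
From mathcomp Require Import all_boot all_order all_algebra.
From mathcomp Require Import finmap multiset.
From mathcomp Require Import classical_sets functions fsbigop reals trigo.
From mathcomp Require Import complex.
From mathcomp Require Import monalg.

Set Implicit Arguments.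
Unset Strict Implicit.
Unset Printing Implicit Defensive.

Import Order.TTheory GRing.Theory Num.Theory.
Local Open Scope ring_scope.

(** * The Fock space

    The complex numbers are [R[i]] for [R : realType].  The lattice part V_L
    and the Clifford part F_L of B_L are realised together, over all rational
    momenta in Q^N + (Q^N)*; the space B_L of a lattice L is the subspace of
    momenta in L + L* ([latticeFock] below).  In this way B_Lambda and
    B_{Lambda_orb}, neither of which contains the other, live in one space. *)

(** The pair [(false, j)] stands for X_j (and for the odd generator ~X_j), the
    pair [(true, j)] for the dual X*_j (and ~X*_j).  A label [(s, j, r)] is the
    creation mode number [Negz r], i.e. -(r+1), of that generator. *)
Definition label (N : nat) : countType := (bool * 'I_N * nat)%type.

(** [(m, k)] is the element sum_j m_j X_j + sum_j k_j X*_j. *)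
Definition momentum (N : nat) : zmodType := ('rV[rat]_N * 'rV[rat]_N)%type.

(** A basis vector is e^lambda times a monomial in bosonic creation modes (a
    multiset) and an exterior monomial in fermionic creation modes (a set,
    its elements being multiplied in increasing order of [pickle]). *)
Definition basis (N : nat) : choiceType :=
  (momentum N * {mset (label N)}%mset * {fset (label N)}%fset)%type.

Definition fock (R : realType) (N : nat) : lmodType R[i] :=
  monalg.malg (basis N) R[i].

(** A formal field a(z) = sum_n a_(n) z^(-n-1) is its family of modes
    [n |-> a_(n)]; sums and multiples of fields are taken pointwise. *)
Definition field (R : realType) (N : nat) : lmodType R[i] :=
  int -> fock R N -> fock R N.

Section Fock.
Variables (R : realType) (N : nat).
Local Notation C := R[i].
Local Notation V := (fock R N).
Local Notation field := (field R N).

Definition ket (b : basis N) : V := monalg.mkmalgU b (1 : C).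

Definition ketM (l : momentum N) : V := ket (l, mset0, fset0).

Definition vac : V := ketM 0.

Definition linext (f : basis N -> V) (v : V) : V :=
  \sum_(b <- monalg.msupp v) monalg.mcoeff b v *: f b.

(** Sum of a locally finite family: [fsbigop] sums over the support. *)
Definition lfsum (F : nat -> V) : V := \sum_(j \in [set: nat]) F j.

(** * The free fields *)

(** The bosonic fields X_j(z), X*_j(z), with
    [X*_i(m), X_j(n)] = m delta_ij delta_{m,-n}.  The zero mode of h acts on
    e^lambda by (h, lambda); for n > 0 the n-th mode acts as n times the
    derivative in the dual creation variable. *)
Definition bos (s : bool) (j : 'I_N) : field := fun n =>
  linext (fun b => let: (l, B, F) := b in
    match n with
    | Posz 0 => (ratr (if s then l.1 0 j else l.2 0 j) : C) *: ket b
    | Posz r.+1 =>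
        (r.+1 * B (~~ s, j, r))%:R *: ket (l, (B `\ (~~ s, j, r))%mset, F)
    | Negz r => ket (l, ((s, j, r) +` B)%mset, F)
    end).

Definition fsign (x : label N) (F : {fset (label N)}%fset) : C :=
  (-1) ^+ count (fun y : label N => (choice.pickle y < choice.pickle x)%N) (enum_fset F).

(** The fermionic fields ~X_j(z), ~X*_j(z), with
    [~X*_i(m), ~X_j(n)]_+ = delta_ij delta_{m+n,-1}. *)
Definition fer (s : bool) (j : 'I_N) : field := fun n =>
  linext (fun b => let: (l, B, F) := b in
    match n with
    | Posz r =>
        let x := (~~ s, j, r) in
        if x \in F then fsign x F *: ket (l, B, (F `\ x)%fset) else 0
    | Negz r =>
        let x := (s, j, r) in
        if x \in F then 0 else fsign x F *: ket (l, B, (x |` F)%fset)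
    end).

(** * Lattice vertex operators *)

Definition dotr (u v : 'rV[rat]_N) : rat := \sum_j u 0 j * v 0 j.

Definition form (l m : momentum N) : rat := dotr l.1 m.2 + dotr l.2 m.1.

(** The cocycle epsilon(X + X*, Y + Y* ) = (-1)^(X*(Y)). *)
Definition cocycle (l m : momentum N) : C := (-1) ^+ `|numq (dotr l.2 m.1)|%N.

Definition heis (l : momentum N) : field :=
  \sum_j ((ratr (l.1 0 j) : C) *: bos false j + (ratr (l.2 0 j) : C) *: bos true j).

(** For S(t) = sum_a S_a t^a without constant term, [powcoef S k a] is the
    coefficient of t^a in S(t)^k, and [expcoef S a] that in exp(S(t)). *)
Fixpoint powcoef (S : nat -> V -> V) (k a : nat) (v : V) : V :=
  if k is k'.+1 then \sum_(i < a.+1) S i (powcoef S k' (a - i) v)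
  else if a == 0%N then v else 0.

Definition expcoef (S : nat -> V -> V) (a : nat) (v : V) : V :=
  \sum_(k < a.+1) ((k`!)%:R : C)^-1 *: powcoef S k a v.

(** The exponents sum_{a>0} l_(-a) z^a / a and - sum_{a>0} l_(a) z^(-a) / a;
    their coefficients at a = 0 vanish because 0^-1 = 0. *)
Definition expcr (l : momentum N) (a : nat) (v : V) : V :=
  (a%:R : C)^-1 *: heis l (- a%:Z) v.
Definition expan (l : momentum N) (a : nat) (v : V) : V :=
  - ((a%:R : C)^-1 *: heis l a%:Z v).

(** e^l(z) = e^l z^(l_(0)) exp(sum_{a>0} l_(-a) z^a/a)
                         exp(- sum_{a>0} l_(a) z^(-a)/a),
    where e^l . e^m = epsilon(l, m) e^(l+m).  On momentum m the power of z
    is (l, m) + a - b = - n - 1.  Momenta with non-integral (l, m), which never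
    occur inside a single B_L, are given the value 0. *)
Definition vop (l : momentum N) : field := fun n =>
  linext (fun b => let: (m, B, F) := b in
    if form l m \is a Num.int then
      cocycle l m *: lfsum (fun c =>
        match c%:Z - n - 1 - numq (form l m) with
        | Posz a => expcoef (expcr l) a (expcoef (expan l) c (ket (l + m, B, F)))
        | Negz _ => 0
        end)
    else 0).

(** * Operations on fields and the state-field correspondence *)

(** Normally ordered product :a(z)b(z): , with modes
    sum_{j<0} a_(j) b_(n-j-1) + (-1)^(|a||b|) sum_{j>=0} b_(n-j-1) a_(j).
    The flag [s] says that both a and b are odd. *)
Definition nop (s : bool) (a b : field) : field := fun n v =>
  lfsum (fun j => a (Negz j) (b (n + j%:Z) v)
                  + (-1 : C) ^+ s *: b (n - j%:Z - 1) (a j%:Z v)).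

Definition deriv (a : field) : field := fun n v => (- n)%:~R *: a (n - 1) v.

Definition divderiv (r : nat) (a : field) : field :=
  ((r`!)%:R : C)^-1 *: iter r deriv a.

Definition stateof (a : field) : V := a (-1) vac.

Fixpoint ferY (s : seq (label N)) (a : field) : field :=
  if s is (t, j, r) :: s' then
    nop (odd (size s')) (divderiv r (fer t j)) (ferY s' a)
  else a.

Fixpoint bosY (s : seq (label N)) (a : field) : field :=
  if s is (t, j, r) :: s' then
    nop false (divderiv r (bos t j)) (bosY s' a)
  else a.

(** The field of the state h_(-r1-1) ... psi_(-s1-1) ... e^l is
    :d^(r1) h(z) ... d^(s1) psi(z) ... e^l(z): , with divided powers of d/dz. *)
Definition basisY (b : basis N) : field :=
  let: (l, B, F) := b in
  bosY (enum_mset B)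
    (ferY (sort (fun x y : label N => (choice.pickle x <= choice.pickle y)%N) (enum_fset F)) (vop l)).

Definition Y (u : V) : field :=
  \sum_(b <- monalg.msupp u) monalg.mcoeff b u *: basisY b.

(** * Lattices *)

Definition latZ : set 'rV[rat]_N := [set m | forall j, m 0 j \is a Num.int]%classic.

(** Z^N_orb: the sum of the coordinates is a multiple of N. *)
Definition latZorb : set 'rV[rat]_N :=
  [set m | latZ m /\ (\sum_j m 0 j) / N%:R \is a Num.int]%classic.

Definition latdual (L : set 'rV[rat]_N) : set 'rV[rat]_N :=
  [set k | forall m, L m -> dotr k m \is a Num.int]%classic.

Definition latticeFock (L : set 'rV[rat]_N) : set V :=
  [set v | forall b : basis N, b \in monalg.msupp v ->
    L b.1.1.1 /\ latdual L b.1.1.2]%classic.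

(** [n X*_orb], where X*_orb = (1/N) sum_j X*_j. *)
Definition nXorb (n : nat) : momentum N := (0, const_mx (n%:R / N%:R)).

(** Right multiplication u |-> u e^g in the twisted group algebra. *)
Definition mulexp (g : momentum N) : V -> V :=
  linext (fun b => let: (l, B, F) := b in cocycle l g *: ket (l + g, B, F)).

(** * The bc-beta-gamma system, through Borisov's embedding *)

(** e^{X_i}(z), and e^{-X_i}(z) when [s]. *)
Definition eX (s : bool) (i : 'I_N) : field :=
  vop (if s then - delta_mx 0 i else delta_mx 0 i, 0).

(** chi_j(z) and e^{chi_j}(z), e^{-chi_j}(z) under F_Lambda = V_{Z^N}. *)
Definition chi (j : 'I_N) : field := nop true (fer false j) (fer true j).
Definition expchi (j : 'I_N) : field := fer false j.
Definition expchiN (j : 'I_N) : field := fer true j.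

(** The images of x_i, dx_i, d/dx_i, d/d(dx_i) under Borisov's embedding. *)
Definition bx (i : 'I_N) : field := eX false i.
Definition bdx (i : 'I_N) : field := nop false (eX false i) (fer false i).
Definition bpx (i : 'I_N) : field := nop false (bos true i - chi i) (eX true i).
Definition bpdx (i : 'I_N) : field := nop false (eX true i) (fer true i).

(** [U] is a vertex subalgebra of B_Lambda. *)
Definition vertex_subalgebra (U : set V) : Prop :=
  [/\ (U `<=` latticeFock latZ)%classic,
      U vac,
      forall (c : C) u v, U u -> U v -> U (c *: u + v)
    & forall u v n, U u -> U v -> U (Y u n v)].

(** Lambda^ch T(C^N), as the image of Borisov's embedding: the vertex subalgebra
    of B_Lambda generated by the images of the generating fields. *)
Definition LambdaChT : set V :=
  [set v | forall U : set V, vertex_subalgebra U ->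
    (forall i, [/\ U (stateof (bx i)), U (stateof (bdx i)),
                   U (stateof (bpx i)) & U (stateof (bpdx i))]) -> U v]%classic.

(** e^{2 pi i / N} *)
Definition zetaN : C :=
  (cos (pi *+ 2 / N%:R) +i* sin (pi *+ 2 / N%:R))%C.

(** [g] is, on Lambda^ch T(C^N), the automorphism by which the generator of
    Z_N acts. *)
Definition ZN_generator (g : V -> V) : Prop :=
  [/\ forall (c : C) u v, LambdaChT u -> LambdaChT v ->
        g (c *: u + v) = c *: g u + g v,
      g vac = vac,
      forall u v n, LambdaChT u -> LambdaChT v ->
        g (Y u n v) = Y (g u) n (g v),
      forall i, g (stateof (bx i)) = zetaN *: stateof (bx i)
             /\ g (stateof (bdx i)) = zetaN *: stateof (bdx i)
    & forall i, g (stateof (bpx i)) = zetaN^-1 *: stateof (bpx i)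
             /\ g (stateof (bpdx i)) = zetaN^-1 *: stateof (bpdx i)].

Definition LambdaChT_ZN : set V :=
  [set v | LambdaChT v /\ forall g, ZN_generator g -> g v = v]%classic.

(** The direct sum over 0 <= n < N of the Lambda^ch T(C^N)^{Z_N} e^{n X*_orb},
    inside B_{Lambda_orb}. *)
Definition LGorb : set V :=
  [set v | latticeFock latZorb v /\
    exists2 u : 'I_N -> V, forall n, LambdaChT_ZN (u n)
      & v = \sum_(n < N) mulexp (nXorb n) (u n)]%classic.

(** * N2-structures *)

Record N2data := N2Data { N2G : field; N2Q : field; N2J : field; N2L : field }.

Definition cstfield (c : C) : field := fun n v => if n == -1 then c *: v else 0.

(** [has_bracket W s a b cs] says that on [W]
      [a(z), b(w)] = sum_k d_w^k delta(z-w) cs_k(w),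
    an anticommutator when [s]; the coefficient of z^(-m-1) in
    d_w^k delta(z-w) is m (m-1) ... (m-k+1) w^(m-k). *)
Definition has_bracket (W : set V) (s : bool) (a b : field) (cs : seq field) :=
  forall (m n : int) v, W v ->
    a m (b n v) - (-1 : C) ^+ s *: b n (a m v)
    = \sum_(k < size cs)
        (\prod_(i < k) (m - i%:Z))%:~R *: nth 0 cs k (m + n - k%:Z) v.

Definition acts_on (W : set V) (a : field) : Prop :=
  forall v, W v -> (forall n, W (a n v)) /\
    exists K : int, forall n, K <= n -> a n v = 0.

(** The relations of the N = 2 super-Virasoro algebra (brackets not displayed
    in the usual list, [G, G] and [Q, Q], are zero), the central element
    acting by the scalar [c]. *)
Definition N2_structure (W : set V) (S : N2data) : Prop :=
  let: N2Data G Q J L := S in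
  [/\ acts_on W G, acts_on W Q, acts_on W J & acts_on W L] /\
  exists c : C,
  [/\ has_bracket W false L L [:: deriv L; 2%:R *: L],
      has_bracket W false J J [:: 0; cstfield (c / 3%:R)],
      has_bracket W false L G [:: deriv G; 2%:R *: G],
      has_bracket W false J G [:: G]
    & has_bracket W false L Q [:: deriv Q; Q]] /\
  [/\ has_bracket W false J Q [:: - Q],
      has_bracket W false L J [:: deriv J; J; cstfield (c / 6%:R)],
      has_bracket W true Q G [:: L; - J; cstfield (c / 6%:R)],
      has_bracket W true G G [::]
    & has_bracket W true Q Q [::]].

Definition N2_coincide (W : set V) (S T : N2data) : Prop :=
  forall n v, W v ->
    [/\ N2G S n v = N2G T n v, N2Q S n v = N2Q T n v,
        N2J S n v = N2J T n v & N2L S n v = N2L T n v].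

Definition LG_G : field := \sum_i nop false (bpx i) (bdx i).
Definition LG_Q : field :=
  \sum_i (- ((N%:R : C)^-1 *: nop false (bx i) (deriv (bpdx i)))
          - ((N%:R : C)^-1 - 1) *: nop false (deriv (bx i)) (bpdx i)).
Definition LG_J : field :=
  \sum_i (- ((N%:R : C)^-1 *: nop false (bpx i) (bx i))
          + ((N%:R : C)^-1 - 1) *: nop true (bpdx i) (bdx i)).
Definition LG_L : field :=
  \sum_i (nop false (bpx i) (deriv (bx i)) + nop true (deriv (bpdx i)) (bdx i)).

(** The fields of Lambda^ch T(C^N)^{Z_N} act on B_{Lambda_orb} through their
    states: the individual x_i(z), ... are not fields of B_{Lambda_orb} (they
    have fractional powers of z on momenta involving X*_orb), so the normally
    ordered products are taken in B_Lambda, and then the resulting states are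
    turned into fields by the state-field correspondence of B_{Lambda_orb}. *)
Definition N2_LG : N2data :=
  N2Data (Y (stateof LG_G)) (Y (stateof LG_Q))
         (Y (stateof LG_J)) (Y (stateof LG_L)).

Definition N2_geom : N2data := N2Data
  (\sum_j nop false (bos true j - chi j) (expchi j))
  (\sum_j nop false (bos false j + (N%:R : C)^-1 *: chi j) (expchiN j))
  (\sum_j (- ((N%:R : C)^-1 *: bos true j) + bos false j + chi j))
  (\sum_j (nop false (bos false j) (bos true j)
           + (2%:R : C)^-1 *: nop false (chi j) (chi j)
           - (2%:R : C)^-1 *: deriv (chi j) - deriv (bos false j))).

End Fock.

Arguments LGorb : clear implicits.

(* Main.v *)
(* Write X_j, X*_j for the bosonic and psi_j, psi*_j for the fermionic generators.
   The bosonization identities :chi psi: = psi', :chi psi*: = - psi*' and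
   1/2 (:chi^2: - chi') = :psi*' psi: turn the geometric fields into the free
   field expressions
     G = sum :X* psi: - psi',          Q = sum :X psi*: - psi*'/N,
     J = sum - X*/N + X + chi,         L = sum :X X*: - X' + :psi*' psi:.
   The identities hold because the difference of the two sides (anti)commutes
   with all modes of the generators and kills the vacuum vectors, and the Fock
   space is irreducible.  The N = 2 relations, with c = 3(N - 2), then follow
   from the noncommutative Wick formula.
   The states of the Landau-Ginzburg fields, computed from the action of
   e^{X_j}(z) and e^{-X_j}(z) on vectors free of X*-modes, are the states of the
   four expressions above; applying Y shows that the two structures are equal.
   Finally, on the summand with e^{n X*_orb} the field X_j(z) acts as
   X_j(z) + (n/N) z^{-1}, so that G is unchanged while Q, J and L are corrected by
   multiples of z^{-1} sum psi*_j(z), z^{-1} and z^{-1} sum X*_j(z), z^{-2}.  These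
   preserve the Z_N-invariants, since psi*_j, X_j + chi_j, the summands of G and
   those of Q are states of the Z_N-invariant subalgebra, J and L are modes of Q
   applied to G, and sum X*_j = N (sum (X_j + chi_j) - J). *)

From mathcomp Require Import all_boot all_order all_algebra.
From mathcomp Require Import finmap multiset.
From mathcomp Require Import boolp classical_sets functions cardinality fsbigop.
From mathcomp Require Import reals trigo complex mpoly ring zify.
Require Import Defs.

Set Implicit Arguments.
Unset Strict Implicit.
Unset Printing Implicit Defensive.

Import Order.TTheory GRing.Theory Num.Theory.
Local Open Scope classical_set_scope.
Local Open Scope ring_scope.

(** * Linear maps and locally finite sums *)

(** The generators X_j, X*_j, psi_j, psi*_j preserve the momentum, so all N = 2 relations are
    checked as operator identities on the entire Fock space, over all rational momenta. [LGorb]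
    enters only through the claim that the modes preserve it. It is cut out by two conditions,
    momenta in the orbifold lattice and a decomposition into sectors; each is encoded by a linear
    map, a projection on momenta or a shift of momentum, which the free fields intertwine up to an
    explicit correction. The operators e^{X_j}(z), e^{-X_j}(z) do change the momentum and stay
    outside this calculus: only a few of their lowest modes are computed, on explicit vectors. The
    central scalar is a sum over the variables: each contributes 1 - 2/N to c/3, namely 1 from chi_j
    paired with itself and -1/N twice from X_j paired with X*_j. Invariance is tested without
    choosing an automorphism: every g satisfying [ZN_generator] multiplies the four kinds of
    generating states by known scalars, and these scalars multiply under [Y]. *)

Section LinearExtension.
Variables (R : realType) (N : nat).
Local Notation C := R[i].
Local Notation V := (fock R N).
Local Notation field := (field R N).

Lemma vecP (u v : V) :
  (forall b, monalg.mcoeff b u = monalg.mcoeff b v) -> u = v.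
Proof. by move/monalg.malgP. Qed.

(** A name of its own for [monalg.mcoeff], on which the tactics below match. *)
Definition coef (b : basis N) (v : V) : C := monalg.mcoeff b v.

Lemma coefP (u v : V) : (forall b, coef b u = coef b v) -> u = v.
Proof. exact: vecP. Qed.
Lemma coef0 b : coef b 0 = 0. Proof. exact: monalg.mcoeff0. Qed.
Lemma coefD b u v : coef b (u + v) = coef b u + coef b v.
Proof. exact: monalg.mcoeffD. Qed.
Lemma coefN b u : coef b (- u) = - coef b u.
Proof. exact: monalg.mcoeffN. Qed.
Lemma coefZ b c u : coef b (c *: u) = c * coef b u.
Proof. exact: monalg.mcoeffZ. Qed.
Lemma coef_add b u v x y : coef b u = x -> coef b v = y -> coef b (u + v) = x + y.
Proof. by move=> <- <-; apply: coefD. Qed.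
Lemma coef_opp b u x : coef b u = x -> coef b (- u) = - x.
Proof. by move=> <-; apply: coefN. Qed.
Lemma coef_scale b c u x : coef b u = x -> coef b (c *: u) = c * x.
Proof. by move=> <-; apply: coefZ. Qed.

(** [linext] with an arbitrary target: the same lemmas then apply to [Y], whose values are fields,
    as well as to operators on the Fock space. *)
Definition lext (W : lmodType C) (f : basis N -> W) (v : V) : W :=
  \sum_(b <- monalg.msupp v) monalg.mcoeff b v *: f b.

Lemma lext_widen (W : lmodType C) (f : basis N -> W) (d : {fset basis N}) v :
  (monalg.msupp v `<=` d)%fset ->
  lext f v = \sum_(b <- d) monalg.mcoeff b v *: f b.
Proof.
move=> sub; rewrite /lext [RHS](bigID (fun b => b \in monalg.msupp v)) /=.
rewrite [X in _ + X]big1 => [|b]; last first.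
  by rewrite -monalg.mcoeff_eq0 => /eqP ->; rewrite scale0r.
rewrite addr0 -[RHS]big_filter; apply: perm_big; apply: uniq_perm.
- exact: fset_uniq.
- by rewrite filter_uniq // fset_uniq.
move=> b; rewrite mem_filter; case bv: (b \in _) => //=.
by rewrite (fsubsetP sub).
Qed.

Lemma lext_linear (W : lmodType C) (f : basis N -> W) c u v :
  lext f (c *: u + v) = c *: lext f u + lext f v.
Proof.
set d := (monalg.msupp u `|` monalg.msupp v)%fset.
rewrite !(@lext_widen W f d) ?fsubsetUl ?fsubsetUr //; last first.
  apply/(fsubset_trans (monalg.msuppD_le _ _)).
  by rewrite fsetSU // monalg.msuppZ_le.
rewrite scaler_sumr -big_split /=; apply: eq_bigr => b _.
by rewrite monalg.mcoeffD monalg.mcoeffZ scalerDl scalerA.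
Qed.

Lemma lext_ket (W : lmodType C) (f : basis N -> W) b : lext f (ket R b) = f b.
Proof.
by rewrite /lext monalg.msuppU oner_eq0 big_seq_fset1 monalg.mcoeffUU scale1r.
Qed.

Lemma linextE f : @linext R N f = lext f. Proof. by []. Qed.

Lemma mcoeff_ket (b b' : basis N) : monalg.mcoeff b' (ket R b) = (b == b')%:R.
Proof. by rewrite /ket monalg.mcoeffU. Qed.

Lemma ketE (v : V) : v = lext (@ket R N) v.
Proof.
rewrite /lext {1}(monalg.monalgE v); apply: eq_bigr => b _.
apply: vecP => b'.
rewrite monalg.mcoeffU monalg.mcoeffZ mcoeff_ket.
by rewrite (mulr_natr (monalg.mcoeff b v)).
Qed.

Definition lin (W : lmodType C) (T : V -> W) :=
  forall c u v, T (c *: u + v) = c *: T u + T v.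

Section Lin.
Variables (W : lmodType C) (T : V -> W).
Hypothesis linT : lin T.

Lemma lin0 : T 0 = 0.
Proof.
have := linT 1 0 0; rewrite !scale1r addr0 => /eqP.
by rewrite eq_sym addrC -subr_eq0 addrK => /eqP.
Qed.
Lemma linD u v : T (u + v) = T u + T v.
Proof. by have := linT 1 u v; rewrite !scale1r. Qed.
Lemma linZ c u : T (c *: u) = c *: T u.
Proof. by have := linT c u 0; rewrite lin0 !addr0. Qed.
Lemma linN u : T (- u) = - T u.
Proof. by rewrite -scaleN1r linZ scaleN1r. Qed.
Lemma linB u v : T (u - v) = T u - T v.
Proof. by rewrite linD linN. Qed.
Lemma lin_sum I (r : seq I) P (F : I -> V) :
  T (\sum_(i <- r | P i) F i) = \sum_(i <- r | P i) T (F i).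
Proof. exact: (big_morph T linD lin0). Qed.
Lemma lin_lext v : T v = lext (T \o @ket R N) v.
Proof. by rewrite {1}(ketE v) /lext lin_sum; apply: eq_bigr => b _; rewrite linZ. Qed.
End Lin.

Lemma lin_ext (W : lmodType C) (S T : V -> W) : lin S -> lin T ->
  (forall b, S (ket R b) = T (ket R b)) -> forall v, S v = T v.
Proof.
move=> linS linT ST v; rewrite (lin_lext linS) (lin_lext linT).
by apply: eq_bigr => b _; rewrite /= ST.
Qed.

Lemma lext_lin (W : lmodType C) (f : basis N -> W) : lin (lext f).
Proof. by move=> c u v; rewrite lext_linear. Qed.

Lemma lin_comp (W : lmodType C) (S : V -> W) (T : V -> V) :
  lin S -> lin T -> lin (S \o T).
Proof. by move=> linS linT c u v; rewrite /= linT linS. Qed.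

Lemma lin_add (W : lmodType C) (S T : V -> W) :
  lin S -> lin T -> lin (fun v => S v + T v).
Proof.
move=> linS linT c u v; rewrite linT linS scalerDr.
by rewrite !addrA; congr (_ + _); rewrite addrAC.
Qed.

Lemma lin_scale (W : lmodType C) k (T : V -> W) : lin T -> lin (fun v => k *: T v).
Proof. by move=> linT c u v; rewrite linT scalerDr !scalerA mulrC. Qed.

Lemma lin_zero (W : lmodType C) : lin (fun _ => 0 : W).
Proof. by move=> c u v; rewrite scaler0 addr0. Qed.

Lemma fieldD (a b : field) n v : (a + b) n v = a n v + b n v.
Proof. by []. Qed.
Lemma fieldN (a : field) n v : (- a) n v = - a n v.
Proof. by []. Qed.
Lemma fieldZ c (a : field) n v : (c *: a) n v = c *: a n v.
Proof. by []. Qed.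
Lemma field0 n v : (0 : field) n v = 0.
Proof. by []. Qed.
Lemma field_sum I (r : seq I) P (F : I -> field) n v :
  (\sum_(i <- r | P i) F i) n v = \sum_(i <- r | P i) F i n v.
Proof. by elim/big_rec2: _ => // i x y _ <-. Qed.

Lemma coef_fieldD k (a b : field) n v x :
  coef k (a n v + b n v) = x -> coef k ((a + b) n v) = x.
Proof. by []. Qed.
Lemma coef_fieldN k (a : field) n v x :
  coef k (- a n v) = x -> coef k ((- a) n v) = x.
Proof. by []. Qed.
Lemma coef_fieldZ k c (a : field) n v x :
  coef k (c *: a n v) = x -> coef k ((c *: a) n v) = x.
Proof. by []. Qed.
Lemma coef_field0 k n v : coef k ((0 : field) n v) = 0.
Proof. exact: coef0. Qed.
Lemma coef_fderiv k (a : field) n v x :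
  coef k ((- n)%:~R *: a (n - 1) v) = x -> coef k (Defs.deriv a n v) = x.
Proof. by []. Qed.

Lemma eq_field (a b : field) : (forall n v, a n v = b n v) -> a = b.
Proof. by move=> ab; apply/funext => n; apply/funext => v. Qed.

End LinearExtension.

(** Pushes [coef] through linear combinations down to atoms. The operations occur in two arities: a
    sum of fields evaluated at a mode and a vector is [GRing.add] with two further arguments. *)
Ltac coef_norm :=
  lazymatch goal with |- coef _ ?t = _ =>
    lazymatch t with
    | @GRing.add _ _ _ => eapply coef_add; [coef_norm|coef_norm]
    | @GRing.opp _ _ => eapply coef_opp; coef_norm
    | @GRing.scale _ _ _ _ => eapply coef_scale; coef_norm
    | @GRing.zero _ => apply coef0
    | @GRing.add _ _ _ _ _ => eapply coef_fieldD; coef_norm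
    | @GRing.opp _ _ _ _ => eapply coef_fieldN; coef_norm
    | @GRing.scale _ _ _ _ _ _ => eapply coef_fieldZ; coef_norm
    | @GRing.zero _ _ _ => apply coef_field0
    | Defs.deriv _ _ _ => eapply coef_fderiv; coef_norm
    | _ => reflexivity
    end
  end.

(* Linear identities between vectors are checked coefficientwise; modes of the
   same field at provably equal indices are identified, and the coefficients of
   the atoms are generalised so that they are never unfolded. *)
Ltac mode_eq :=
  lazymatch goal with |- ?a ?i ?w = ?a' ?j ?w' =>
    constr_eq a a'; refine (f_equal2 a _ _);
    [ first [constr_eq i j; exact (erefl i) | ring | clear; lia]
    | first [constr_eq w w'; exact (erefl w) | mode_eq] ]
  end.
Ltac mode_match :=
  repeat match goal with |- context [coef ?b (?a ?i ?v)] =>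
    match goal with |- context [coef b (a ?j ?w)] =>
      tryif (constr_eq i j; constr_eq v w) then fail else
        (let e := fresh in assert (e : a j w = a i v) by mode_eq;
         replace (coef b (a j w)) with (coef b (a i v))
           by (symmetry; exact (f_equal (coef b) e));
         clear e)
    end end.
Ltac vlin :=
  apply coefP; intro;
  eapply eq_trans; [coef_norm|eapply eq_trans; [|symmetry; coef_norm]];
  mode_match;
  repeat match goal with |- context [coef ?b ?t] => generalize (coef b t); intro end.
Ltac vring := vlin; ring.
Ltac vfield := vlin; field.

Section LocallyFiniteSums.
Variables (R : realType) (N : nat).
Local Notation V := (fock R N).

Definition lfin (F : nat -> V) := exists K, forall j, (K <= j)%N -> F j = 0.

Lemma lfsumE K (F : nat -> V) : (forall j, (K <= j)%N -> F j = 0) ->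
  lfsum F = \sum_(j < K) F j.
Proof.
move=> F0; rewrite /lfsum fsbig_ord; symmetry; apply: fsbig_widen => // j [_] /=.
by move=> /negP; rewrite -leqNgt => /F0.
Qed.

Lemma eq_lfsum (F G : nat -> V) : F =1 G -> lfsum F = lfsum G.
Proof. by move=> /funext ->. Qed.

Lemma lfsum0 (F : nat -> V) : (forall j, F j = 0) -> lfsum F = 0.
Proof. by move=> F0; rewrite (@lfsumE 0) ?big_ord0. Qed.

Lemma lfsum1 (F : nat -> V) k : (forall j, j != k -> F j = 0) -> lfsum F = F k.
Proof.
move=> F0; rewrite (@lfsumE k.+1) => [|j kj]; last by rewrite F0 // gtn_eqF.
rewrite big_ord_recr big1 => [|i _]; first exact: add0r.
by apply: F0; rewrite neq_ltn /= ltn_ord.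
Qed.

Lemma lfinD (F G : nat -> V) : lfin F -> lfin G -> lfin (fun j => F j + G j).
Proof.
move=> [K F0] [L G0]; exists (maxn K L) => j; rewrite geq_max => /andP[? ?].
by rewrite F0 ?G0 ?addr0.
Qed.

Lemma lfinZ c (F : nat -> V) : lfin F -> lfin (fun j => c *: F j).
Proof. by move=> [K F0]; exists K => j /F0 ->; rewrite scaler0. Qed.

Lemma lfin_lin (T : V -> V) (F : nat -> V) : lin T -> lfin F -> lfin (T \o F).
Proof. by move=> linT [K F0]; exists K => j /F0 /= ->; rewrite lin0. Qed.

Lemma lfsumD (F G : nat -> V) : lfin F -> lfin G ->
  lfsum (fun j => F j + G j) = lfsum F + lfsum G.
Proof.
move=> [K F0] [L G0]; rewrite !(@lfsumE (maxn K L)) ?big_split // => j;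
by rewrite geq_max => /andP[? ?]; rewrite ?F0 ?G0 ?addr0.
Qed.

Lemma lfsum_lin (T : V -> V) (F : nat -> V) : lin T -> lfin F ->
  T (lfsum F) = lfsum (T \o F).
Proof.
move=> linT [K F0]; rewrite !(@lfsumE K) ?lin_sum // => j /F0 /= ->.
by rewrite lin0.
Qed.

(** No finiteness is required: for nonzero c both families have the same support, and on an infinite
    support both sums take the default value 0. Hence homogeneity passes to normally ordered
    products without truncation, as used in [hom_nop]. *)
Lemma lfsumZ c (F : nat -> V) : lfsum (fun j => c *: F j) = c *: lfsum F.
Proof.
have [->|c0] := eqVneq c 0.
  by rewrite scale0r lfsum0 // => j; rewrite scale0r.
rewrite /lfsum.
have supp : [set: nat] `&` (fun j => c *: F j) @^-1` [set~ 0]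
          = [set: nat] `&` F @^-1` [set~ 0].
  apply/seteqP; split=> j [_ /= Fj]; split=> //=.
    by move=> F0; apply: Fj; rewrite F0 scaler0.
  apply: contra_not Fj => cF; have /eqP : c *: F j = 0 by exact: cF.
  by rewrite scaler_eq0 (negPf c0) => /eqP.
have [fin|inf] := pselect (finite_set ([set: nat] `&` F @^-1` [set~ 0])); last first.
  by rewrite !fsbig_dflt ?scaler0 // supp.
rewrite fsbig_supp [in RHS]fsbig_supp supp !fsbig_finite //.
by rewrite scaler_sumr.
Qed.

Lemma lfsum_recl (F : nat -> V) : lfin F -> lfsum F = F 0%N + lfsum (fun j => F j.+1).
Proof.
move=> [K F0]; rewrite (@lfsumE K.+1) => [|j Kj]; last by rewrite F0 // ltnW.
rewrite big_ord_recl (@lfsumE K) // => j Kj; exact: F0 (leqW Kj).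
Qed.

Lemma lfinS (F : nat -> V) : lfin (fun j => F j.+1) -> lfin F.
Proof. by move=> [K F0]; exists K.+1; case=> // j; apply: F0. Qed.

End LocallyFiniteSums.

(** * Free fields and normally ordered products *)

Fact kt_key : unit. Proof. by []. Qed.

(* [ket] behind an opaque key: unification would otherwise unfold kets of
   different basis elements down to finitely supported functions. *)
Definition sket (R : realType) (N : nat) : basis N -> fock R N :=
  locked_with kt_key (@ket R N).

Section FreeFields.
Variables (R : realType) (N : nat).
Local Notation C := R[i].
Local Notation V := (fock R N).
Local Notation field := (field R N).
Local Notation bos := (@bos R N).
Local Notation fer := (@fer R N).
Local Notation kt := (@sket R N).
Implicit Types (x y : label N) (B : {mset label N}%mset) (F : {fset label N}%fset).

Lemma ktE b : ket R b = kt b. Proof. by rewrite /sket locked_withE. Qed.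

Lemma lext_kt (W : lmodType C) (f : basis N -> W) b : lext f (kt b) = f b.
Proof. by rewrite -ktE lext_ket. Qed.

Lemma linP (W : lmodType C) (S T : V -> W) : lin S -> lin T ->
  (forall b, S (kt b) = T (kt b)) -> forall v, S v = T v.
Proof. by move=> linS linT ST; apply: lin_ext => // b; rewrite ktE. Qed.

Lemma vscalerBl (a b : C) (v : V) : (a - b) *: v = a *: v - b *: v.
Proof. exact: scalerBl. Qed.
Lemma vscalerDl (a b : C) (v : V) : (a + b) *: v = a *: v + b *: v.
Proof. exact: scalerDl. Qed.

Lemma vscale1r (v : V) : 1 *: v = v.
Proof. exact: scale1r. Qed.

Lemma eq_scale (a b : C) (v : V) : a = b -> a *: v = b *: v.
Proof. by move=> ->. Qed.

(** The usual notion of a field: on each vector all modes of large index vanish. The sums defining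
    [nop] are then finite and commute with linear maps. *)
Definition good (a : field) :=
  (forall n, lin (a n)) /\
  forall v, exists K : int, forall n, K <= n -> a n v = 0.

Lemma trunc_lin (a : field) : (forall n, lin (a n)) ->
  (forall b, exists K : int, forall n, K <= n -> a n (kt b) = 0) -> good a.
Proof.
move=> la tb; split=> // v.
have : forall s : seq (basis N), exists K : int, forall n, K <= n ->
    forall b, b \in s -> a n (kt b) = 0.
  elim=> [|b s [K IH]]; first by exists 0.
  have [L Lb] := tb b; exists (Num.max K L) => n; rewrite ge_max => /andP[Kn Ln] b'.
  by rewrite inE => /orP[/eqP ->|]; [apply: Lb|apply: IH].
move=> /(_ (monalg.msupp v)) [K Kv]; exists K => n Kn.
rewrite (lin_lext (la n)) /lext big_seq big1 // => b bv /=.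
by rewrite ktE Kv // scaler0.
Qed.

Lemma bos0E s j l B F : bos s j 0 (kt (l, B, F)) =
  (ratr (if s then l.1 0 j else l.2 0 j) : C) *: kt (l, B, F).
Proof. by rewrite /bos linextE lext_kt ?ktE. Qed.
Lemma bosPE s j (r : nat) l B F : bos s j r.+1 (kt (l, B, F)) =
  (r.+1 * B (~~ s, j, r))%:R *: kt (l, (B `\ (~~ s, j, r))%mset, F).
Proof. by rewrite /bos linextE lext_kt ?ktE. Qed.
Lemma bosNE s j (r : nat) l B F : bos s j (Negz r) (kt (l, B, F)) =
  kt (l, ((s, j, r) +` B)%mset, F).
Proof. by rewrite /bos linextE lext_kt ?ktE. Qed.

Lemma ferPE s j (r : nat) l B F : fer s j r (kt (l, B, F)) =
  if (~~ s, j, r) \in F then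
    fsign R (~~ s, j, r) F *: kt (l, B, (F `\ (~~ s, j, r))%fset) else 0.
Proof. by rewrite /fer linextE lext_kt ?ktE. Qed.
Lemma ferNE s j (r : nat) l B F : fer s j (Negz r) (kt (l, B, F)) =
  if (s, j, r) \in F then 0 else
    fsign R (s, j, r) F *: kt (l, B, ((s, j, r) |` F)%fset).
Proof. by rewrite /fer linextE lext_kt ?ktE. Qed.

Lemma bos_lin s j n : lin (bos s j n). Proof. exact: lext_lin. Qed.
Lemma fer_lin s j n : lin (fer s j n). Proof. exact: lext_lin. Qed.

Lemma mode_bound (s : seq (label N)) :
  exists K, forall x, x \in s -> (x.2 < K)%N.
Proof.
elim: s => [|y s [K IH]]; first by exists 0%N.
exists (maxn K y.2.+1) => x; rewrite inE => /orP[/eqP ->|/IH xK].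
  by rewrite leq_max leqnn orbT.
by rewrite leq_max xK.
Qed.

Lemma bos_good s j : good (bos s j).
Proof.
apply: trunc_lin => [n|[[l B] F]]; first exact: bos_lin.
have [K BK] := mode_bound (enum_mset B).
exists K.+1%:Z => -[[|r]|r] // Kr; rewrite bosPE.
have -> : B (~~ s, j, r) = 0%N.
  apply/mset_eq0P; apply/negP => xB; have := BK (~~ s, j, r) xB => /=.
  by move: Kr; rewrite lez_nat; lia.
by rewrite muln0 scale0r.
Qed.

Lemma fer_good s j : good (fer s j).
Proof.
apply: trunc_lin => [n|[[l B] F]]; first exact: fer_lin.
have [K BK] := mode_bound (enum_fset F).
exists K%:Z => -[r|r] // Kr; rewrite ferPE; case: ifP => // xF.
have := BK (~~ s, j, r) xF => /=; move: Kr; rewrite lez_nat; lia.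
Qed.

(** The one nontrivial case, multiplication against differentiation by the same variable: creating
    first raises the multiplicity of the label by one, so the eigenvalues differ by m.+1 exactly
    when the labels agree. *)
Lemma bos_comm_PN s t i j (m n : nat) l B F :
  bos s i m.+1 (bos t j (Negz n) (kt (l, B, F))) -
  bos t j (Negz n) (bos s i m.+1 (kt (l, B, F)))
  = (m.+1%:R * ((s != t) && (i == j) && (m == n))%:R) *: kt (l, B, F).
Proof.
rewrite bosNE bosPE bosPE (linZ (@bos_lin t j _)) bosNE.
set x := (~~ s, i, m); set y := (t, j, n).
have -> : (s != t) && (i == j) && (m == n) = (x == y).
  by rewrite /x /y !xpair_eqE; congr (_ && _ && _); case: (s) (t) => -[].
rewrite mset1DE; case: eqVneq => [->|xy].
  rewrite msetD1K mulr1; case: (posnP (B y)) => [B0|By].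
    by rewrite B0 muln0 scale0r subr0 addn0 muln1.
  rewrite msetB1K; last by rewrite in_mset.
  rewrite -vscalerBl; apply: eq_scale.
  by rewrite -natrB ?leq_mul2l ?leq_addl ?orbT // -mulnBr addnK muln1.
rewrite add0n mulr0 scale0r; case: (posnP (B x)) => [B0|Bx].
  by rewrite B0 muln0 !scale0r subrr.
suff -> : ((y +` B) `\ x)%mset = (y +` (B `\ x))%mset by rewrite subrr.
apply/msetP => z; rewrite msetB1E !mset1DE msetB1E.
have [->|zx] := eqVneq z x; last by rewrite !subn0.
by rewrite (negPf xy) !add0n.
Qed.

Lemma bos_comm_ket s t i j m n l B F :
  bos s i m (bos t j n (kt (l, B, F))) - bos t j n (bos s i m (kt (l, B, F)))
  = (m%:~R * ((s != t) && (i == j) && (m + n == 0))%:R) *: kt (l, B, F).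
Proof.
have bZ := fun s j n => linZ (@bos_lin s j n).
case: m => [[|m]|m]; case: n => [[|n]|n].
- by rewrite mul0r scale0r !bos0E !bZ !bos0E !scalerA mulrC subrr.
- by rewrite mul0r scale0r bos0E bosPE !bZ bos0E bosPE !scalerA mulrC subrr.
- by rewrite mul0r scale0r bos0E bosNE !bZ bos0E bosNE subrr.
- by rewrite addr0 andbF mulr0 scale0r bos0E bosPE !bZ bos0E bosPE !scalerA mulrC subrr.
- rewrite -PoszD addnS andbF mulr0 scale0r !bosPE !bZ !bosPE.
  set x := (~~ s, i, m); set y := (~~ t, j, n).
  rewrite !msetB1E !scalerA.
  have -> : ((B `\ y) `\ x)%mset = ((B `\ x) `\ y)%mset.
    by apply/msetP => z; rewrite !msetB1E subnAC.
  rewrite -vscalerBl -!natrM; have [xy|xy] := eqVneq x y.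
    have mn : m = n by case: xy.
    by rewrite xy mn subrr scale0r.
  by rewrite !subn0 mulnC subrr scale0r.
- rewrite bos_comm_PN; apply: eq_scale; congr (_ * _%:R); congr (_ && _ : nat).
  by rewrite NegzE subr_eq0 eqz_nat eqSS.
- by rewrite bos0E bosNE bZ bos0E bosNE subrr addr0 andbF mulr0 scale0r.
- rewrite -[LHS]opprB bos_comm_PN -scaleNr; apply: eq_scale.
  rewrite -mulNr; have -> : (Negz m + n.+1%:Z == 0) = (n == m).
    by rewrite NegzE addrC subr_eq0 eqz_nat eqSS.
  rewrite [j == i]eq_sym [t == s]eq_sym; case: (n =P m) => [->|_]; last by rewrite !andbF !mulr0.
  by rewrite NegzE mulrNz.
- rewrite !bosNE; have -> : (Negz m + Negz n == 0) = false by [].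
  rewrite andbF mulr0 scale0r; apply/eqP; rewrite subr_eq0; apply/eqP.
  by congr (kt (_, _, _)); rewrite msetDCA.
Qed.

Lemma bos_comm s t i j m n v :
  bos s i m (bos t j n v) - bos t j n (bos s i m v)
  = (m%:~R * ((s != t) && (i == j) && (m + n == 0))%:R) *: v.
Proof.
rewrite -scaleN1r; move: v; apply: linP.
- apply: lin_add; last apply: lin_scale; by apply: lin_comp; apply: bos_lin.
- by apply: lin_scale.
by move=> [[l B] F]; rewrite scaleN1r bos_comm_ket.
Qed.

(** The scalar and the new multiset are chosen before F: a bosonic mode does not see the fermionic
    part. With the mirror statement [fer_kt], bosons and fermions commute because scalars do. *)
Lemma bos_kt s j n l B : exists c B', forall F,
  bos s j n (kt (l, B, F)) = c *: kt (l, B', F).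
Proof.
case: n => [[|r]|r].
- by eexists; exists B => F; apply: bos0E.
- by eexists; eexists => F; apply: bosPE.
- by exists 1; eexists => F; rewrite scale1r; apply: bosNE.
Qed.

Lemma fer_kt s j n F : exists c F', forall l B,
  fer s j n (kt (l, B, F)) = c *: kt (l, B, F').
Proof.
case: n => r.
- case xF: ((~~ s, j, r) \in F); last first.
    by exists 0, F => l B; rewrite ferPE xF scale0r.
  by eexists; eexists => l B; rewrite ferPE xF.
- case xF: ((s, j, r) \in F).
    by exists 0, F => l B; rewrite ferNE xF scale0r.
  by eexists; eexists => l B; rewrite ferNE xF.
Qed.

Lemma bos_fer_comm s t i j m n v : bos s i m (fer t j n v) = fer t j n (bos s i m v).
Proof.
move: v; apply: linP.
- exact: lin_comp (@bos_lin _ _ _) (@fer_lin _ _ _).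
- exact: lin_comp (@fer_lin _ _ _) (@bos_lin _ _ _).
move=> [[l B] F]; have [c [B' bE]] := bos_kt s i m l B.
have [d [F' fE]] := fer_kt t j n F.
rewrite fE bE (linZ (@bos_lin _ _ _)) (linZ (@fer_lin _ _ _)) fE bE !scalerA.
by rewrite mulrC.
Qed.

(** Exterior multiplication and contraction indexed by the label alone; a nonnegative mode is the
    contraction by the dual label. The Clifford relations become three statements about labels. *)
Definition ferc x := linext (fun b => let: (l, B, F) := b in
  if x \in F then 0 else fsign R x F *: @ket R N (l, B, (x |` F)%fset)).
Definition fera x := linext (fun b => let: (l, B, F) := b in
  if x \in F then fsign R x F *: @ket R N (l, B, (F `\ x)%fset) else 0).

Lemma ferc_lin x : lin (ferc x). Proof. exact: lext_lin. Qed.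
Lemma fera_lin x : lin (fera x). Proof. exact: lext_lin. Qed.
Lemma fercE x l B F : ferc x (kt (l, B, F)) =
  if x \in F then 0 else fsign R x F *: kt (l, B, (x |` F)%fset).
Proof. by rewrite /ferc linextE lext_kt ?ktE. Qed.
Lemma feraE x l B F : fera x (kt (l, B, F)) =
  if x \in F then fsign R x F *: kt (l, B, (F `\ x)%fset) else 0.
Proof. by rewrite /fera linextE lext_kt ?ktE. Qed.

Lemma fer_pos s j (r : nat) v : fer s j r v = fera (~~ s, j, r) v. Proof. by []. Qed.
Lemma fer_neg s j (r : nat) v : fer s j (Negz r) v = ferc (s, j, r) v. Proof. by []. Qed.

(** The contribution of the factor y to the sign [fsign] of x. Its antisymmetry for distinct labels
    is the source of all anticommutation. *)
Definition xsign x y : C := (-1) ^+ (choice.pickle y < choice.pickle x)%N.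

Lemma xsign_anti x y : x != y -> xsign x y = - xsign y x.
Proof.
move=> xy; rewrite /xsign; case: ltngtP => [_|_|/(pcan_inj choice.pickleK) /eqP].
- by rewrite expr1.
- by rewrite opprK.
by rewrite eq_sym (negPf xy).
Qed.

Lemma xsign_sq x y : xsign x y * xsign x y = 1.
Proof. by rewrite /xsign -expr2 sqrr_sign. Qed.

Lemma fsignU1 x y F : y \notin F -> fsign R x (y |` F)%fset = xsign x y * fsign R x F.
Proof.
move=> yF; rewrite /fsign /xsign -exprD; congr (_ ^+ _).
have /permP -> : perm_eq (enum_fset (y |` F)%fset) (y :: enum_fset F).
  apply: uniq_perm; first exact: fset_uniq.
    by rewrite /= fset_uniq andbT.
  by move=> z; rewrite in_cons -in_fset1U.
by [].
Qed.

Lemma fsignD1 x y F : y \in F -> fsign R x F = xsign x y * fsign R x (F `\ y)%fset.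
Proof. by move=> yF; rewrite -{1}(fsetD1K yF) fsignU1 // !inE eqxx. Qed.

Lemma fsign_sq x F : fsign R x F * fsign R x F = 1.
Proof. by rewrite /fsign -expr2 sqrr_sign. Qed.

Lemma ferc_ferc x y v : ferc x (ferc y v) + ferc y (ferc x v) = 0.
Proof.
move: v; apply: linP; last move=> [[l B] F].
- apply: lin_add; apply: lin_comp; exact: ferc_lin.
- exact: lin_zero.
rewrite !fercE; have [->|xy] := eqVneq x y.
  case: ifP => yF; rewrite ?(lin0 (@ferc_lin _)) ?addr0 //.
  by rewrite (linZ (@ferc_lin _)) fercE fset1U1 scaler0 addr0.
case: (boolP (y \in F)) => yF; case: (boolP (x \in F)) => xF;
  rewrite ?(lin0 (@ferc_lin _)) ?(linZ (@ferc_lin _)) ?fercE ?in_fset1U ?xF ?yF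
    ?orbT ?scaler0 ?add0r ?addr0 //.
rewrite (negPf xy) eq_sym (negPf xy) /= (negPf xF) (negPf yF) !fsignU1 //.
rewrite fsetUCA !scalerA -vscalerDl (xsign_anti xy).
by rewrite [X in X *: _](_ : _ = 0) ?scale0r //; ring.
Qed.

Lemma fera_fera x y v : fera x (fera y v) + fera y (fera x v) = 0.
Proof.
move: v; apply: linP; last move=> [[l B] F].
- apply: lin_add; apply: lin_comp; exact: fera_lin.
- exact: lin_zero.
rewrite !feraE; have [->|xy] := eqVneq x y.
  case: ifP => yF; rewrite ?(lin0 (@fera_lin _)) ?addr0 //.
  by rewrite (linZ (@fera_lin _)) feraE in_fsetD1 eqxx scaler0 addr0.
case: (boolP (y \in F)) => yF; case: (boolP (x \in F)) => xF;
  rewrite ?(lin0 (@fera_lin _)) ?(linZ (@fera_lin _)) ?feraE ?in_fsetD1 ?xF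
    ?(negPf xF) ?(negPf yF) ?yF ?andbF ?scaler0 ?add0r ?addr0 //.
rewrite xy eq_sym xy /= (fsignD1 y xF) (fsignD1 x yF).
have -> : (F `\ y `\ x = F `\ x `\ y)%fset.
  by apply/fsetP => z; rewrite !inE andbCA.
rewrite !scalerA -vscalerDl (xsign_anti xy).
by rewrite [X in X *: _](_ : _ = 0) ?scale0r //; ring.
Qed.

Lemma fera_ferc x y v : fera x (ferc y v) + ferc y (fera x v) = (x == y)%:R *: v.
Proof.
move: v; apply: linP; last move=> [[l B] F].
- apply: lin_add; apply: lin_comp; [exact: fera_lin|exact: ferc_lin|
    exact: ferc_lin|exact: fera_lin].
- exact: lin_scale.
rewrite feraE fercE; have [->|xy] := eqVneq x y.
  rewrite scale1r; case: ifP => yF.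
    rewrite (lin0 (@fera_lin _)) add0r (linZ (@ferc_lin _)) fercE in_fsetD1 eqxx /=.
    rewrite scalerA fsetD1K // (fsignD1 y yF) /xsign ltnn expr0 mul1r fsign_sq.
    by rewrite vscale1r.
  rewrite (lin0 (@ferc_lin _)) addr0 (linZ (@fera_lin _)) feraE fset1U1.
  rewrite scalerA fsetU1K ?yF // fsignU1 ?yF // /xsign ltnn mul1r fsign_sq.
  by rewrite vscale1r.
rewrite scale0r; case: (boolP (y \in F)) => yF; case: (boolP (x \in F)) => xF;
  rewrite ?(lin0 (@fera_lin _)) ?(linZ (@fera_lin _)) ?(lin0 (@ferc_lin _))
   ?(linZ (@ferc_lin _)) ?feraE ?fercE ?in_fsetD1 ?in_fset1U ?xF ?yF
    ?(negPf xF) ?(negPf yF) ?(negPf xy) ?orbF ?orbT ?andbF ?scaler0 ?add0r ?addr0 //.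
  by rewrite eq_sym xy scaler0.
rewrite (fsignU1 x yF) (fsignD1 y xF) !scalerA.
have -> : ((y |` F) `\ x = y |` (F `\ x))%fset.
  apply/fsetP => z; rewrite !inE; have [->|//] := eqVneq z x.
  by rewrite (negPf xy).
rewrite -vscalerDl (xsign_anti xy).
rewrite [X in X *: _](_ : _ = (1 - xsign y x * xsign y x)
  * (fsign R x F * fsign R y (F `\ x)%fset)); last by ring.
by rewrite xsign_sq subrr mul0r scale0r.
Qed.

Lemma fer_comm s t i j m n v :
  fer s i m (fer t j n v) + fer t j n (fer s i m v)
  = ((s != t) && (i == j) && (m + n == -1))%:R *: v.
Proof.
have PN : forall s t i j (m n : nat),
  fer s i m (fer t j (Negz n) v) + fer t j (Negz n) (fer s i m v)
  = ((s != t) && (i == j) && (m%:Z + Negz n == -1))%:R *: v.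
  move=> {}s {}t {}i {}j {}m {}n; rewrite !fer_pos !fer_neg fera_ferc.
  apply: eq_scale; congr (_%:R); rewrite !xpair_eqE; congr (_ && _ && _ : nat); last by lia.
  by case: (s) (t) => -[].
case: m => m; case: n => n.
- by rewrite !fer_pos fera_fera -PoszD andbF scale0r.
- exact: PN.
- rewrite addrC PN; apply: eq_scale.
  by rewrite [n%:Z + _]addrC [j == i]eq_sym [t == s]eq_sym.
- rewrite !fer_neg ferc_ferc (_ : _ == -1 = false) ?andbF ?scale0r //.
Qed.

End FreeFields.

(** * Calculus of fields: derivative, identity field, normally ordered product *)

Section FieldCalculus.
Variables (R : realType) (N : nat).
Local Notation C := R[i].
Local Notation V := (fock R N).
Local Notation field := (field R N).
Local Notation deriv := (@Defs.deriv R N).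
Implicit Types (a b c e : field) (s : bool) (m n p q : int) (v : V).

Lemma good_lin a : good a -> forall n, lin (a n). Proof. by case. Qed.

Lemma good_trunc a : good a -> forall n v,
  exists K, forall j : nat, (K <= j)%N -> a (n + j%:Z) v = 0.
Proof.
move=> [_ ta] n v; have [K aK] := ta v; exists `|K - n|%N => j Kj.
by apply: aK; lia.
Qed.

Lemma good0 : good (0 : field).
Proof. by split=> [n|v]; [exact: lin_zero|exists 0]. Qed.

Lemma goodD a b : good a -> good b -> good (a + b).
Proof.
move=> [la ta] [lb tb]; split=> [n|v]; first exact: lin_add.
have [K aK] := ta v; have [L bL] := tb v; exists (Num.max K L) => n.
by rewrite ge_max => /andP[? ?]; rewrite fieldD aK ?bL ?addr0.
Qed.

Lemma goodZ k a : good a -> good (k *: a).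
Proof.
move=> [la ta]; split=> [n|v]; first exact: lin_scale.
by have [K aK] := ta v; exists K => n Kn; rewrite fieldZ aK ?scaler0.
Qed.

Lemma goodN a : good a -> good (- a).
Proof. by move=> ga; rewrite -scaleN1r; apply: goodZ. Qed.

Lemma goodB a b : good a -> good b -> good (a - b).
Proof. by move=> ga gb; apply/goodD/goodN. Qed.

Lemma good_sum I (r : seq I) P (F : I -> field) :
  (forall i, good (F i)) -> good (\sum_(i <- r | P i) F i).
Proof. by move=> gF; elim/big_ind: _ => //; [exact: good0|exact: goodD]. Qed.

Lemma good_deriv a : good a -> good (deriv a).
Proof.
move=> [la ta]; split=> [n|v]; first by apply: lin_scale; apply: la.
have [K aK] := ta v; exists (K + 1) => n Kn; rewrite /Defs.deriv aK ?scaler0 //.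
by rewrite lerBrDr.
Qed.

(** The field of the vacuum; central terms of brackets are multiples of it. *)
Definition idf : field := fun n v => if n == -1 then v else 0.

Lemma cstfieldE (c : C) : @cstfield R N c = c *: idf.
Proof.
apply: eq_field => n v; rewrite /cstfield fieldZ /idf.
by case: ifP => // _; rewrite scaler0.
Qed.

Lemma good_idf : good idf.
Proof.
split=> [n|v]; last by exists 0 => -[].
by move=> k u w; rewrite /idf; case: ifP => // _; rewrite scaler0 addr0.
Qed.

Lemma deriv_idf : deriv idf = 0.
Proof.
apply: eq_field => n v; rewrite /Defs.deriv /idf field0; case: eqP => [n0|_]; last first.
  by rewrite scaler0.
have -> : n = 0 by lia.
by rewrite oppr0 scale0r.
Qed.

Lemma fderivD a b : deriv (a + b) = deriv a + deriv b.
Proof. by apply: eq_field => n v; rewrite /Defs.deriv !fieldD scalerDr. Qed.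

Lemma fderivZ k a : deriv (k *: a) = k *: deriv a.
Proof. by apply: eq_field => n v; rewrite /Defs.deriv !fieldZ !scalerA mulrC. Qed.

Lemma fderivN a : deriv (- a) = - deriv a.
Proof. by rewrite -scaleN1r fderivZ scaleN1r. Qed.

Lemma fderiv0 : deriv (0 : field) = 0.
Proof. by apply: eq_field => n v; rewrite /Defs.deriv !field0 scaler0. Qed.

Definition sg s : C := (-1) ^+ s.

Lemma sg_sq s : sg s * sg s = 1.
Proof. by case: s; rewrite /sg ?expr1 ?expr0; ring. Qed.

Definition nterm s a b n v (j : nat) : V :=
  a (Negz j) (b (n + j%:Z) v) + sg s *: b (n - j%:Z - 1) (a j%:Z v).

Lemma nopE s a b n v : nop s a b n v = lfsum (nterm s a b n v).
Proof. by []. Qed.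

Lemma lfin_left b n v (A : nat -> V -> V) : good b -> (forall j, A j 0 = 0) ->
  lfin (fun j => A j (b (n + j%:Z) v)).
Proof. by move=> gb A0; have [K bK] := good_trunc gb n v; exists K => j /bK ->. Qed.

Lemma lfin_nop s a b n v : good a -> good b -> lfin (nterm s a b n v).
Proof.
move=> ga gb; apply: lfinD.
  by apply: (@lfin_left b n v (fun j => a (Negz j))) => // j; apply/lin0/good_lin.
apply: lfinZ; have [K aK] := good_trunc ga 0 v; exists K => j /aK.
by rewrite add0r => ->; apply/lin0/good_lin.
Qed.

(** For truncation on v: only finitely many vectors a_(j) v with j >= 0 are nonzero, so the bounds
    for b on these and on v itself combine into one. *)
Lemma good_nop s a b : good a -> good b -> good (nop s a b).
Proof.
move=> ga gb; split=> [n k u v|v].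
  rewrite !nopE -lfsumZ -lfsumD; [|by apply: lfinZ; exact: lfin_nop|exact: lfin_nop].
  apply: eq_lfsum => j; rewrite /nterm (good_lin gb) (good_lin ga) (good_lin ga) (good_lin gb).
  by vring.
have [K aK] := good_trunc ga 0 v; have [L bL] := gb.2 v.
have : exists M : int, forall j : nat, (j < K)%N -> forall n, M <= n ->
    b (n - j%:Z - 1) (a j%:Z v) = 0.
  elim: K {aK} => [|K [M IH]]; first by exists 0.
  have [P bP] := gb.2 (a K%:Z v); exists (Num.max M (P + K%:Z + 1)) => j.
  rewrite ltnS leq_eqVlt => /orP[/eqP ->|jK] n; rewrite ge_max => /andP[Mn Pn].
    by apply: bP; lia.
  exact: IH.
move=> [M bM]; exists (Num.max M L) => n; rewrite ge_max => /andP[Mn Ln].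
rewrite nopE lfsum0 // => j; rewrite /nterm bL; last by lia.
rewrite (lin0 (good_lin ga _)) add0r; case: (ltnP j K) => jK.
  by rewrite bM ?scaler0.
by have := aK j jK; rewrite add0r => ->; rewrite (lin0 (good_lin gb _)) scaler0.
Qed.

Lemma nopDl s a a' b : good a -> good a' -> good b ->
  nop s (a + a') b = nop s a b + nop s a' b.
Proof.
move=> ga ga' gb; apply: eq_field => n v; rewrite fieldD !nopE -lfsumD; try exact: lfin_nop.
by apply: eq_lfsum => j; rewrite /nterm !fieldD (linD (good_lin gb _)); vring.
Qed.

Lemma nopDr s a b b' : good a -> good b -> good b' ->
  nop s a (b + b') = nop s a b + nop s a b'.
Proof.
move=> ga gb gb'; apply: eq_field => n v; rewrite fieldD !nopE -lfsumD; try exact: lfin_nop.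
by apply: eq_lfsum => j; rewrite /nterm !fieldD (linD (good_lin ga _)); vring.
Qed.

Lemma nopZl s k a b : good b -> nop s (k *: a) b = k *: nop s a b.
Proof.
move=> gb; apply: eq_field => n v; rewrite fieldZ !nopE -lfsumZ.
by apply: eq_lfsum => j; rewrite /nterm !fieldZ (linZ (good_lin gb _)); vring.
Qed.

Lemma nopZr s k a b : good a -> nop s a (k *: b) = k *: nop s a b.
Proof.
move=> ga; apply: eq_field => n v; rewrite fieldZ !nopE -lfsumZ.
by apply: eq_lfsum => j; rewrite /nterm !fieldZ (linZ (good_lin ga _)); vring.
Qed.

Lemma nopNl s a b : good b -> nop s (- a) b = - nop s a b.
Proof. by move=> gb; rewrite -scaleN1r nopZl // scaleN1r. Qed.

Lemma nopNr s a b : good a -> nop s a (- b) = - nop s a b.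
Proof. by move=> ga; rewrite -scaleN1r nopZr // scaleN1r. Qed.

Lemma nop0l s b : good b -> nop s 0 b = 0.
Proof.
move=> gb; apply: eq_field => n v; rewrite nopE lfsum0 // => j.
by rewrite /nterm !field0 (lin0 (good_lin gb _)) scaler0 addr0.
Qed.

Lemma nop0r s a : good a -> nop s a 0 = 0.
Proof.
move=> ga; apply: eq_field => n v; rewrite nopE lfsum0 // => j.
by rewrite /nterm !field0 (lin0 (good_lin ga _)) scaler0 addr0.
Qed.

Lemma nop_idl b : good b -> nop false idf b = b.
Proof.
move=> gb; apply: eq_field => n v; rewrite nopE (@lfsum1 _ _ _ 0%N) /nterm /idf /=.
  by rewrite addr0 (lin0 (good_lin gb _)) scaler0 addr0.
by case=> // j _; rewrite (lin0 (good_lin gb _)) scaler0 addr0.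
Qed.

Lemma nop_idr a : good a -> nop false a idf = a.
Proof.
move=> ga; apply: eq_field => n v; rewrite nopE.
case: n => n.
  rewrite (@lfsum1 _ _ _ n) => [|j jn]; rewrite /nterm /idf.
    by rewrite subrr sub0r eqxx (lin0 (good_lin ga _)) add0r /sg expr0 scale1r.
  have -> : (n%:Z - j%:Z - 1 == -1) = false by lia.
  by rewrite scaler0 addr0 (lin0 (good_lin ga _)).
rewrite (@lfsum1 _ _ _ n) => [|j jn]; rewrite /nterm /idf.
  have -> : Negz n + n%:Z == -1 by lia.
  have -> : (Negz n - n%:Z - 1 == -1) = false by lia.
  by rewrite scaler0 addr0.
have -> : (Negz n + j%:Z == -1) = false by lia.
have -> : (Negz n - j%:Z - 1 == -1) = false by lia.
by rewrite scaler0 addr0 (lin0 (good_lin ga _)).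
Qed.

(** Leibniz rule, mode by mode. Differentiating a shifts the summation index by one in both halves
    of the product; after reindexing, the factors j and -(n + j) of the first half, and -(j + 1) and
    -(n - j - 1) of the second, both add up to -n. *)
Lemma deriv_nop s a b : good a -> good b ->
  deriv (nop s a b) = nop s (deriv a) b + nop s a (deriv b).
Proof.
move=> ga gb; apply: eq_field => n v; rewrite fieldD [LHS]/Defs.deriv !nopE -lfsumZ.
have la := good_lin ga; have lb := good_lin gb.
have gda := good_deriv ga; have gdb := good_deriv gb.
pose A j := a (Negz j) (b (n - 1 + j%:Z) v).
pose B (j : nat) := sg s *: b (n - 1 - j%:Z - 1) (a j%:Z v).
have fA : lfin A by apply: (@lfin_left b (n - 1) v (fun j => a (Negz j))) => // j; apply: lin0.
have fB : lfin B.
  apply: lfinZ; have [K aK] := good_trunc ga 0 v; exists K => j /aK.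
  by rewrite add0r => ->; apply: lin0.
have fjA : lfin (fun j => j%:R *: A j).
  by have [K A0] := fA; exists K => j /A0 ->; rewrite scaler0.
have fjB : lfin (fun j => j.+1%:R *: B j).
  by have [K B0] := fB; exists K => j /B0 ->; rewrite scaler0.
have eA : lfsum (fun j => j%:R *: A j) = lfsum (fun j => j.+1%:R *: A j.+1).
  by rewrite [LHS](lfsum_recl fjA) mulr0n scale0r add0r.
(* The second half moved up by one place; the term at 0 vanishes because mode 0 of a derivative is
   zero. *)
pose B' j := if j is j'.+1 then - (j%:R *: B j') else 0.
have B'S j : B' j.+1 = - (j.+1%:R *: B j) by [].
have fB' : lfin B'.
  by apply: lfinS; have [K B0] := fjB; exists K => j Kj; rewrite B'S (B0 _ Kj) oppr0.
have eB : lfsum (fun j => - (j.+1%:R *: B j)) = lfsum B'.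
  by rewrite [RHS](lfsum_recl fB') add0r.
have fA1 : lfin (fun j => j.+1%:R *: A j.+1).
  by have [K A0] := fA; exists K => j Kj; rewrite (A0 _ (leqW Kj)) scaler0.
have fmB : lfin (fun j => - (j.+1%:R *: B j)).
  by have [K B0] := fjB; exists K => j Kj; rewrite (B0 _ Kj) oppr0.
have e1 : lfsum (nterm s (deriv a) b n v)
    = lfsum (fun j => j%:R *: A j) + lfsum (fun j => - (j.+1%:R *: B j)).
  rewrite [X in _ = X + _]eA [X in _ = _ + X]eB -[RHS](lfsumD fA1 fB').
  apply: eq_lfsum => j.
  rewrite /nterm /Defs.deriv (linZ (lb _)) /A /B' /B.
  have -> : Negz j - 1 = Negz j.+1 by lia.
  have -> : n - 1 + j.+1%:Z = n + j%:Z by lia.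
  have -> : (- Negz j)%:~R = j.+1%:R :> C by rewrite NegzE opprK.
  congr (_ + _); case: j => [|j]; first by rewrite oppr0 scale0r scaler0.
  have -> : j.+1%:Z - 1 = j%:Z by lia.
  have -> : n - 1 - j%:Z - 1 = n - j.+1%:Z - 1 by lia.
  have -> : (- j.+1%:Z)%:~R = - j.+1%:R :> C by rewrite mulrNz.
  by vring.
have e2 : lfsum (nterm s a (deriv b) n v)
    = lfsum (fun j : nat => (- (n + j%:Z))%:~R *: A j + (- (n - j%:Z - 1))%:~R *: B j).
  apply: eq_lfsum => j; rewrite /nterm /Defs.deriv (linZ (la _)) /A /B.
  have -> : n - 1 + j%:Z = n + j%:Z - 1 by lia.
  have -> : n - 1 - j%:Z - 1 = n - j%:Z - 1 - 1 by lia.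
  by vring.
rewrite [X in _ = X + _]e1 [X in _ = _ + X]e2.
rewrite -[X in _ = X + _](lfsumD fjA fmB) -[RHS]lfsumD.
- apply: eq_lfsum => j; rewrite /nterm -/(A j) -/(B j).
  have -> : j.+1%:R = j%:R + 1 :> C by rewrite -natr1.
  have -> : j%:R = (j%:Z)%:~R :> C by [].
  by vring.
- exact: lfinD.
apply: lfinD.
  by have [K A0] := fA; exists K => j /A0 ->; rewrite scaler0.
by have [K B0] := fB; exists K => j /B0 ->; rewrite scaler0.
Qed.

End FieldCalculus.

(** * Brackets and the Wick formula *)

Section Brackets.
Variables (R : realType) (N : nat).
Local Notation C := R[i].
Local Notation V := (fock R N).
Local Notation field := (field R N).
Local Notation deriv := (@Defs.deriv R N).
Local Notation sg := (@sg R).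
Implicit Types (a b c e f : field) (s : bool) (m n p q : int) (v : V).

(** Here e_k is a_(k) b divided by k!, as the coefficients m (m - 1) ... carry no factorials,
    matching [has_bracket]. The fourth coefficient is there because the Wick formula for brackets
    with three coefficients can produce one. *)
Definition brk s a b e0 e1 e2 e3 := forall m n v,
  a m (b n v) - sg s *: b n (a m v) =
  e0 (m + n) v + m%:~R *: e1 (m + n - 1) v
  + (m * (m - 1))%:~R *: e2 (m + n - 2) v
  + (m * (m - 1) * (m - 2))%:~R *: e3 (m + n - 3) v.

Lemma commD (k : C) (x y z t : V) :
  x + y - k *: (z + t) = (x - k *: z) + (y - k *: t).
Proof. by vring. Qed.

Lemma commZ (k l : C) (x y : V) : l *: x - k *: (l *: y) = l *: (x - k *: y).
Proof. by vring. Qed.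

Lemma comm_flip s (x y : V) : x - sg s *: y = - sg s *: (y - sg s *: x).
Proof. by rewrite -{1}(vscale1r x) -(sg_sq R s); vring. Qed.

Lemma sgK s v : sg s *: (sg s *: v) = v.
Proof. by rewrite scalerA sg_sq vscale1r. Qed.

Lemma comm_move (k : C) (x y z : V) : x - k *: y = z -> x = k *: y + z.
Proof. by move=> <-; vring. Qed.

Lemma lfsumB (k : C) (F G : nat -> V) : lfin F -> lfin G ->
  lfsum (fun j => F j - k *: G j) = lfsum F - k *: lfsum G.
Proof.
move=> fF fG; have fG' := lfinZ (- k) fG.
have -> : lfsum (fun j => F j - k *: G j) = lfsum (fun j => F j + (- k) *: G j).
  by apply: eq_lfsum => j; vring.
by rewrite (lfsumD fF fG') lfsumZ; vring.
Qed.

Lemma lfsum3 (k l : C) (F G H : nat -> V) : lfin F -> lfin G -> lfin H ->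
  lfsum (fun j => F j + k *: G j + l *: H j) = lfsum F + k *: lfsum G + l *: lfsum H.
Proof.
move=> fF fG fH; have fG' := lfinZ k fG; have fH' := lfinZ l fH.
have fFG := lfinD fF fG'.
apply: etrans (lfsumD fFG fH') _.
apply: (congr2 (fun x y => x + y)) (lfsumZ l H).
apply: etrans (lfsumD fF fG') _.
exact: (congr1 (fun x => lfsum F + x)) (lfsumZ k G).
Qed.

Lemma lfin3 (k l : C) (F G H : nat -> V) : lfin F -> lfin G -> lfin H ->
  lfin (fun j => F j + k *: G j + l *: H j).
Proof.
move=> fF fG fH; have fG' := lfinZ k fG; have fH' := lfinZ l fH.
by have fFG := lfinD fF fG'; exact: lfinD fFG fH'.
Qed.

Lemma lin_comb3 (x y z t : V) (k k1 k2 : C) (T : V -> V) : lin T ->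
  T (k *: x + (y + k1 *: z + k2 *: t)) = k *: T x + (T y + k1 *: T z + k2 *: T t).
Proof.
move=> lT; apply: etrans (lT k x _) _; apply: (congr1 (fun w => k *: T x + w)).
apply: etrans (linD lT _ _) _; apply: congr2 (linZ lT _ _).
by apply: etrans (linD lT _ _) _; apply: (congr1 (fun w => T y + w)) (linZ lT _ _).
Qed.

Lemma comb3 (k l : C) (x y z x' y' z' : V) : x = x' -> y = y' -> z = z' ->
  x + k *: y + l *: z = x' + k *: y' + l *: z'.
Proof. by move=> -> -> ->. Qed.

Lemma brkD s a b b' e0 e1 e2 e3 f0 f1 f2 f3 :
  good a -> brk s a b e0 e1 e2 e3 -> brk s a b' f0 f1 f2 f3 ->
  brk s a (b + b') (e0 + f0) (e1 + f1) (e2 + f2) (e3 + f3).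
Proof.
move=> ga hb hb' m n v; rewrite [(b + b') n v]fieldD [(b + b') n (a m v)]fieldD (linD (good_lin ga m)).
by apply: etrans (commD _ _ _ _ _) _; rewrite hb hb'; vring.
Qed.

Lemma brkZ s k a b e0 e1 e2 e3 : good a -> brk s a b e0 e1 e2 e3 ->
  brk s a (k *: b) (k *: e0) (k *: e1) (k *: e2) (k *: e3).
Proof.
move=> ga hb m n v; rewrite [(k *: b) n v]fieldZ [(k *: b) n (a m v)]fieldZ (linZ (good_lin ga m)).
by apply: etrans (commZ _ _ _ _) _; rewrite hb; vring.
Qed.

Lemma brk0 s a : good a -> brk s a 0 0 0 0 0.
Proof.
by move=> ga m n v; rewrite !field0 (lin0 (good_lin ga m)); vring.
Qed.

Lemma brk_sum s a (I : Type) (r : seq I) (b e0 e1 e2 e3 : I -> field) :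
  good a -> (forall i, brk s a (b i) (e0 i) (e1 i) (e2 i) (e3 i)) ->
  brk s a (\sum_(i <- r) b i) (\sum_(i <- r) e0 i) (\sum_(i <- r) e1 i)
    (\sum_(i <- r) e2 i) (\sum_(i <- r) e3 i).
Proof.
move=> ga hb; elim: r => [|i r IH]; first by rewrite !big_nil; apply: brk0.
by rewrite !big_cons; exact: (brkD ga (hb i) IH).
Qed.

Lemma brk_eq s a b e0 e1 e2 e3 f0 f1 f2 f3 : brk s a b e0 e1 e2 e3 ->
  e0 = f0 -> e1 = f1 -> e2 = f2 -> e3 = f3 -> brk s a b f0 f1 f2 f3.
Proof. by move=> hb <- <- <- <-. Qed.

Lemma brk_deriv s a b e0 e1 e2 : good a -> brk s a b e0 e1 e2 0 ->
  brk s a (deriv b) (deriv e0) (deriv e1 + e0) (deriv e2 + e1) e2.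
Proof.
move=> ga hb m n v.
rewrite {1 2}/Defs.deriv (linZ (good_lin ga m)).
apply: etrans (commZ _ _ _ _) _; rewrite hb.
by vring.
Qed.

(** Skew-symmetry. The old mode number is the total mode minus the new one; powers of the total mode
    are absorbed into derivatives of the coefficients. *)
Lemma brk_skew s a b e0 e1 e2 : brk s a b e0 e1 e2 0 ->
  brk s b a (- sg s *: (e0 - deriv e1 + deriv (deriv e2)))
    (- sg s *: (2%:R *: deriv e2 - e1)) (- sg s *: e2) 0.
Proof.
move=> hb m n v.
apply: etrans (comm_flip _ _ _) _; rewrite hb; vring.
Qed.

Lemma int_step (P : int -> Prop) : P 0 -> (forall p, P p <-> P (p + 1)) ->
  forall p, P p.
Proof.
move=> P0 PS; elim/int_ind => // p Pp.
  by have /PS := Pp; rewrite -PoszD addn1.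
by apply/PS; have -> : - p.+1%:Z + 1 = - p%:Z by lia.
Qed.

(* The normally ordered product with the creation/annihilation split of [e]
   moved from mode 0 to mode [p]. *)
Definition shterm s e c p q v (j : nat) : V :=
  e (p - 1 - j%:Z) (c (q - p + j%:Z) v) + sg s *: c (q - p - 1 - j%:Z) (e (p + j%:Z) v).

Lemma lfin_shterm s e c p q v : good e -> good c -> lfin (shterm s e c p q v).
Proof.
move=> ge gc; apply: lfinD.
  apply: (@lfin_left _ _ c (q - p) v (fun j : nat => e (p - 1 - j%:Z))) => // j.
  exact/lin0/good_lin.
apply: lfinZ; have [K eK] := good_trunc ge p v; exists K => j /eK ->.
exact/lin0/good_lin.
Qed.

(** Moving the split from p to p + 1 reverses the order of a single product and so costs one
    commutator, given by the bracket. The polynomials are the sums of 1, p' and p' (p' - 1) over 0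
    <= p' < p; the recurrence is run in both directions to reach negative p. *)
Lemma shift_split s e c f0 f1 f2 p q v : good e -> good c -> brk s e c f0 f1 f2 0 ->
  lfsum (shterm s e c p q v) = nop s e c q v
    + p%:~R *: f0 (q - 1) v + ((p * (p - 1))%:~R / 2%:R) *: f1 (q - 2) v
    + ((p * (p - 1) * (p - 2))%:~R / 3%:R) *: f2 (q - 3) v.
Proof.
move=> ge gc hec; have le := good_lin ge; have lc := good_lin gc.
have two : 2%:R != 0 :> C by rewrite pnatr_eq0.
have three : 3%:R != 0 :> C by rewrite pnatr_eq0.
have step p' : lfsum (shterm s e c (p' + 1) q v) - lfsum (shterm s e c p' q v)
    = e p' (c (q - p' - 1) v) - sg s *: c (q - p' - 1) (e p' v).
  pose A (j : nat) := e (p' - j%:Z) (c (q - p' - 1 + j%:Z) v).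
  pose B (j : nat) := sg s *: c (q - p' - 1 - j%:Z) (e (p' + j%:Z) v).
  have fA : lfin A.
    apply: (@lfin_left _ _ c (q - p' - 1) v (fun j : nat => e (p' - j%:Z))) => // j.
    exact: lin0.
  have fB : lfin B.
    apply: lfinZ; have [K eK] := good_trunc ge p' v; exists K => j /eK ->.
    exact: lin0.
  have fA1 : lfin (fun j => A j.+1).
    by have [K A0] := fA; exists K => j Kj; exact: (A0 _ (leqW Kj)).
  have fB1 : lfin (fun j => B j.+1).
    by have [K B0] := fB; exists K => j Kj; exact: (B0 _ (leqW Kj)).
  have h1 : lfsum (shterm s e c (p' + 1) q v) = lfsum A + lfsum (fun j => B j.+1).
    rewrite -(lfsumD fA fB1); apply: eq_lfsum => j; rewrite /shterm /A /B.
    have -> : p' + 1 - 1 - j%:Z = p' - j%:Z by ring.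
    have -> : q - (p' + 1) + j%:Z = q - p' - 1 + j%:Z by ring.
    have -> : q - (p' + 1) - 1 - j%:Z = q - p' - 1 - j.+1%:Z by lia.
    by have -> : p' + 1 + j%:Z = p' + j.+1%:Z by lia.
  have h0 : lfsum (shterm s e c p' q v) = lfsum (fun j => A j.+1) + lfsum B.
    rewrite -(lfsumD fA1 fB); apply: eq_lfsum => j; rewrite /shterm /A /B.
    have -> : p' - 1 - j%:Z = p' - j.+1%:Z by lia.
    by have -> : q - p' + j%:Z = q - p' - 1 + j.+1%:Z by lia.
  apply: etrans (congr2 (fun x y => x - y) h1 h0) _.
  have A0E : A 0%N = e p' (c (q - p' - 1) v) by rewrite /A subr0 addr0.
  have B0E : B 0%N = sg s *: c (q - p' - 1) (e p' v) by rewrite /B subr0 addr0.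
  clearbody A B.
  move: (lfsum_recl fA) (lfsum_recl fB); rewrite A0E B0E => -> ->.
  by vring.
pose rhs p' : V := p'%:~R *: f0 (q - 1) v + ((p' * (p' - 1))%:~R / 2%:R) *: f1 (q - 2) v
    + ((p' * (p' - 1) * (p' - 2))%:~R / 3%:R) *: f2 (q - 3) v.
have rstep p' : rhs (p' + 1) - rhs p' = lfsum (shterm s e c (p' + 1) q v)
    - lfsum (shterm s e c p' q v).
  apply/esym/(etrans (step p')); rewrite hec /rhs.
  by vfield; rewrite ?two ?three.
suff : lfsum (shterm s e c p q v) = nop s e c q v + rhs p.
  by rewrite /rhs => ->; vring.
move: p; apply: int_step => [|p].
  have -> : rhs 0 = 0 by rewrite /rhs; vring.
  rewrite addr0 [RHS]nopE; apply: eq_lfsum => j; rewrite /shterm /nterm.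
  have -> : 0 - 1 - j%:Z = Negz j by lia.
  have -> : q - 0 + j%:Z = q + j%:Z by lia.
  have -> : q - 0 - 1 - j%:Z = q - j%:Z - 1 by lia.
  by rewrite add0r.
have := rstep p; clearbody rhs.
generalize (lfsum (shterm s e c (p + 1) q v)) (lfsum (shterm s e c p q v)) (nop s e c q v).
move=> S1 S0 n0 h; have -> : S1 = S0 + (rhs (p + 1) - rhs p) by rewrite h; vring.
split=> [->|h']; first by vring.
have -> : S0 = S0 + (rhs (p + 1) - rhs p) - (rhs (p + 1) - rhs p) by vring.
by rewrite h'; vring.
Qed.

(** Quasicommutativity: [shift_split] at p = q = n is the product in the opposite order, and the
    polynomials in n turn into derivatives. *)
Lemma nop_swap s e c f0 f1 f2 : good e -> good c -> brk s e c f0 f1 f2 0 ->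
  nop s c e = sg s *: (nop s e c - deriv f0 + 2%:R^-1 *: deriv (deriv f1)
    - 3%:R^-1 *: deriv (deriv (deriv f2))).
Proof.
move=> ge gc hec; apply: eq_field => n v.
have := shift_split n n v ge gc hec.
have -> : lfsum (shterm s e c n n v) = sg s *: nop s c e n v.
  rewrite nopE -lfsumZ; apply: eq_lfsum => j; rewrite /shterm /nterm.
  have -> : n - n + j%:Z = j%:Z by ring.
  have -> : n - n - 1 - j%:Z = Negz j by lia.
  have -> : n - 1 - j%:Z = n - j%:Z - 1 by ring.
  rewrite -{1}(vscale1r (e _ _)) -(sg_sq R s); vring.
move=> h; apply: etrans (esym (sgK s _)) _; rewrite h.
by vring.
Qed.

(* The noncommutative Wick formula, for brackets of low order. *)
Lemma brk_nop (pa pb pc : bool) a b c b0 b1 b2 c0 c1 c2 f00 f01 f02 f10 f11 f20 :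
  good a -> good b -> good c ->
  good b0 -> good b1 -> good b2 -> good c0 -> good c1 -> good c2 ->
  brk (pa && pb) a b b0 b1 b2 0 ->
  brk (pa && pc) a c c0 c1 c2 0 ->
  brk ((pa (+) pb) && pc) b0 c f00 f01 f02 0 ->
  brk ((pa (+) pb) && pc) b1 c f10 f11 0 0 ->
  brk ((pa (+) pb) && pc) b2 c f20 0 0 0 ->
  brk (pa && (pb (+) pc)) a (nop (pb && pc) b c)
    (nop ((pa (+) pb) && pc) b0 c + sg (pa && pb) *: nop (pb && (pa (+) pc)) b c0)
    (nop ((pa (+) pb) && pc) b1 c + sg (pa && pb) *: nop (pb && (pa (+) pc)) b c1
     + f00)
    (nop ((pa (+) pb) && pc) b2 c + sg (pa && pb) *: nop (pb && (pa (+) pc)) b c2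
     + 2%:R^-1 *: f01 + f10)
    (3%:R^-1 *: f02 + 2%:R^-1 *: f11 + f20).
Proof.
move=> ga gb gc gb0 gb1 gb2 gc0 gc1 gc2 hb hc hf0 hf1 hf2 m n v.
have two : 2%:R != 0 :> C by rewrite pnatr_eq0.
have three : 3%:R != 0 :> C by rewrite pnatr_eq0.
have e1 : sg ((pa (+) pb) && pc) = sg (pb && pc) * sg (pa && pc).
  by case: (pa) (pb) (pc) => -[] []; rewrite /sg /= ?expr0 ?expr1; ring.
have e2 : sg (pb && (pa (+) pc)) = sg (pb && pc) * sg (pa && pb).
  by case: (pa) (pb) (pc) => -[] []; rewrite /sg /= ?expr0 ?expr1; ring.
have e3 : sg (pa && (pb (+) pc)) = sg (pa && pb) * sg (pa && pc).
  by case: (pa) (pb) (pc) => -[] []; rewrite /sg /= ?expr0 ?expr1; ring.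
have la := good_lin ga; have lb := good_lin gb; have lc := good_lin gc.
have ee := sg_sq R (pa && pb).
have HB k w : a m (b k w) = sg (pa && pb) *: b k (a m w) + (b0 (m + k) w
    + m%:~R *: b1 (m - 1 + k) w + (m * (m - 1))%:~R *: b2 (m - 2 + k) w).
  by apply: etrans (comm_move (hb m k w)) _; vring.
have HC k w : a m (c k w) = sg (pa && pc) *: c k (a m w) + (c0 (m + k) w
    + m%:~R *: c1 (m - 1 + k) w + (m * (m - 1))%:~R *: c2 (m - 2 + k) w).
  by apply: etrans (comm_move (hc m k w)) _; vring.
have fF0 := lfin_shterm ((pa (+) pb) && pc) m (n + m) v gb0 gc.
have fF1 := lfin_shterm ((pa (+) pb) && pc) (m - 1) (n + m - 1) v gb1 gc.
have fF2 := lfin_shterm ((pa (+) pb) && pc) (m - 2) (n + m - 2) v gb2 gc.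
have fG0 := lfin_nop (pb && (pa (+) pc)) (n + m) v gb gc0.
have fG1 := lfin_nop (pb && (pa (+) pc)) (n + m - 1) v gb gc1.
have fG2 := lfin_nop (pb && (pa (+) pc)) (n + m - 2) v gb gc2.
have fL := lfin_lin (la m) (lfin_nop (pb && pc) n v gb gc).
have fR := lfin_nop (pb && pc) n (a m v) gb gc.
apply: etrans (esym _) _.
  apply: etrans (lfsumB (sg (pa && (pb (+) pc))) fL fR) _.
  by rewrite -(lfsum_lin (la m) (lfin_nop (pb && pc) n v gb gc)).
(* Once a_m has passed b, the coefficient b_k carries the mode (m - k) - 1 - j: its product with c
   is split at m - k instead of 0, and [shift_split] restores the normal order at the price of the
   brackets of b_k with c. The terms in which a_m meets c are normally ordered already. *)
have -> : lfsum (fun j => (a m \o nterm (pb && pc) b c n v) j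
      - sg (pa && (pb (+) pc)) *: nterm (pb && pc) b c n (a m v) j)
  = lfsum (fun j =>
      (shterm ((pa (+) pb) && pc) b0 c m (n + m) v j
       + m%:~R *: shterm ((pa (+) pb) && pc) b1 c (m - 1) (n + m - 1) v j
       + (m * (m - 1))%:~R *: shterm ((pa (+) pb) && pc) b2 c (m - 2) (n + m - 2) v j)
      - (- sg (pa && pb)) *: (nterm (pb && (pa (+) pc)) b c0 (n + m) v j
       + m%:~R *: nterm (pb && (pa (+) pc)) b c1 (n + m - 1) v j
       + (m * (m - 1))%:~R *: nterm (pb && (pa (+) pc)) b c2 (n + m - 2) v j)).
  apply: eq_lfsum => j; rewrite /nterm /shterm /=.
  rewrite (linD (la m)) (linZ (la m)).
  have E1 := HB (Negz j) (c (n + j%:Z) v).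
  rewrite (HC (n + j%:Z) v) (lin_comb3 _ _ _ _ _ _ _ (lb (Negz j))) in E1.
  have E2 := HC (n - j%:Z - 1) (b j%:Z v).
  rewrite (HB j%:Z v) (lin_comb3 _ _ _ _ _ _ _ (lc (n - j%:Z - 1))) in E2.
  rewrite E1 E2 e1 e2 e3.
  have ecc : sg (pb && pc) * sg (pb && pc) = 1 := sg_sq R _.
  by vlin; ring: ee.
apply: etrans (lfsumB _ (lfin3 _ _ fF0 fF1 fF2) (lfin3 _ _ fG0 fG1 fG2)) _.
apply: etrans (congr2 (fun x y => x - (- sg (pa && pb)) *: y)
  (etrans (lfsum3 _ _ fF0 fF1 fF2) (comb3 _ _ (shift_split m (n + m) v gb0 gc hf0)
     (shift_split (m - 1) (n + m - 1) v gb1 gc hf1)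
     (shift_split (m - 2) (n + m - 2) v gb2 gc hf2)))
  (etrans (lfsum3 _ _ fG0 fG1 fG2)
     (comb3 _ _ (esym (nopE _ _ _ _ _)) (esym (nopE _ _ _ _ _))
       (esym (nopE _ _ _ _ _))))) _.
by vring.
Qed.

End Brackets.

Ltac good_field :=
  lazymatch goal with
  | |- good (Defs.nop _ _ _) => apply good_nop; good_field
  | |- good (Defs.deriv _) => apply good_deriv; good_field
  | |- good (@GRing.add _ _ _) => apply goodD; good_field
  | |- good (@GRing.opp _ _) => apply goodN; good_field
  | |- good (@GRing.scale _ _ _ _) => apply goodZ; good_field
  | |- good (@GRing.zero _) => apply good0
  | |- good (@Defs.bos _ _ _ _) => apply bos_good
  | |- good (@Defs.fer _ _ _ _) => apply fer_good
  | |- good (@Defs.chi _ _ _) => apply good_nop; apply fer_good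
  | |- good (@idf _ _) => apply good_idf
  | |- good _ => assumption
  end.

Section FieldNormalisation.
Variables (R : realType) (N : nat).
Local Notation V := (fock R N).
Local Notation field := (field R N).

Lemma coef_field k (a b : field) n (v : V) x :
  a = b -> coef k (b n v) = x -> coef k (a n v) = x.
Proof. by move=> ->. Qed.

Lemma sg_false : sg R false = 1. Proof. by []. Qed.
Lemma sg_true : sg R true = -1. Proof. by rewrite /sg expr1. Qed.

End FieldNormalisation.

(** Like [coef_norm], but it also expands normally ordered products bilinearly and derivatives by
    the Leibniz rule, proving goodness on the way. *)
Ltac field_norm :=
  lazymatch goal with |- coef _ ?t = _ =>
    lazymatch t with
    | @GRing.add _ _ _ => eapply coef_add; [field_norm|field_norm]
    | @GRing.opp _ _ => eapply coef_opp; field_norm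
    | @GRing.scale _ _ _ _ => eapply coef_scale; field_norm
    | @GRing.zero _ => apply coef0
    | @GRing.add _ _ _ _ _ => eapply coef_fieldD; field_norm
    | @GRing.opp _ _ _ _ => eapply coef_fieldN; field_norm
    | @GRing.scale _ _ _ _ _ _ => eapply coef_fieldZ; field_norm
    | @GRing.zero _ _ _ => apply coef_field0
    | Defs.nop _ (@GRing.add _ _ _) _ _ _ =>
        eapply coef_field; [apply nopDl; good_field|field_norm]
    | Defs.nop _ (@GRing.opp _ _) _ _ _ =>
        eapply coef_field; [apply nopNl; good_field|field_norm]
    | Defs.nop _ (@GRing.scale _ _ _ _) _ _ _ =>
        eapply coef_field; [apply nopZl; good_field|field_norm]
    | Defs.nop _ (@GRing.zero _) _ _ _ =>
        eapply coef_field; [apply nop0l; good_field|field_norm]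
    | Defs.nop false (@idf _ _) _ _ _ =>
        eapply coef_field; [apply nop_idl; good_field|field_norm]
    | Defs.nop _ _ (@GRing.add _ _ _) _ _ =>
        eapply coef_field; [apply nopDr; good_field|field_norm]
    | Defs.nop _ _ (@GRing.opp _ _) _ _ =>
        eapply coef_field; [apply nopNr; good_field|field_norm]
    | Defs.nop _ _ (@GRing.scale _ _ _ _) _ _ =>
        eapply coef_field; [apply nopZr; good_field|field_norm]
    | Defs.nop _ _ (@GRing.zero _) _ _ =>
        eapply coef_field; [apply nop0r; good_field|field_norm]
    | Defs.nop false _ (@idf _ _) _ _ =>
        eapply coef_field; [apply nop_idr; good_field|field_norm]
    | Defs.deriv (@idf _ _) _ _ =>
        eapply coef_field; [apply deriv_idf|field_norm]
    | Defs.deriv (@GRing.zero _) _ _ =>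
        eapply coef_field; [apply fderiv0|field_norm]
    | Defs.deriv (@GRing.add _ _ _) _ _ =>
        eapply coef_field; [apply fderivD|field_norm]
    | Defs.deriv (@GRing.opp _ _) _ _ =>
        eapply coef_field; [apply fderivN|field_norm]
    | Defs.deriv (@GRing.scale _ _ _ _) _ _ =>
        eapply coef_field; [apply fderivZ|field_norm]
    | Defs.deriv (Defs.nop _ _ _) _ _ =>
        eapply coef_field; [apply deriv_nop; good_field|field_norm]
    | Defs.deriv _ _ _ => eapply coef_fderiv; field_norm
    | _ => reflexivity
    end
  end.

Ltac flin :=
  apply eq_field; intros; apply coefP; intro;
  eapply eq_trans; [field_norm|eapply eq_trans; [|symmetry; field_norm]];
  mode_match;
  repeat match goal with |- context [coef ?b ?t] => generalize (coef b t); intro end.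
Ltac fring :=
  flin; rewrite ?sg_true ?sg_false;
  first [ring
        (* The inverse of a variable number such as N is frozen as an atom, so that [field] only has
           to invert numerals. *)
        |repeat match goal with |- context [GRing.inv (GRing.natmul ?x ?n)] =>
           is_var n; generalize (GRing.inv (GRing.natmul x n)); intro end;
         field; done].

(** * The Wick formula by parity, and the brackets of the generators *)

Section N2Brackets.
Variables (R : realType) (N : nat).
Local Notation C := R[i].
Local Notation V := (fock R N).
Local Notation field := (field R N).
Local Notation deriv := (@Defs.deriv R N).
Local Notation idf := (@idf R N).
Local Notation sg := (@sg R).
Local Notation bos := (@bos R N).
Local Notation fer := (@fer R N).
Implicit Types (a b c e f : field) (s t : bool) (m n p q : int) (v : V) (i j : 'I_N).

(** The Wick formula with evaluated signs, in the three parity patterns that occur: a even with b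
    and c of equal parity; a odd, b even, c odd ([eo]); all three odd ([oo]). *)
Lemma brk_nop_even s a b c b0 b1 b2 c0 c1 c2 f00 f01 f02 f10 f11 f20 :
  good a -> good b -> good c ->
  good b0 -> good b1 -> good b2 -> good c0 -> good c1 -> good c2 ->
  brk false a b b0 b1 b2 0 -> brk false a c c0 c1 c2 0 ->
  brk s b0 c f00 f01 f02 0 -> brk s b1 c f10 f11 0 0 -> brk s b2 c f20 0 0 0 ->
  brk false a (nop s b c) (nop s b0 c + nop s b c0) (nop s b1 c + nop s b c1 + f00)
    (nop s b2 c + nop s b c2 + 2%:R^-1 *: f01 + f10)
    (3%:R^-1 *: f02 + 2%:R^-1 *: f11 + f20).
Proof.
move=> ga gb gc gb0 gb1 gb2 gc0 gc1 gc2 hb hc h0 h1 h2.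
have es : sg false = 1 :> C by [].
by case: s h0 h1 h2 => h0 h1 h2;
  [have := @brk_nop R N false true true a b c b0 b1 b2 c0 c1 c2 f00 f01 f02 f10 f11 f20
    ga gb gc gb0 gb1 gb2 gc0 gc1 gc2 hb hc h0 h1 h2
  |have := @brk_nop R N false false false a b c b0 b1 b2 c0 c1 c2 f00 f01 f02 f10 f11 f20
    ga gb gc gb0 gb1 gb2 gc0 gc1 gc2 hb hc h0 h1 h2];
  cbn [andb addb negb]; move/brk_eq; apply; apply: eq_field => n v; vlin; rewrite ?es; ring.
Qed.

Lemma brk_nop_eo a b c b0 b1 b2 c0 c1 c2 f00 f01 f02 f10 f11 f20 :
  good a -> good b -> good c ->
  good b0 -> good b1 -> good b2 -> good c0 -> good c1 -> good c2 ->
  brk false a b b0 b1 b2 0 -> brk true a c c0 c1 c2 0 ->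
  brk true b0 c f00 f01 f02 0 -> brk true b1 c f10 f11 0 0 -> brk true b2 c f20 0 0 0 ->
  brk true a (nop false b c) (nop true b0 c + nop false b c0)
    (nop true b1 c + nop false b c1 + f00)
    (nop true b2 c + nop false b c2 + 2%:R^-1 *: f01 + f10)
    (3%:R^-1 *: f02 + 2%:R^-1 *: f11 + f20).
Proof.
move=> ga gb gc gb0 gb1 gb2 gc0 gc1 gc2 hb hc h0 h1 h2.
have es : sg false = 1 :> C by [].
have := @brk_nop R N true false true a b c b0 b1 b2 c0 c1 c2 f00 f01 f02 f10 f11 f20
  ga gb gc gb0 gb1 gb2 gc0 gc1 gc2 hb hc h0 h1 h2.
by cbn [andb addb negb]; move/brk_eq; apply; apply: eq_field => n v; vlin; rewrite ?es; ring.
Qed.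

Lemma brk_nop_oo a b c b0 b1 b2 c0 c1 c2 f00 f01 f02 f10 f11 f20 :
  good a -> good b -> good c ->
  good b0 -> good b1 -> good b2 -> good c0 -> good c1 -> good c2 ->
  brk true a b b0 b1 b2 0 -> brk true a c c0 c1 c2 0 ->
  brk false b0 c f00 f01 f02 0 -> brk false b1 c f10 f11 0 0 -> brk false b2 c f20 0 0 0 ->
  brk false a (nop true b c) (nop false b0 c - nop false b c0)
    (nop false b1 c - nop false b c1 + f00)
    (nop false b2 c - nop false b c2 + 2%:R^-1 *: f01 + f10)
    (3%:R^-1 *: f02 + 2%:R^-1 *: f11 + f20).
Proof.
move=> ga gb gc gb0 gb1 gb2 gc0 gc1 gc2 hb hc h0 h1 h2.
have es : sg true = -1 :> C by rewrite /sg expr1.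
have := @brk_nop R N true true true a b c b0 b1 b2 c0 c1 c2 f00 f01 f02 f10 f11 f20
  ga gb gc gb0 gb1 gb2 gc0 gc1 gc2 hb hc h0 h1 h2.
by cbn [andb addb negb]; move/brk_eq; apply; apply: eq_field => n v; vlin; rewrite ?es; ring.
Qed.

Definition dl s t i j : C := ((s != t) && (i == j))%:R.

Lemma brk_bos s t i j : brk false (bos s i) (bos t j) 0 (dl s t i j *: idf) 0 0.
Proof.
move=> m n v; rewrite /sg expr0 vscale1r bos_comm.
rewrite [X in _ = X + _ + _ + _]field0 fieldZ /idf /dl.
have -> : (m + n - 1 == -1) = (m + n == 0) by lia.
by case: ((s != t) && (i == j)) => /=; case: (m + n == 0) => /=; vring.
Qed.

Lemma brk_fer s t i j : brk true (fer s i) (fer t j) (dl s t i j *: idf) 0 0 0.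
Proof.
move=> m n v; rewrite /sg expr1 scaleN1r opprK fer_comm.
rewrite fieldZ /idf /dl.
by case: ((s != t) && (i == j)) => /=; case: (m + n == -1) => /=; vring.
Qed.

Lemma brk_bos_fer s t i j : brk false (bos s i) (fer t j) 0 0 0 0.
Proof.
by move=> m n v; rewrite /sg expr0 vscale1r bos_fer_comm; vring.
Qed.

Lemma brk_fer_bos s t i j : brk false (fer s i) (bos t j) 0 0 0 0.
Proof.
by move=> m n v; rewrite /sg expr0 vscale1r bos_fer_comm; vring.
Qed.

Lemma brk_0l s b : good b -> brk s 0 b 0 0 0 0.
Proof. by move=> gb m n v; rewrite !field0 (lin0 (good_lin gb _)); vring. Qed.

Lemma brk_idl b : good b -> brk false idf b 0 0 0 0.
Proof.
move=> gb m n v; rewrite /idf /sg expr0 vscale1r.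
by case: ifP => _; rewrite ?(lin0 (good_lin gb _)); vring.
Qed.

Lemma brk_Zl s k a b e0 e1 e2 e3 : good b -> brk s a b e0 e1 e2 e3 ->
  brk s (k *: a) b (k *: e0) (k *: e1) (k *: e2) (k *: e3).
Proof.
move=> gb hb m n v; rewrite [(k *: a) m v]fieldZ [(k *: a) m (b n v)]fieldZ.
rewrite (linZ (good_lin gb n)).
by apply: etrans (commZ _ _ _ _) _; rewrite hb; vring.
Qed.

Lemma brk_derivl s a b e0 e1 e2 : good b -> brk s a b e0 e1 e2 0 ->
  brk s (deriv a) b 0 (- e0) (- e1) (- e2).
Proof.
move=> gb hb m n v; rewrite {1 2}/Defs.deriv (linZ (good_lin gb n)).
by apply: etrans (commZ _ _ _ _) _; rewrite hb; vring.
Qed.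

Lemma brkN s a b e0 e1 e2 e3 : good a -> brk s a b e0 e1 e2 e3 ->
  brk s a (- b) (- e0) (- e1) (- e2) (- e3).
Proof.
move=> ga hb; have := brkZ (-1) ga hb; move/brk_eq => h.
by rewrite -scaleN1r; apply: h; apply: scaleN1r.
Qed.

Lemma brk_Zidl k b : good b -> brk false (k *: idf) b 0 0 0 0.
Proof.
move=> gb; refine (brk_eq (brk_Zl k gb (brk_idl gb)) _ _ _ _); exact: scaler0.
Qed.

End N2Brackets.

Ltac brk_goal :=
  lazymatch goal with
  | |- good _ => good_field
  | |- _ = _ => fring
  end.

(** * The free field realization of the N = 2 algebra *)

Section GeometricBrackets.
Variables (R : realType) (N : nat).
Local Notation C := R[i].
Local Notation field := (field R N).
Local Notation deriv := (@Defs.deriv R N).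
Local Notation idf := (@idf R N).
Local Notation X := (@bos R N false).
Local Notation A := (@bos R N true).
Local Notation P := (@fer R N false).
Local Notation Q := (@fer R N true).
Local Notation chi := (@chi R N).
Implicit Types (i j : 'I_N).
Local Notation d i j := ((i == j)%:R : C).
Local Notation ni := (N%:R^-1 : C).

Lemma brkXX i j : brk false (X i) (X j) 0 0 0 0.
Proof. by refine (brk_eq (@brk_bos R N _ _ _ _) _ _ _ _); rewrite /dl /= ?scale0r. Qed.
Lemma brkAA i j : brk false (A i) (A j) 0 0 0 0.
Proof. by refine (brk_eq (@brk_bos R N _ _ _ _) _ _ _ _); rewrite /dl /= ?scale0r. Qed.
Lemma brkXA i j : brk false (X i) (A j) 0 (d i j *: idf) 0 0.
Proof. exact: brk_bos. Qed.
Lemma brkAX i j : brk false (A i) (X j) 0 (d i j *: idf) 0 0.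
Proof. exact: brk_bos. Qed.
Lemma brkPP i j : brk true (P i) (P j) 0 0 0 0.
Proof. by refine (brk_eq (@brk_fer R N _ _ _ _) _ _ _ _); rewrite /dl /= ?scale0r. Qed.
Lemma brkQQ i j : brk true (Q i) (Q j) 0 0 0 0.
Proof. by refine (brk_eq (@brk_fer R N _ _ _ _) _ _ _ _); rewrite /dl /= ?scale0r. Qed.
Lemma brkPQ i j : brk true (P i) (Q j) (d i j *: idf) 0 0 0.
Proof. exact: brk_fer. Qed.
Lemma brkQP i j : brk true (Q i) (P j) (d i j *: idf) 0 0 0.
Proof. exact: brk_fer. Qed.

(** The summands of the four free field expressions. The letters X, A, P, Q stand for X_j, X*_j,
    psi_j, psi*_j; the current Q of the N = 2 algebra is [sumQ]. *)
Definition sumG j : field := nop false (A j) (P j) - deriv (P j).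
Definition sumQ j : field := nop false (X j) (Q j) - ni *: deriv (Q j).
Definition sumJ j : field := - (ni *: A j) + X j + chi j.
Definition sumL j : field :=
  nop false (X j) (A j) - deriv (X j) + nop true (deriv (Q j)) (P j).

Let gA i : good (A i) := bos_good R true i.
Let gP i : good (P i) := fer_good R false i.
Let gQ i : good (Q i) := fer_good R true i.
Local Notation b00 := (@brk_0l R N _ _).
Local Notation bid := (fun k b gb => @brk_Zidl R N k b gb).
Local Notation bf := (@brk_bos_fer R N _ _ _ _).
Local Notation fb := (@brk_fer_bos R N _ _ _ _).

(** This and the following lemmas tabulate the brackets of generators with summands; the arguments
    after the two outer brackets are the inner brackets demanded by the Wick formula. *)
Lemma AsumG j i : brk false (A j) (sumG i) 0 0 0 0.
Proof.
refine (brk_eq (brkD _ (brk_nop_even _ _ _ _ _ _ _ _ _ (brkAA j i) bf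
  (b00 (gP i)) (b00 (gP i)) (b00 (gP i)))
  (brkN _ (brk_deriv _ bf))) _ _ _ _); brk_goal.
Qed.

Lemma PsumG j i : brk true (P j) (sumG i) 0 0 0 0.
Proof.
refine (brk_eq (brkD _ (brk_nop_eo _ _ _ _ _ _ _ _ _ fb (brkPP j i)
  (b00 (gP i)) (b00 (gP i)) (b00 (gP i)))
  (brkN _ (brk_deriv _ (brkPP j i)))) _ _ _ _); brk_goal.
Qed.

Lemma XsumQ j i : brk false (X j) (sumQ i) 0 0 0 0.
Proof.
refine (brk_eq (brkD _ (brk_nop_even _ _ _ _ _ _ _ _ _ (brkXX j i) bf
  (b00 (gQ i)) (b00 (gQ i)) (b00 (gQ i)))
  (brkN _ (brkZ ni _ (brk_deriv _ bf)))) _ _ _ _); brk_goal.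
Qed.

Lemma AsumQ j i : brk false (A j) (sumQ i) 0 (d j i *: Q i) 0 0.
Proof.
refine (brk_eq (brkD _ (brk_nop_even _ _ _ _ _ _ _ _ _ (brkAX j i) bf
  (b00 (gQ i)) (bid _ _ (gQ i)) (b00 (gQ i)))
  (brkN _ (brkZ ni _ (brk_deriv _ bf)))) _ _ _ _); brk_goal.
Qed.

Lemma PsumQ j i : brk true (P j) (sumQ i) (d j i *: X i) (- (ni * d j i) *: idf) 0 0.
Proof.
refine (brk_eq (brkD _ (brk_nop_eo _ _ _ _ _ _ _ _ _ fb (brkPQ j i)
  (b00 (gQ i)) (b00 (gQ i)) (b00 (gQ i)))
  (brkN _ (brkZ ni _ (brk_deriv _ (brkPQ j i))))) _ _ _ _); brk_goal.
Qed.

Lemma QsumQ j i : brk true (Q j) (sumQ i) 0 0 0 0.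
Proof.
refine (brk_eq (brkD _ (brk_nop_eo _ _ _ _ _ _ _ _ _ fb (brkQQ j i)
  (b00 (gQ i)) (b00 (gQ i)) (b00 (gQ i)))
  (brkN _ (brkZ ni _ (brk_deriv _ (brkQQ j i))))) _ _ _ _); brk_goal.
Qed.

Lemma bos_chi s j i : brk false (@bos R N s j) (chi i) 0 0 0 0.
Proof.
refine (brk_eq (brk_nop_even _ _ _ _ _ _ _ _ _ bf bf
  (b00 (gQ i)) (b00 (gQ i)) (b00 (gQ i))) _ _ _ _); brk_goal.
Qed.

Lemma P_chi j i : brk false (P j) (chi i) (- d j i *: P i) 0 0 0.
Proof.
refine (brk_eq (brk_nop_oo _ _ _ _ _ _ _ _ _ (brkPP j i) (brkPQ j i)
  (b00 (gQ i)) (b00 (gQ i)) (b00 (gQ i))) _ _ _ _); brk_goal.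
Qed.

Lemma Q_chi j i : brk false (Q j) (chi i) (d j i *: Q i) 0 0 0.
Proof.
refine (brk_eq (brk_nop_oo _ _ _ _ _ _ _ _ _ (brkQP j i) (brkQQ j i)
  (bid _ _ (gQ i)) (b00 (gQ i)) (b00 (gQ i))) _ _ _ _); brk_goal.
Qed.

Lemma XsumJ j i : brk false (X j) (sumJ i) 0 (- (ni * d j i) *: idf) 0 0.
Proof.
refine (brk_eq (brkD _ (brkD _ (brkN _ (brkZ ni _ (brkXA j i))) (brkXX j i))
  (bos_chi false j i)) _ _ _ _); brk_goal.
Qed.

Lemma AsumJ j i : brk false (A j) (sumJ i) 0 (d j i *: idf) 0 0.
Proof.
refine (brk_eq (brkD _ (brkD _ (brkN _ (brkZ ni _ (brkAA j i))) (brkAX j i))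
  (bos_chi true j i)) _ _ _ _); brk_goal.
Qed.

Lemma PsumJ j i : brk false (P j) (sumJ i) (- d j i *: P i) 0 0 0.
Proof.
refine (brk_eq (brkD _ (brkD _ (brkN _ (brkZ ni _ fb)) fb)
  (P_chi j i)) _ _ _ _); brk_goal.
Qed.

Lemma QsumJ j i : brk false (Q j) (sumJ i) (d j i *: Q i) 0 0 0.
Proof.
refine (brk_eq (brkD _ (brkD _ (brkN _ (brkZ ni _ fb)) fb)
  (Q_chi j i)) _ _ _ _); brk_goal.
Qed.

Lemma derivQ_brk (a : field) i : good a -> brk false a (Q i) 0 0 0 0 ->
  brk false a (deriv (Q i)) 0 0 0 0.
Proof. by move=> ga h; refine (brk_eq (brk_deriv ga h) _ _ _ _); brk_goal. Qed.

Lemma bos_QP s j i : brk false (@bos R N s j) (nop true (deriv (Q i)) (P i)) 0 0 0 0.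
Proof.
refine (brk_eq (brk_nop_even _ _ _ _ _ _ _ _ _ (derivQ_brk _ bf) bf
  (b00 (gP i)) (b00 (gP i)) (b00 (gP i))) _ _ _ _); brk_goal.
Qed.

Lemma P_derivQ j i : brk true (P j) (deriv (Q i)) 0 (d j i *: idf) 0 0.
Proof. refine (brk_eq (brk_deriv _ (brkPQ j i)) _ _ _ _); brk_goal. Qed.

Lemma Q_derivQ j i : brk true (Q j) (deriv (Q i)) 0 0 0 0.
Proof. refine (brk_eq (brk_deriv _ (brkQQ j i)) _ _ _ _); brk_goal. Qed.

Lemma P_QP j i : brk false (P j) (nop true (deriv (Q i)) (P i)) 0 (d j i *: P i) 0 0.
Proof.
refine (brk_eq (brk_nop_oo _ _ _ _ _ _ _ _ _ (P_derivQ j i) (brkPP j i)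
  (b00 (gP i)) (bid _ _ (gP i)) (b00 (gP i))) _ _ _ _); brk_goal.
Qed.

Lemma Q_QP j i : brk false (Q j) (nop true (deriv (Q i)) (P i))
  (- d j i *: deriv (Q i)) 0 0 0.
Proof.
refine (brk_eq (brk_nop_oo _ _ _ _ _ _ _ _ _ (Q_derivQ j i) (brkQP j i)
  (b00 (gP i)) (b00 (gP i)) (b00 (gP i))) _ _ _ _); brk_goal.
Qed.

Lemma XsumL j i : brk false (X j) (sumL i) 0 (d j i *: X i) 0 0.
Proof.
refine (brk_eq (brkD _ (brkD _ (brk_nop_even _ _ _ _ _ _ _ _ _ (brkXX j i) (brkXA j i)
  (b00 (gA i)) (b00 (gA i)) (b00 (gA i)))
  (brkN _ (brk_deriv _ (brkXX j i)))) (bos_QP false j i)) _ _ _ _); brk_goal.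
Qed.

Lemma AsumL j i : brk false (A j) (sumL i) 0 (d j i *: A i) (- d j i *: idf) 0.
Proof.
refine (brk_eq (brkD _ (brkD _ (brk_nop_even _ _ _ _ _ _ _ _ _ (brkAX j i) (brkAA j i)
  (b00 (gA i)) (bid _ _ (gA i)) (b00 (gA i)))
  (brkN _ (brk_deriv _ (brkAX j i)))) (bos_QP true j i)) _ _ _ _); brk_goal.
Qed.

Lemma PsumL j i : brk false (P j) (sumL i) 0 (d j i *: P i) 0 0.
Proof.
refine (brk_eq (brkD _ (brkD _ (brk_nop_even _ _ _ _ _ _ _ _ _ fb fb
  (b00 (gA i)) (b00 (gA i)) (b00 (gA i)))
  (brkN _ (brk_deriv _ fb))) (P_QP j i)) _ _ _ _); brk_goal.
Qed.

Lemma QsumL j i : brk false (Q j) (sumL i) (- d j i *: deriv (Q i)) 0 0 0.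
Proof.
refine (brk_eq (brkD _ (brkD _ (brk_nop_even _ _ _ _ _ _ _ _ _ fb fb
  (b00 (gA i)) (b00 (gA i)) (b00 (gA i)))
  (brkN _ (brk_deriv _ fb))) (Q_QP j i)) _ _ _ _); brk_goal.
Qed.

Definition totG : field := \sum_j sumG j.
Definition totQ : field := \sum_j sumQ j.
Definition totJ : field := \sum_j sumJ j.
Definition totL : field := \sum_j sumL j.

Lemma good_sumG j : good (sumG j). Proof. rewrite /sumG; good_field. Qed.
Lemma good_sumQ j : good (sumQ j). Proof. rewrite /sumQ; good_field. Qed.
Lemma good_sumJ j : good (sumJ j). Proof. rewrite /sumJ; good_field. Qed.
Lemma good_sumL j : good (sumL j). Proof. rewrite /sumL; good_field. Qed.
Lemma gG : good totG. Proof. by apply: good_sum; apply: good_sumG. Qed.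
Lemma gQQ : good totQ. Proof. by apply: good_sum; apply: good_sumQ. Qed.
Lemma gJ : good totJ. Proof. by apply: good_sum; apply: good_sumJ. Qed.
Lemma gL : good totL. Proof. by apply: good_sum; apply: good_sumL. Qed.

Lemma sum_delta (k : C) j (F : 'I_N -> field) : \sum_i (k * d j i) *: F i = k *: F j.
Proof.
have h : \sum_(i | i != j) (k * d j i) *: F i = 0.
  by apply: big1 => i ij; rewrite eq_sym (negPf ij) mulr0 scale0r.
have e : \sum_i (k * d j i) *: F i = (k * d j j) *: F j
  + \sum_(i | i != j) (k * d j i) *: F i by exact: (bigD1 j isT).
by rewrite e h addr0 eqxx mulr1.
Qed.

(** The brackets with a generator are diagonal in the variables, so the sum over i retains only i =
    j; the shape of the coefficients is chosen for [sum_delta]. *)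
Lemma brk_tot s (a : field) (f : 'I_N -> field) j (k0 k1 k2 : C) (e0 e1 e2 : 'I_N -> field) :
  good a -> (forall i, brk s a (f i) ((k0 * d j i) *: e0 i) ((k1 * d j i) *: e1 i)
     ((k2 * d j i) *: e2 i) 0) ->
  brk s a (\sum_i f i) (k0 *: e0 j) (k1 *: e1 j) (k2 *: e2 j) 0.
Proof.
move=> ga h; refine (brk_eq (brk_sum (index_enum 'I_N) ga h) _ _ _ _);
  try exact: sum_delta.
exact: big1_eq.
Qed.

(** From here on the total field stands first, by skew-symmetry: in this form its bracket with a
    product of generators is again an instance of the Wick formula. *)
Lemma totG_A j : brk false totG (A j) (0) (0) (0) 0.
Proof.
refine (brk_eq (brk_skew (@brk_tot false _ _ j 0 0 0 (fun _ => 0) (fun _ => 0) (fun _ => 0) _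
  (fun i => brk_eq (AsumG j i) _ _ _ _))) _ _ _ _); brk_goal.
Qed.

Lemma totG_P j : brk true totG (P j) (0) (0) (0) 0.
Proof.
refine (brk_eq (brk_skew (@brk_tot true _ _ j 0 0 0 (fun _ => 0) (fun _ => 0) (fun _ => 0) _
  (fun i => brk_eq (PsumG j i) _ _ _ _))) _ _ _ _); brk_goal.
Qed.

Lemma totQ_X j : brk false totQ (X j) (0) (0) (0) 0.
Proof.
refine (brk_eq (brk_skew (@brk_tot false _ _ j 0 0 0 (fun _ => 0) (fun _ => 0) (fun _ => 0) _
  (fun i => brk_eq (XsumQ j i) _ _ _ _))) _ _ _ _); brk_goal.
Qed.

Lemma totQ_A j : brk false totQ (A j) (deriv (Q j)) (Q j) (0) 0.
Proof.
refine (brk_eq (brk_skew (@brk_tot false _ _ j 0 1 0 (fun _ => 0) (fun i => Q i) (fun _ => 0) _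
  (fun i => brk_eq (AsumQ j i) _ _ _ _))) _ _ _ _); brk_goal.
Qed.

Lemma totQ_P j : brk true totQ (P j) (X j) (ni *: idf) (0) 0.
Proof.
refine (brk_eq (brk_skew (@brk_tot true _ _ j 1 (- ni) 0 (fun i => X i) (fun _ => idf) (fun _ => 0) _
  (fun i => brk_eq (PsumQ j i) _ _ _ _))) _ _ _ _); brk_goal.
Qed.

Lemma totQ_Q j : brk true totQ (Q j) (0) (0) (0) 0.
Proof.
refine (brk_eq (brk_skew (@brk_tot true _ _ j 0 0 0 (fun _ => 0) (fun _ => 0) (fun _ => 0) _
  (fun i => brk_eq (QsumQ j i) _ _ _ _))) _ _ _ _); brk_goal.
Qed.

Lemma totJ_X j : brk false totJ (X j) (0) (- ni *: idf) (0) 0.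
Proof.
refine (brk_eq (brk_skew (@brk_tot false _ _ j 0 (- ni) 0 (fun _ => 0) (fun _ => idf) (fun _ => 0) _
  (fun i => brk_eq (XsumJ j i) _ _ _ _))) _ _ _ _); brk_goal.
Qed.

Lemma totJ_A j : brk false totJ (A j) (0) (idf) (0) 0.
Proof.
refine (brk_eq (brk_skew (@brk_tot false _ _ j 0 1 0 (fun _ => 0) (fun _ => idf) (fun _ => 0) _
  (fun i => brk_eq (AsumJ j i) _ _ _ _))) _ _ _ _); brk_goal.
Qed.

Lemma totJ_P j : brk false totJ (P j) (P j) (0) (0) 0.
Proof.
refine (brk_eq (brk_skew (@brk_tot false _ _ j (-1) 0 0 (fun i => P i) (fun _ => 0) (fun _ => 0) _
  (fun i => brk_eq (PsumJ j i) _ _ _ _))) _ _ _ _); brk_goal.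
Qed.

Lemma totJ_Q j : brk false totJ (Q j) (- Q j) (0) (0) 0.
Proof.
refine (brk_eq (brk_skew (@brk_tot false _ _ j 1 0 0 (fun i => Q i) (fun _ => 0) (fun _ => 0) _
  (fun i => brk_eq (QsumJ j i) _ _ _ _))) _ _ _ _); brk_goal.
Qed.

Lemma totL_X j : brk false totL (X j) (deriv (X j)) (X j) (0) 0.
Proof.
refine (brk_eq (brk_skew (@brk_tot false _ _ j 0 1 0 (fun _ => 0) (fun i => X i) (fun _ => 0) _
  (fun i => brk_eq (XsumL j i) _ _ _ _))) _ _ _ _); brk_goal.
Qed.

(** The anomalous last term is the background charge -X' of L: X*_j is not primary. *)
Lemma totL_A j : brk false totL (A j) (deriv (A j)) (A j) (idf) 0.
Proof.
refine (brk_eq (brk_skew (@brk_tot false _ _ j 0 1 (-1) (fun _ => 0) (fun i => A i) (fun _ => idf) _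
  (fun i => brk_eq (AsumL j i) _ _ _ _))) _ _ _ _); brk_goal.
Qed.

Lemma totL_P j : brk false totL (P j) (deriv (P j)) (P j) (0) 0.
Proof.
refine (brk_eq (brk_skew (@brk_tot false _ _ j 0 1 0 (fun _ => 0) (fun i => P i) (fun _ => 0) _
  (fun i => brk_eq (PsumL j i) _ _ _ _))) _ _ _ _); brk_goal.
Qed.

Lemma totL_Q j : brk false totL (Q j) (deriv (Q j)) (0) (0) 0.
Proof.
refine (brk_eq (brk_skew (@brk_tot false _ _ j (-1) 0 0 (fun i => deriv (Q i)) (fun _ => 0) (fun _ => 0) _
  (fun i => brk_eq (QsumL j i) _ _ _ _))) _ _ _ _); brk_goal.
Qed.

End GeometricBrackets.

(** * The N = 2 relations for the total fields *)

Section GeometricN2.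
Variables (R : realType) (N : nat).
Local Notation C := R[i].
Local Notation V := (fock R N).
Local Notation field := (field R N).
Local Notation deriv := (@Defs.deriv R N).
Local Notation idf := (@idf R N).
Local Notation X := (@bos R N false).
Local Notation A := (@bos R N true).
Local Notation P := (@fer R N false).
Local Notation Q := (@fer R N true).
Local Notation chi := (@chi R N).
Local Notation ni := (N%:R^-1 : C).
Local Notation sumG := (@sumG R N).
Local Notation sumQ := (@sumQ R N).
Local Notation sumJ := (@sumJ R N).
Local Notation sumL := (@sumL R N).
Local Notation totG := (@totG R N).
Local Notation totQ := (@totQ R N).
Local Notation totJ := (@totJ R N).
Local Notation totL := (@totL R N).
Implicit Types (i j : 'I_N).

Local Notation b00 := (@brk_0l R N _ _).
Local Notation bid := (fun k b gb => @brk_Zidl R N k b gb).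
Local Notation bf := (@brk_bos_fer R N _ _ _ _).

Lemma brk_derivl0 s (a b : field) : good b -> brk s a b 0 0 0 0 ->
  brk s (deriv a) b 0 0 0 0.
Proof. by move=> gb h; refine (brk_eq (brk_derivl gb h) _ _ _ _); brk_goal. Qed.

Lemma PQ1 j : brk true (P j) (Q j) idf 0 0 0.
Proof. by refine (brk_eq (@brkPQ R N j j) _ _ _ _); rewrite ?eqxx ?scale1r. Qed.
Lemma QP1 j : brk true (Q j) (P j) idf 0 0 0.
Proof. by refine (brk_eq (@brkQP R N j j) _ _ _ _); rewrite ?eqxx ?scale1r. Qed.
Let XA1 j : brk false (X j) (A j) 0 idf 0 0.
Proof. by refine (brk_eq (@brkXA R N j j) _ _ _ _); rewrite ?eqxx ?scale1r. Qed.
Let dPQ1 j : brk true (deriv (P j)) (Q j) 0 (- idf) 0 0.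
Proof. refine (brk_eq (brk_derivl _ (PQ1 j)) _ _ _ _); brk_goal. Qed.
Let dQP1 j : brk true (deriv (Q j)) (P j) 0 (- idf) 0 0.
Proof. refine (brk_eq (brk_derivl _ (QP1 j)) _ _ _ _); brk_goal. Qed.
Let ddQP1 j : brk true (deriv (deriv (Q j))) (P j) 0 0 idf 0.
Proof. refine (brk_eq (brk_derivl _ (dQP1 j)) _ _ _ _); brk_goal. Qed.
Let dXA1 j : brk false (deriv (X j)) (A j) 0 0 (- idf) 0.
Proof. refine (brk_eq (brk_derivl _ (XA1 j)) _ _ _ _); brk_goal. Qed.

Lemma totL_sumG j : brk false totL (sumG j) (deriv (sumG j)) (2%:R *: sumG j) 0 0.
Proof.
have gg := gL R N; rewrite /sumG.
refine (brk_eq (brkD _ (brk_nop_even _ _ _ _ _ _ _ _ _ (@totL_A R N j) (@totL_P R N j)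
  (brk_derivl0 _ bf) bf (brk_idl _))
  (brkN _ (brk_deriv _ (@totL_P R N j)))) _ _ _ _); brk_goal.
Qed.

Lemma totL_sumQ j : brk false totL (sumQ j) (deriv (sumQ j)) (sumQ j) 0 0.
Proof.
have gg := gL R N; rewrite /sumQ.
refine (brk_eq (brkD _ (brk_nop_even _ _ _ _ _ _ _ _ _ (@totL_X R N j) (@totL_Q R N j)
  (brk_derivl0 _ bf) bf (b00 _))
  (brkN _ (brkZ ni _ (brk_deriv _ (@totL_Q R N j))))) _ _ _ _); brk_goal.
Qed.

(** In the central term, -1/N is the anomaly of X*_j from [totL_A], and 1/2 = 1 - 1/2 collects the
    two double contractions inside chi_j. *)
Lemma totL_sumJ j :
  brk false totL (sumJ j) (deriv (sumJ j)) (sumJ j) ((2%:R^-1 - ni) *: idf) 0.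
Proof.
have gg := gL R N; rewrite /sumJ /Defs.chi.
refine (brk_eq (brkD _ (brkD _ (brkN _ (brkZ ni _ (@totL_A R N j))) (@totL_X R N j))
  (brk_nop_even _ _ _ _ _ _ _ _ _ (@totL_P R N j) (@totL_Q R N j) (dPQ1 j) (PQ1 j) (b00 _)))
  _ _ _ _); brk_goal.
Qed.

Let totL_dQ j : brk false totL (deriv (Q j)) (deriv (deriv (Q j))) (deriv (Q j)) 0 0.
Proof.
have gg := gL R N.
refine (brk_eq (brk_deriv _ (@totL_Q R N j)) _ _ _ _); brk_goal.
Qed.

Lemma totL_sumL j : brk false totL (sumL j) (deriv (sumL j)) (2%:R *: sumL j) 0 0.
Proof.
have gg := gL R N; rewrite /sumL.
have two : 2%:R != 0 :> C by rewrite pnatr_eq0.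
have three : 3%:R != 0 :> C by rewrite pnatr_eq0.
refine (brk_eq (brkD _ (brkD _
  (brk_nop_even _ _ _ _ _ _ _ _ _ (@totL_X R N j) (@totL_A R N j) (dXA1 j) (XA1 j) (b00 _))
  (brkN _ (brk_deriv _ (@totL_X R N j))))
  (brk_nop_even _ _ _ _ _ _ _ _ _ (totL_dQ j) (@totL_P R N j) (ddQP1 j) (dQP1 j) (b00 _)))
  _ _ _ _); brk_goal.
Qed.

(** The 1 is the double contraction in chi_j; each of X_j and X*_j contributes -1/N. *)
Lemma totJ_sumJ j : brk false totJ (sumJ j) 0 ((1 - 2%:R * ni) *: idf) 0 0.
Proof.
have gg := gJ R N; rewrite /sumJ /Defs.chi.
refine (brk_eq (brkD _ (brkD _ (brkN _ (brkZ ni _ (@totJ_A R N j))) (@totJ_X R N j))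
  (brk_nop_even _ _ _ _ _ _ _ _ _ (@totJ_P R N j) (@totJ_Q R N j) (PQ1 j) (b00 _) (b00 _)))
  _ _ _ _); brk_goal.
Qed.

Lemma totJ_sumG j : brk false totJ (sumG j) (sumG j) 0 0 0.
Proof.
have gg := gJ R N; rewrite /sumG.
refine (brk_eq (brkD _ (brk_nop_even _ _ _ _ _ _ _ _ _ (@totJ_A R N j) (@totJ_P R N j)
  (b00 _) (brk_idl _) (b00 _))
  (brkN _ (brk_deriv _ (@totJ_P R N j)))) _ _ _ _); brk_goal.
Qed.

Lemma totJ_sumQ j : brk false totJ (sumQ j) (- sumQ j) 0 0 0.
Proof.
have gg := gJ R N; rewrite /sumQ.
refine (brk_eq (brkD _ (brk_nop_even _ _ _ _ _ _ _ _ _ (@totJ_X R N j) (@totJ_Q R N j)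
  (b00 _) (bid _ _ _) (b00 _))
  (brkN _ (brkZ ni _ (brk_deriv _ (@totJ_Q R N j))))) _ _ _ _); brk_goal.
Qed.

Lemma totG_sumG j : brk true totG (sumG j) 0 0 0 0.
Proof.
have gg := gG R N; rewrite /sumG.
refine (brk_eq (brkD _ (brk_nop_eo _ _ _ _ _ _ _ _ _ (@totG_A R N j) (@totG_P R N j)
  (b00 _) (b00 _) (b00 _))
  (brkN _ (brk_deriv _ (@totG_P R N j)))) _ _ _ _); brk_goal.
Qed.

Lemma totQ_sumQ j : brk true totQ (sumQ j) 0 0 0 0.
Proof.
have gg := gQQ R N; rewrite /sumQ.
refine (brk_eq (brkD _ (brk_nop_eo _ _ _ _ _ _ _ _ _ (@totQ_X R N j) (@totQ_Q R N j)
  (b00 _) (b00 _) (b00 _))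
  (brkN _ (brkZ ni _ (brk_deriv _ (@totQ_Q R N j))))) _ _ _ _); brk_goal.
Qed.

Lemma nop_AX j : nop false (A j) (X j) = nop false (X j) (A j).
Proof.
refine (etrans (nop_swap _ _ (XA1 j)) _); brk_goal.
Qed.

Lemma nop_QP j : nop true (Q j) (P j) = - chi j.
Proof.
rewrite /Defs.chi.
refine (etrans (nop_swap _ _ (PQ1 j)) _); brk_goal.
Qed.

Lemma totQ_sumG j : brk true totQ (sumG j) (sumL j) (- sumJ j) ((2%:R^-1 - ni) *: idf) 0.
Proof.
have gg := gQQ R N.
have h : brk true totQ (sumG j)
  (nop true (deriv (Q j)) (P j) - deriv (X j) + nop false (A j) (X j))
  (ni *: A j - X j + nop true (Q j) (P j)) ((2%:R^-1 - ni) *: idf) 0.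
  rewrite /sumG.
  refine (brk_eq (brkD _ (brk_nop_eo _ _ _ _ _ _ _ _ _ (@totQ_A R N j) (@totQ_P R N j)
    (dQP1 j) (QP1 j) (b00 _))
    (brkN _ (brk_deriv _ (@totQ_P R N j)))) _ _ _ _); brk_goal.
(* The Wick formula returns :X* X: and :psi* psi: ; reordered, they are the terms of L and J. *)
rewrite nop_QP nop_AX in h.
rewrite /sumL /sumJ; refine (brk_eq h _ _ _ _); brk_goal.
Qed.

Lemma deriv_sum (I : Type) (r : seq I) (F : I -> field) :
  deriv (\sum_(i <- r) F i) = \sum_(i <- r) deriv (F i).
Proof. exact: (big_morph deriv (@fderivD R N) (@fderiv0 R N)). Qed.

Lemma brk_total s (a : field) (f e0 e1 e2 : 'I_N -> field) E0 E1 E2 :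
  good a -> (forall j, brk s a (f j) (e0 j) (e1 j) (e2 j) 0) ->
  \sum_j e0 j = E0 -> \sum_j e1 j = E1 -> \sum_j e2 j = E2 ->
  brk s a (\sum_j f j) E0 E1 E2 0.
Proof.
move=> ga h <- <- <-; refine (brk_eq (brk_sum (index_enum 'I_N) ga h) _ _ _ _) => //.
exact: big1_eq.
Qed.

Lemma sum_const (k : C) : \sum_(j < N) k *: idf = (N%:R * k) *: idf.
Proof.
have e : \sum_(j < N) k = N%:R * k by rewrite sumr_const card_ord mulr_natl.
by rewrite -e; apply/esym; exact: scaler_suml.
Qed.

Lemma totLL : brk false totL totL (deriv totL) (2%:R *: totL) 0 0.
Proof.
refine (brk_total (gL R N) totL_sumL _ _ _); first exact: esym (deriv_sum _ _).
- by rewrite -scaler_sumr.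
- exact: big1_eq.
Qed.

Lemma totLG : brk false totL totG (deriv totG) (2%:R *: totG) 0 0.
Proof.
refine (brk_total (gL R N) totL_sumG _ _ _); first exact: esym (deriv_sum _ _).
- by rewrite -scaler_sumr.
- exact: big1_eq.
Qed.

Lemma totLQ : brk false totL totQ (deriv totQ) totQ 0 0.
Proof.
refine (brk_total (gL R N) totL_sumQ _ _ _); first exact: esym (deriv_sum _ _).
- by [].
- exact: big1_eq.
Qed.

Lemma totLJ : brk false totL totJ (deriv totJ) totJ ((N%:R * (2%:R^-1 - ni)) *: idf) 0.
Proof.
refine (brk_total (gL R N) totL_sumJ _ _ _); first exact: esym (deriv_sum _ _).
- by [].
- exact: sum_const.
Qed.

Lemma totJJ : brk false totJ totJ 0 ((N%:R * (1 - 2%:R * ni)) *: idf) 0 0.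
Proof.
refine (brk_total (gJ R N) totJ_sumJ _ _ _); first exact: big1_eq.
- exact: sum_const.
- exact: big1_eq.
Qed.

Lemma totJG : brk false totJ totG totG 0 0 0.
Proof.
by refine (brk_total (gJ R N) totJ_sumG _ _ _) => //; exact: big1_eq.
Qed.

Lemma totJQ : brk false totJ totQ (- totQ) 0 0 0.
Proof.
refine (brk_total (gJ R N) totJ_sumQ _ _ _); first exact: sumrN.
- exact: big1_eq.
- exact: big1_eq.
Qed.

Lemma totQG : brk true totQ totG totL (- totJ) ((N%:R * (2%:R^-1 - ni)) *: idf) 0.
Proof.
refine (brk_total (gQQ R N) totQ_sumG _ _ _); first by [].
- exact: sumrN.
- exact: sum_const.
Qed.

Lemma totGG : brk true totG totG 0 0 0 0.
Proof. by refine (brk_total (gG R N) totG_sumG _ _ _); exact: big1_eq. Qed.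

Lemma totQQ : brk true totQ totQ 0 0 0 0.
Proof. by refine (brk_total (gQQ R N) totQ_sumQ _ _ _); exact: big1_eq. Qed.

Lemma brk_has_bracket (W : set V) s (a b e0 e1 e2 : field) : brk s a b e0 e1 e2 0 ->
  has_bracket W s a b [:: e0; e1; e2].
Proof.
move=> h m n v _; apply: etrans (h m n v) _.
have E (F : nat -> V) : \sum_(k < 3) F k = F 0%N + F 1%N + F 2%N.
  by rewrite !big_ord_recr big_ord0 /= add0r.
have E0 (F : nat -> int) : \prod_(k < 0) F k = 1 by rewrite big_ord0.
have E1 (F : nat -> int) : \prod_(k < 1) F k = F 0%N.
  by rewrite !big_ord_recr big_ord0 /= mul1r.
have E2 (F : nat -> int) : \prod_(k < 2) F k = F 0%N * F 1%N.
  by rewrite !big_ord_recr big_ord0 /= mul1r.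
apply/esym; apply: etrans (E (fun k : nat => (\prod_(i < k) (m - i%:Z))%:~R *:
  nth 0 [:: e0; e1; e2] k (m + n - k%:Z) v)) _.
rewrite (E0 (fun i : nat => m - i%:Z)) (E1 (fun i : nat => m - i%:Z))
  (E2 (fun i : nat => m - i%:Z)).
cbn [nth]; rewrite !subr0.
by vring.
Qed.

(** Drops the zero coefficients by which the uniform shape of [brk] exceeds the lists in
    [N2_structure]. *)
Lemma has_bracket_trim (W : set V) s (a b : field) cs k :
  has_bracket W s a b (cs ++ nseq k 0) -> has_bracket W s a b cs.
Proof.
move=> h m n v Wv; apply: etrans (h m n v Wv) _.
rewrite size_cat big_split_ord /=; set S2 := (X in _ + X).
have -> : S2 = 0 :> V.
  apply: big1 => i _.
  rewrite nth_cat ltnNge leq_addr /= addKn nth_nseq.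
  by case: ifP => _; rewrite field0 scaler0.
rewrite addr0; apply: eq_bigr => i _.
by rewrite nth_cat ltn_ord.
Qed.

End GeometricN2.

(** * Bosonization identities *)

Section Irreducibility.
Variables (R : realType) (N : nat).
Local Notation C := R[i].
Local Notation V := (fock R N).
Local Notation field := (field R N).
Local Notation deriv := (@Defs.deriv R N).
Local Notation bos := (@bos R N).
Local Notation fer := (@fer R N).
Local Notation kt := (@sket R N).
Local Notation vk l := (kt (l, mset0, fset0)).
Implicit Types (i j : 'I_N) (l : momentum N).

Lemma coef_kt b b' : coef b (kt b') = (b' == b)%:R.
Proof. by rewrite -ktE; exact: mcoeff_ket. Qed.

Lemma coef_lin b : lin (coef b : V -> C^o).
Proof. by move=> c u v; rewrite coefD coefZ. Qed.

Lemma coef_sum b (I : Type) (r : seq I) (F : I -> V) :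
  coef b (\sum_(k <- r) F k) = \sum_(k <- r) coef b (F k).
Proof. exact: (lin_sum (coef_lin b)). Qed.

Lemma coef_diag (T : V -> V) (w : basis N -> C) : lin T ->
  (forall b, T (kt b) = w b *: kt b) -> forall b v, coef b (T v) = w b * coef b v.
Proof.
move=> lT Tb b; apply: (@linP _ _ C^o).
- exact: (lin_comp (coef_lin b) lT).
- exact: (lin_scale (w b) (coef_lin b)).
move=> b'; rewrite Tb coefZ coef_kt; case: eqVneq => [->//|_].
by rewrite !mulr0.
Qed.

(** The span of the vacuum vectors e^lambda over all momenta lambda. *)
Definition vfock : set V := [set v : V | forall b, coef b v != 0 -> b.1.2 = mset0 /\ b.2 = fset0].

(** Number operator: annihilating and then creating a label is diagonal, with eigenvalue
    proportional to its multiplicity. A vector killed by the annihilation mode therefore has no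
    component containing the label. *)
Lemma bos_number s i (r : nat) b v :
  coef b (bos (~~ s) i (Negz r) (bos s i r.+1 v))
  = (r.+1 * b.1.2 (~~ s, i, r))%:R * coef b v.
Proof.
move: b v; apply: (@coef_diag (fun v => bos (~~ s) i (Negz r) (bos s i r.+1 v))).
  exact: (lin_comp (bos_lin _ _ _) (bos_lin _ _ _)).
move=> [[l B] F]; rewrite bosPE (linZ (bos_lin _ _ _)) bosNE /=.
case: (posnP (B (~~ s, i, r))) => [->|Bx]; first by rewrite muln0 !scale0r.
by rewrite msetB1K // in_mset.
Qed.

Lemma ferc_fera_kt (x : label N) l B F :
  @ferc R N x (@fera R N x (kt (l, B, F))) = (x \in F)%:R *: kt (l, B, F).
Proof.
rewrite feraE; case: ifP => xF; last by rewrite (lin0 (@ferc_lin R N _)) scale0r.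
rewrite (linZ (@ferc_lin R N _)) fercE in_fsetD1 eqxx /=.
rewrite fsetD1K; last exact: xF.
rewrite scalerA; apply: eq_scale.
by rewrite (fsignD1 _ _ xF) /xsign ltnn expr0 mul1r fsign_sq.
Qed.

Lemma fer_number s i (r : nat) b v :
  coef b (fer (~~ s) i (Negz r) (fer s i r v)) = ((~~ s, i, r) \in b.2)%:R * coef b v.
Proof.
move: b v; apply: (@coef_diag (fun v => fer (~~ s) i (Negz r) (fer s i r v))).
  exact: (lin_comp (fer_lin _ _ _) (fer_lin _ _ _)).
by move=> [[l B] F]; rewrite fer_pos fer_neg ferc_fera_kt.
Qed.

Lemma singular_vfock v : (forall s i (r : nat), bos s i r.+1 v = 0) ->
  (forall s i (r : nat), fer s i r v = 0) -> vfock v.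
Proof.
move=> bv fv [[l B] F] c0 /=; split.
  apply/msetP => -[[s i] r]; rewrite mset0E.
  have := bos_number (~~ s) i r (l, B, F) v; rewrite bv (lin0 (bos_lin _ _ _)) coef0.
  move=> /esym/eqP; rewrite mulf_eq0 (negPf c0) orbF pnatr_eq0 muln_eq0 /= negbK.
  by move=> /eqP.
apply/fsetP => -[[s i] r]; rewrite in_fset0.
have := fer_number (~~ s) i r (l, B, F) v; rewrite fv (lin0 (fer_lin _ _ _)) coef0.
move=> /esym/eqP; rewrite mulf_eq0 (negPf c0) orbF /= negbK.
by case: (_ \in F) => //=; rewrite oner_eq0.
Qed.

Lemma bos_vk s i (r : nat) l : bos s i r.+1 (vk l) = 0.
Proof. by rewrite bosPE mset0E muln0 scale0r. Qed.

Lemma fer_vk s i (r : nat) l : fer s i r (vk l) = 0.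
Proof. by rewrite ferPE in_fset0. Qed.

(** The creation modes generate the Fock space from the vectors e^lambda; the scalars that appear
    are signs, hence invertible. *)
Lemma fock_ind (T : V -> V) : lin T -> (forall l, T (vk l) = 0) ->
  (forall s i (r : nat) v, T v = 0 -> T (bos s i (Negz r) v) = 0) ->
  (forall s i (r : nat) v, T v = 0 -> T (fer s i (Negz r) v) = 0) ->
  forall v, T v = 0.
Proof.
move=> lT T0 Tb Tf; apply: linP => //; first exact: lin_zero.
move=> [[l B] F]; rewrite -(seq_mset_id B); elim: (enum_mset B) => [|[[s i] r] q IH].
  have -> : seq_mset [::] = mset0 :> {mset label N}%mset.
    by apply/msetP => x; rewrite mset_seqE mset0E.
  elim/fset1U_rect: F => [|[[s i] r] F xF IH]; first exact: T0.
  have := Tf s i r _ IH; rewrite ferNE (negPf xF) (linZ lT) => /eqP.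
  rewrite scaler_eq0 => /orP[/eqP f0|/eqP //].
  by have := fsign_sq R (s, i, r) F; rewrite f0 mul0r => /esym/eqP; rewrite oner_eq0.
by rewrite mset_cons -bosNE; apply: Tb.
Qed.

(** The clause on negative modes concerns all vectors v, not only e^lambda: this makes the property
    stable under normally ordered products. It suits fermions; a bosonic zero mode acts on e^lambda
    by a scalar. *)
Definition vacuum_free (a : field) :=
  (forall n l, 0 <= n -> a n (vk l) = 0) /\
  (forall n v l, n < 0 -> coef (l, mset0, fset0) (a n v) = 0).

(** A form of Schur's lemma. Each D_(n) e^lambda is killed by all annihilation modes, hence a
    combination of vacuum vectors; being free of such components it is zero, and commutation with
    the creation modes carries this to every vector. *)
Lemma field_eq0 s (D : field) : good D -> vacuum_free D ->
  (forall t i, brk false (bos t i) D 0 0 0 0) ->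
  (forall t i, brk s (fer t i) D 0 0 0 0) -> D = 0.
Proof.
move=> gD [Dpos Dneg] Db Df; apply: eq_field => n v; rewrite field0.
have lD := good_lin gD n.
have cb t i m w : bos t i m (D n w) = D n (bos t i m w).
  have := comm_move (Db t i m n w); rewrite /sg expr0 vscale1r => ->.
  by vring.
have cf t i m w : fer t i m (D n w) = sg R s *: D n (fer t i m w).
  by have -> := comm_move (Df t i m n w); vring.
move: v; apply: fock_ind => //.
- move=> l; case: (leP 0 n) => n0; first exact: Dpos.
  have sv : vfock (D n (vk l)).
    apply: singular_vfock => t i r.
      by rewrite cb bos_vk lin0.
    by rewrite cf fer_vk lin0 ?scaler0.
  apply: coefP => -[[l' B] F]; rewrite coef0; apply/eqP.
  apply: contraT => c0; have [/= B0 F0] := sv _ c0.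
  by rewrite B0 F0 Dneg ?eqxx // in c0.
- by move=> t i r v v0; rewrite -cb v0 (lin0 (bos_lin _ _ _)).
move=> t i r v v0; have := cf t i (Negz r) v.
rewrite v0 (lin0 (fer_lin _ _ _)) => e.
by rewrite -[LHS](sgK s) -e scaler0.
Qed.

Lemma vacuum_freeD a b : vacuum_free a -> vacuum_free b -> vacuum_free (a + b).
Proof.
move=> [a0 a1] [b0 b1]; split=> [n l n0|n v l n0]; rewrite fieldD.
  by rewrite a0 ?b0 ?addr0.
by rewrite coefD a1 ?b1 ?addr0.
Qed.

Lemma vacuum_freeZ k a : vacuum_free a -> vacuum_free (k *: a).
Proof.
move=> [a0 a1]; split=> [n l n0|n v l n0]; rewrite fieldZ.
  by rewrite a0 ?scaler0.
by rewrite coefZ a1 ?mulr0.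
Qed.

Lemma vacuum_freeN a : vacuum_free a -> vacuum_free (- a).
Proof. by move=> ha; rewrite -scaleN1r; apply: vacuum_freeZ. Qed.

Lemma vacuum_free_deriv a : vacuum_free a -> vacuum_free (deriv a).
Proof.
move=> [a0 a1]; split=> [n l n0|n v l n0]; rewrite /Defs.deriv; last first.
  by rewrite coefZ a1 ?mulr0 //; lia.
have [->|nz] := eqVneq n 0; first by rewrite oppr0 scale0r.
by rewrite a0 ?scaler0 //; lia.
Qed.

Lemma vacuum_free_fer s i : vacuum_free (fer s i).
Proof.
split=> [[r|r]//|[r|r]//] => [l _|v l _]; first exact: fer_vk.
move: v; apply: (@linP _ _ C^o).
- exact: (lin_comp (coef_lin _) (fer_lin _ _ _)).
- exact: lin_zero.
move=> [[l' B] F]; rewrite ferNE; case: ifP => xF; first by rewrite coef0.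
rewrite coefZ coef_kt; case: eqVneq => [[_ _ e]|]; last by rewrite mulr0.
by have := in_fset0 (s, i, r); rewrite -e fset1U1.
Qed.

Lemma vacuum_free_nop s a b : good a -> good b -> vacuum_free a -> vacuum_free b ->
  vacuum_free (nop s a b).
Proof.
move=> ga gb [a0 a1] [b0 b1]; split=> [n l n0|n v l n0]; rewrite nopE.
  rewrite lfsum0 // => j; rewrite /nterm b0; last by lia.
  by rewrite a0 // (lin0 (good_lin ga _)) (lin0 (good_lin gb _)) scaler0 addr0.
have [K F0] := lfin_nop s n v ga gb; rewrite (lfsumE F0) coef_sum big1 // => j _.
rewrite /nterm coefD coefZ a1 // b1 ?mulr0 ?addr0 //.
by lia.
Qed.

End Irreducibility.

Ltac vacuum_free_field :=
  lazymatch goal with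
  | |- vacuum_free (Defs.nop _ _ _) =>
      apply vacuum_free_nop; [good_field|good_field|vacuum_free_field|vacuum_free_field]
  | |- vacuum_free (Defs.deriv _) => apply vacuum_free_deriv; vacuum_free_field
  | |- vacuum_free (@GRing.add _ _ _) => apply vacuum_freeD; vacuum_free_field
  | |- vacuum_free (@GRing.opp _ _) => apply vacuum_freeN; vacuum_free_field
  | |- vacuum_free (@GRing.scale _ _ _ _) => apply vacuum_freeZ; vacuum_free_field
  | |- vacuum_free (@Defs.fer _ _ _ _) => apply vacuum_free_fer
  end.

(** * The three fermionic identities and the free field form of the geometric fields *)

Section FermionIdentities.
Variables (R : realType) (N : nat).
Local Notation C := R[i].
Local Notation field := (field R N).
Local Notation deriv := (@Defs.deriv R N).
Local Notation P := (@fer R N false).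
Local Notation Q := (@fer R N true).
Local Notation chi := (@chi R N).
Implicit Types (i j : 'I_N).
Local Notation d i j := ((i == j)%:R : C).

Let gP i : good (P i) := fer_good R false i.
Let gQ i : good (Q i) := fer_good R true i.
Let gchi i : good (chi i). Proof. good_field. Qed.
Local Notation b00 := (@brk_0l R N _ _).
Local Notation bf := (@brk_bos_fer R N _ _ _ _).

(** Reordering shows that the product is its own opposite. *)
Lemma nop_odd_self (a : field) : good a -> brk true a a 0 0 0 0 -> nop true a a = 0.
Proof.
move=> ga ha; have e : nop true a a = - nop true a a.
  refine (etrans (nop_swap ga ga ha) _); brk_goal.
have two : 2%:R != 0 :> C by rewrite pnatr_eq0.
have : nop true a a = 2%:R^-1 *: (nop true a a + nop true a a) by fring.
by rewrite {2}e addNr scaler0.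
Qed.

Lemma brk_Zl0 s k (a b : field) : good b -> brk s a b 0 0 0 0 ->
  brk s (k *: a) b 0 0 0 0.
Proof. by move=> gb h; refine (brk_eq (brk_Zl k gb h) _ _ _ _); brk_goal. Qed.

Lemma P_chi1 j : brk false (P j) (chi j) (- P j) 0 0 0.
Proof. by refine (brk_eq (@P_chi R N j j) _ _ _ _); rewrite ?eqxx ?scaleN1r. Qed.

Lemma Q_chi1 j : brk false (Q j) (chi j) (Q j) 0 0 0.
Proof. by refine (brk_eq (@Q_chi R N j j) _ _ _ _); rewrite ?eqxx ?scale1r. Qed.

Lemma nop_chiP j : nop false (chi j) (P j) = deriv (P j).
Proof.
apply/eqP; rewrite -subr_eq0; apply/eqP; rewrite /Defs.chi.
apply: (@field_eq0 R N true); [good_field|vacuum_free_field| |].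
  move=> t i.
  refine (brk_eq (brkD _ (brk_nop_even _ _ _ _ _ _ _ _ _ (@bos_chi R N t i j) bf
    (b00 _) (b00 _) (b00 _)) (brkN _ (brk_deriv _ bf))) _ _ _ _); brk_goal.
case=> i.
  (* Against psi*_i the contractions with chi_j and with psi_j leave :psi* psi: + chi, which is zero
     after reordering; the derivative cancels the double contraction. *)
  have h : brk true (Q i) (nop false (chi j) (P j) - deriv (P j))
    (d i j *: nop true (Q j) (P j) + d i j *: chi j) 0 0 0.
    have h0 := brk_Zl (d i j) (gP j) (@QP1 R N j).
    refine (brk_eq (brkD _ (brk_nop_eo _ _ _ _ _ _ _ _ _ (@Q_chi R N i j) (@brkQP R N i j)
      (brk_eq (f1 := 0) (f2 := 0) (f3 := 0) h0 erefl _ _ _) (b00 _) (b00 _))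
      (brkN _ (brk_deriv _ (@brkQP R N i j)))) _ _ _ _); brk_goal.
  by refine (brk_eq h _ erefl erefl erefl); rewrite nop_QP; fring.
have h0 := brk_Zl0 (- d i j) (gP j) (@brkPP R N j j).
have pp := nop_odd_self (gP j) (@brkPP R N j j).
have h : brk true (P i) (nop false (chi j) (P j) - deriv (P j))
    (- d i j *: nop true (P j) (P j)) 0 0 0.
  refine (brk_eq (brkD _ (brk_nop_eo _ _ _ _ _ _ _ _ _ (@P_chi R N i j) (@brkPP R N i j)
    h0 (b00 _) (b00 _)) (brkN _ (brk_deriv _ (@brkPP R N i j)))) _ _ _ _); brk_goal.
by rewrite pp scaler0 in h.
Qed.

Lemma nop_chiQ j : nop false (chi j) (Q j) = - deriv (Q j).
Proof.
apply/eqP; rewrite -subr_eq0; apply/eqP; rewrite /Defs.chi.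
apply: (@field_eq0 R N true); [good_field|vacuum_free_field| |].
  move=> t i.
  refine (brk_eq (brkD _ (brk_nop_even _ _ _ _ _ _ _ _ _ (@bos_chi R N t i j) bf
    (b00 _) (b00 _) (b00 _)) (brkN _ (brkN _ (brk_deriv _ bf)))) _ _ _ _); brk_goal.
case=> i; last first.
  have h0 := brk_Zl (- d i j) (gQ j) (@PQ1 R N j).
  refine (brk_eq (brkD _ (brk_nop_eo _ _ _ _ _ _ _ _ _ (@P_chi R N i j) (@brkPQ R N i j)
      (brk_eq (f1 := 0) (f2 := 0) (f3 := 0) h0 erefl _ _ _) (b00 _) (b00 _))
      (brkN _ (brkN _ (brk_deriv _ (@brkPQ R N i j))))) _ _ _ _);
    rewrite /Defs.chi; brk_goal.
have h0 := brk_Zl0 (d i j) (gQ j) (@brkQQ R N j j).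
have pp := nop_odd_self (gQ j) (@brkQQ R N j j).
have h : brk true (Q i) (nop false (chi j) (Q j) - - deriv (Q j))
    (d i j *: nop true (Q j) (Q j)) 0 0 0.
  refine (brk_eq (brkD _ (brk_nop_eo _ _ _ _ _ _ _ _ _ (@Q_chi R N i j) (@brkQQ R N i j)
    h0 (b00 _) (b00 _)) (brkN _ (brkN _ (brk_deriv _ (@brkQQ R N i j))))) _ _ _ _); brk_goal.
by rewrite pp scaler0 in h.
Qed.

Lemma chi_P1 j : brk false (chi j) (P j) (P j) 0 0 0.
Proof. refine (brk_eq (brk_skew (P_chi1 j)) _ _ _ _); brk_goal. Qed.

Lemma chi_Q1 j : brk false (chi j) (Q j) (- Q j) 0 0 0.
Proof. refine (brk_eq (brk_skew (Q_chi1 j)) _ _ _ _); brk_goal. Qed.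

Lemma nop_Pchi j : nop false (P j) (chi j) = 0.
Proof.
have e : nop false (P j) (chi j) = nop false (chi j) (P j) - deriv (P j).
  refine (etrans (nop_swap _ _ (chi_P1 j)) _); brk_goal.
by rewrite e nop_chiP subrr.
Qed.

Lemma nop_Qchi j : nop false (Q j) (chi j) = 0.
Proof.
have e : nop false (Q j) (chi j) = nop false (chi j) (Q j) + deriv (Q j).
  refine (etrans (nop_swap _ _ (chi_Q1 j)) _); brk_goal.
by rewrite e nop_chiQ addNr.
Qed.

(** The Sugawara form of the fermionic conformal field; the term -chi'/2 gives psi weight 1 and psi*
    weight 0. Brackets with psi and psi* leave cubic terms, which the values of :chi psi: , :psi
    chi: and their duals reduce to derivatives that cancel. *)
Lemma sugawara j :
  2%:R^-1 *: nop false (chi j) (chi j) - 2%:R^-1 *: deriv (chi j)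
  = nop true (deriv (Q j)) (P j).
Proof.
apply/eqP; rewrite -subr_eq0; apply/eqP; rewrite {1 2 3}/Defs.chi.
apply: (@field_eq0 R N false); [good_field|vacuum_free_field| |].
  move=> t i.
  refine (brk_eq (brkD _ (brkD _ (brkZ 2%:R^-1 _ (brk_nop_even _ _ _ _ _ _ _ _ _
      (@bos_chi R N t i j) (@bos_chi R N t i j) (b00 _) (b00 _) (b00 _)))
    (brkN _ (brkZ 2%:R^-1 _ (brk_deriv _ (@bos_chi R N t i j)))))
    (brkN _ (@bos_QP R N t i j))) _ _ _ _); brk_goal.
case=> i.
  have h0 := brk_Zl (d i j) (gchi j) (Q_chi1 j).
  have h : brk false (Q i) (2%:R^-1 *: nop false (chi j) (chi j)
      - 2%:R^-1 *: deriv (chi j) - nop true (deriv (Q j)) (P j))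
      (2%:R^-1 *: (d i j *: nop false (Q j) (chi j) + d i j *: nop false (chi j) (Q j))
       + 2%:R^-1 *: (d i j *: deriv (Q j))) 0 0 0.
    refine (brk_eq (brkD _ (brkD _ (brkZ 2%:R^-1 _ (brk_nop_even _ _ _ _ _ _ _ _ _
        (@Q_chi R N i j) (@Q_chi R N i j)
      (brk_eq (f1 := 0) (f2 := 0) (f3 := 0) h0 erefl _ _ _) (b00 _) (b00 _)))
      (brkN _ (brkZ 2%:R^-1 _ (brk_deriv _ (@Q_chi R N i j)))))
      (brkN _ (@Q_QP R N i j))) _ _ _ _); brk_goal.
  by refine (brk_eq h _ erefl erefl erefl); rewrite nop_Qchi nop_chiQ; fring.
have h0 := brk_Zl (- d i j) (gchi j) (P_chi1 j).
have h : brk false (P i) (2%:R^-1 *: nop false (chi j) (chi j)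
    - 2%:R^-1 *: deriv (chi j) - nop true (deriv (Q j)) (P j))
    (- 2%:R^-1 *: (d i j *: nop false (P j) (chi j) + d i j *: nop false (chi j) (P j))
       + 2%:R^-1 *: (d i j *: deriv (P j))) 0 0 0.
  refine (brk_eq (brkD _ (brkD _ (brkZ 2%:R^-1 _ (brk_nop_even _ _ _ _ _ _ _ _ _
      (@P_chi R N i j) (@P_chi R N i j)
    (brk_eq (f1 := 0) (f2 := 0) (f3 := 0) h0 erefl _ _ _) (b00 _) (b00 _)))
    (brkN _ (brkZ 2%:R^-1 _ (brk_deriv _ (@P_chi R N i j)))))
    (brkN _ (@P_QP R N i j))) _ _ _ _); brk_goal.
by refine (brk_eq h _ erefl erefl erefl); rewrite nop_Pchi nop_chiP; fring.
Qed.

Lemma geom_G : N2G (N2_geom R N) = @totG R N.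
Proof.
apply: eq_bigr => j _; rewrite /sumG -nop_chiP /expchi; fring.
Qed.

Lemma geom_Q : N2Q (N2_geom R N) = @totQ R N.
Proof.
apply: eq_bigr => j _; rewrite /sumQ.
have -> : deriv (Q j) = - nop false (chi j) (Q j) by rewrite nop_chiQ opprK.
rewrite /expchiN; fring.
Qed.

Lemma geom_J : N2J (N2_geom R N) = @totJ R N.
Proof. by []. Qed.

Lemma geom_L : N2L (N2_geom R N) = @totL R N.
Proof.
apply: eq_bigr => j _; rewrite /sumL -sugawara; fring.
Qed.

End FermionIdentities.

(** * Vertex operators and the Landau-Ginzburg states *)

Section VertexOperators.
Variables (R : realType) (N : nat).
Local Notation C := R[i].
Local Notation V := (fock R N).
Local Notation idf := (@idf R N).
Local Notation bos := (@bos R N).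
Local Notation fer := (@fer R N).
Local Notation X := (@bos false).
Local Notation kt := (@sket R N).
Local Notation eX := (@eX R N).
Local Notation vop := (@vop R N).
Implicit Types (i j : 'I_N) (l : momentum N) (v : V).

(** Serves twice: as the lowest mode of e^{X_i}(z), e^{-X_i}(z) on [pure] vectors, and as
    multiplication by e^{n X*_orb}. *)
Definition tr (u : momentum N) : V -> V :=
  lext (fun b => kt (b.1.1 + u, b.1.2, b.2)).

Lemma tr_lin u : lin (tr u). Proof. exact: lext_lin. Qed.
Lemma trE u l B F : tr u (kt (l, B, F)) = kt (l + u, B, F).
Proof. by rewrite /tr lext_kt. Qed.

Lemma tr_fer u s j n v : tr u (fer s j n v) = fer s j n (tr u v).
Proof.
move: v; apply: linP.
- exact: (lin_comp (tr_lin u) (fer_lin s j n)).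
- exact: (lin_comp (fer_lin s j n) (tr_lin u)).
move=> [[l B] F]; have [c [F' fE]] := fer_kt R s j n F.
by rewrite fE (linZ (tr_lin u)) !trE fE.
Qed.

Lemma tr_bosN u s j (r : nat) v : tr u (bos s j (Negz r) v) = bos s j (Negz r) (tr u v).
Proof.
move: v; apply: linP.
- exact: (lin_comp (tr_lin u) (bos_lin s j _)).
- exact: (lin_comp (bos_lin s j _) (tr_lin u)).
by move=> [[l B] F]; rewrite bosNE !trE bosNE.
Qed.

Lemma tr_bosP u s j (r : nat) v : tr u (bos s j r.+1 v) = bos s j r.+1 (tr u v).
Proof.
move: v; apply: linP.
- exact: (lin_comp (tr_lin u) (bos_lin s j _)).
- exact: (lin_comp (bos_lin s j _) (tr_lin u)).
by move=> [[l B] F]; rewrite bosPE (linZ (tr_lin u)) !trE bosPE.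
Qed.

Lemma tr_bos0 u s j v : bos s j 0 (tr u v) =
  tr u (bos s j 0 v) + (ratr (if s then u.1 0 j else u.2 0 j) : C) *: tr u v.
Proof.
move: v; apply: linP.
- exact: (lin_comp (bos_lin s j 0) (tr_lin u)).
- apply: lin_add; first exact: (lin_comp (tr_lin u) (bos_lin s j 0)).
  exact: (lin_scale _ (tr_lin u)).
move=> [[l B] F]; rewrite bos0E (linZ (tr_lin u)) !trE bos0E -vscalerDl.
by apply: eq_scale; case: s; rewrite mxE rmorphD.
Qed.

Lemma vop_lin l n : lin (vop l n). Proof. exact: lext_lin. Qed.

Lemma vopE l n m B F : vop l n (kt (m, B, F)) =
  if form l m \is a Num.int then
    cocycle R l m *: lfsum (fun c =>
      match c%:Z - n - 1 - numq (form l m) with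
      | Posz a => expcoef (expcr l) a (expcoef (expan l) c (kt (l + m, B, F)))
      | Negz _ => 0
      end)
  else 0.
Proof. by rewrite [LHS]lext_kt ktE. Qed.

Section Exponentials.
Variable S : nat -> V -> V.
Hypothesis S00 : forall a, S a 0 = 0.

Lemma vsum0 n (F : 'I_n -> V) : (forall k : 'I_n, F k = 0) -> \sum_k F k = 0.
Proof. by move=> F0; apply: big1. Qed.

Lemma powcoefS k a v :
  powcoef S k.+1 a v = \sum_(i < a.+1) S i (powcoef S k (a - i) v) :> V.
Proof. by []. Qed.

Lemma expcoefE a v : expcoef S a v =
  \sum_(k < a.+1) ((k`!)%:R : C)^-1 *: powcoef S k a v :> V.
Proof. by []. Qed.

Lemma powcoef_0 k a : powcoef S k a 0 = 0.
Proof.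
elim: k a => [|k IH] a; first by rewrite /=; case: ifP.
by rewrite powcoefS; apply: vsum0 => i; rewrite IH.
Qed.

Lemma expcoef_0 a : expcoef S a 0 = 0.
Proof. by rewrite expcoefE; apply: vsum0 => i; rewrite powcoef_0 scaler0. Qed.

Lemma expcoef_kill a v : (forall c, S c v = 0) -> expcoef S a v = if a == 0%N then v else 0.
Proof.
move=> Sv; have pk k b : powcoef S k.+1 b v = 0.
  elim: k b => [|k IH] b; rewrite powcoefS; apply: vsum0 => i.
    by rewrite /=; case: ifP.
  by rewrite IH.
rewrite expcoefE big_ord_recl; set rest := (X in _ + X).
have -> : rest = 0 by apply: vsum0 => i; rewrite pk scaler0.
by rewrite addr0 fact0 invr1 vscale1r.
Qed.

Hypothesis S0 : forall v, S 0%N v = 0.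

Lemma expcoef0 v : expcoef S 0 v = v.
Proof. by rewrite expcoefE big_ord_recl big_ord0 addr0 fact0 invr1 vscale1r. Qed.

Lemma powcoef11 v : powcoef S 1 1 v = S 1%N v.
Proof. by rewrite powcoefS !big_ord_recl big_ord0 S00 add0r addr0. Qed.

Lemma expcoef1 v : expcoef S 1 v = S 1%N v.
Proof.
have -> : expcoef S 1 v = ((0`!)%:R : C)^-1 *: powcoef S 0 1 v
    + (((1`!)%:R : C)^-1 *: powcoef S 1 1 v + 0).
  by rewrite expcoefE !big_ord_recl big_ord0.
rewrite powcoef11; by rewrite -[powcoef S 0 1 v]/(0 : V) scaler0 add0r addr0 invr1 vscale1r.
Qed.

Lemma expcoef2 v : expcoef S 2 v = S 2%N v + 2%:R^-1 *: S 1%N (S 1%N v).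
Proof.
have p12 : powcoef S 1 2 v = S 2%N v.
  have -> : powcoef S 1 2 v = S 0%N 0 + (S 1%N 0 + (S 2%N v + 0)).
    by rewrite powcoefS !big_ord_recl big_ord0.
  by rewrite !S00 !add0r addr0.
have p22 : powcoef S 2 2 v = S 1%N (S 1%N v).
  have -> : powcoef S 2 2 v = S 0%N (powcoef S 1 2 v)
      + (S 1%N (powcoef S 1 1 v) + (S 2%N (powcoef S 1 0 v) + 0)).
    by rewrite powcoefS !big_ord_recl big_ord0.
  have -> : powcoef S 1 0 v = 0 by rewrite powcoefS big_ord_recl big_ord0 S0 addr0.
  by rewrite S0 powcoef11 S00 add0r !addr0.
have [c cE] : exists c : nat -> C, forall k, c k = ((k`!)%:R)^-1 by eexists.
have c1 : c 1%N = 1 by rewrite cE invr1.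
have c2 : c 2%N = 2%:R^-1 by rewrite cE.
have -> : expcoef S 2 v = c 0%N *: 0 + (c 1%N *: S 2%N v + (c 2%N *: S 1%N (S 1%N v) + 0)).
  by rewrite (cE 0%N) (cE 1%N) (cE 2%N) -p22 -p12 expcoefE !big_ord_recl big_ord0.
by rewrite c1 c2; vring.
Qed.
End Exponentials.

Lemma heis0 : @heis R N 0 = 0.
Proof.
have z1 j : (0 : momentum N).1 0 j = 0 by rewrite mxE.
have z2 j : (0 : momentum N).2 0 j = 0 by rewrite mxE.
apply: eq_field => n v; rewrite /heis field_sum field0; apply: big1 => j _.
by rewrite z1 ?z2 rmorph0; vring.
Qed.

Lemma vop0 : vop 0 = idf.
Proof.
apply: eq_field => n; apply: linP; first exact: vop_lin.
  exact: (good_lin (good_idf R N) n).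
move=> [[m B] F]; rewrite vopE.
have f0 : form 0 m = 0 :> rat.
  by rewrite /form /dotr big1 ?big1 ?addr0 // => j _; rewrite mxE mul0r.
have c0 : cocycle R 0 m = 1.
  by rewrite /cocycle /dotr big1 ?expr0 // => j _; rewrite mxE mul0r.
rewrite f0 rpred0 c0 vscale1r add0r.
have ea c (v : V) : expan 0 c v = 0 by rewrite /expan heis0 field0 scaler0 oppr0.
have ec c (v : V) : expcr 0 c v = 0 by rewrite /expcr heis0 field0 scaler0.
rewrite (@lfsum1 _ _ _ 0%N) => [|c c0']; last first.
  case: (_ - _) => // a; rewrite (expcoef_kill (S := expan 0)) // (negPf c0').
  exact: expcoef_0.
rewrite (expcoef_kill (S := expan 0)) // eqxx /idf.
have -> : 0%:Z - n - 1 - numq 0 = - n - 1 by rewrite (numq_int 0); lia.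
case e : (- n - 1) => [a|a].
  rewrite (expcoef_kill (S := expcr 0)) //.
  by have -> : (a == 0%N) = (n == -1) by lia.
by have -> : (n == -1) = false by lia.
Qed.

Definition su (s : bool) i : momentum N := (if s then - delta_mx 0 i else delta_mx 0 i, 0).

Lemma eXE s i : eX s i = vop (su s i). Proof. by []. Qed.

Lemma heis_su s i : @heis R N (su s i) = sg R s *: X i.
Proof.
rewrite /heis -(@sum_delta R N (sg R s) i X).
apply: eq_bigr => j _.
have r2 : ratr ((su s i).2 0 j) = 0 :> C by rewrite mxE rmorph0.
have r1 : ratr ((su s i).1 0 j) = sg R s * (i == j)%:R :> C.
  rewrite /su [i == j]eq_sym; case: (s); rewrite ?sg_true ?sg_false !mxE eqxx /=.
    by case: (j == i); rewrite ?rmorphN ?rmorph1 ?rmorph0 ?mulr1 ?mulr0 ?oppr0.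
  by case: (j == i); rewrite ?rmorph1 ?rmorph0 mul1r.
rewrite r1 r2; generalize (sg R s); move=> k; fring.
Qed.

(* On these vectors e^{X_i}(z) and e^{-X_i}(z) act by their creation parts only:
   X_i(n) kills them for n >= 0. *)
Definition pureb (b : basis N) :=
  b.1.1.2 = 0 /\ forall j r, b.1.2 (true, j, r) = 0%N.

Definition pure : set V := [set v : V | forall b, coef b v != 0 -> pureb b].

End VertexOperators.

(** * Exponentials and normally ordered products on vacuum-like vectors *)

Section States.
Variables (R : realType) (N : nat).
Local Notation C := R[i].
Local Notation V := (fock R N).
Local Notation field := (field R N).
Local Notation deriv := (@Defs.deriv R N).
Local Notation bos := (@bos R N).
Local Notation fer := (@fer R N).
Local Notation X := (@bos false).
Local Notation chi := (@chi R N).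
Local Notation kt := (@sket R N).
Local Notation vk l := (kt (l, mset0, fset0)).
Local Notation eX := (@eX R N).
Local Notation tr := (@tr R N).
Local Notation pure := (@pure R N).
Implicit Types (i j : 'I_N) (l : momentum N) (v : V) (s : bool).

Lemma lext_coef (W : lmodType C) (f : basis N -> W) v :
  lext f v = \sum_(b <- monalg.msupp v) coef b v *: f b.
Proof. by []. Qed.

Lemma pure_ext (T T' : V -> V) v : lin T -> lin T' -> pure v ->
  (forall b, pureb b -> T (kt b) = T' (kt b)) -> T v = T' v.
Proof.
move=> lT lT' pv TT'; rewrite (lin_lext lT) (lin_lext lT') !lext_coef.
apply: eq_bigr => b _; have [->|c0] := eqVneq (coef b v) 0; first by rewrite !scale0r.
by rewrite /= ktE TT' //; apply: pv.
Qed.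

Lemma pureD u v : pure u -> pure v -> pure (u + v).
Proof.
move=> pu pv b; rewrite coefD; have [u0|u0 _] := eqVneq (coef b u) 0; last exact: pu.
by rewrite u0 add0r => /pv.
Qed.

Lemma pureZ c v : pure v -> pure (c *: v).
Proof. by move=> pv b; rewrite coefZ mulf_eq0 negb_or => /andP[_ /pv]. Qed.

Lemma pure0 : pure 0.
Proof. by move=> b; rewrite coef0 eqxx. Qed.

Lemma pure_kt b : pureb b -> pure (kt b).
Proof. by move=> pb b'; rewrite coef_kt; case: (eqVneq b b') => [<-//|_]; rewrite eqxx. Qed.

Lemma pure_map (T : V -> V) v : lin T -> (forall b, pureb b -> pure (T (kt b))) ->
  pure v -> pure (T v).
Proof.
move=> lT pT pv; rewrite (lin_lext lT) lext_coef.
apply: big_ind; [exact: pure0|exact: pureD|] => b _.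
have [->|c0] := eqVneq (coef b v) 0; first by rewrite scale0r; apply: pure0.
by apply: pureZ; rewrite /= ktE; apply: pT; apply: pv.
Qed.

Lemma pure_vk (u : 'rV[rat]_N) : pure (vk (u, 0)).
Proof. by apply: pure_kt; split=> // j r; rewrite mset0E. Qed.

Lemma pure_fer s j n v : pure v -> pure (fer s j n v).
Proof.
apply: pure_map; first exact: fer_lin.
move=> [[l B] F] pb; have [c [F' ->]] := fer_kt R s j n F.
by apply: pureZ; apply: pure_kt; apply: pb.
Qed.

Lemma pure_X j (r : nat) v : pure v -> pure (X j (Negz r) v).
Proof.
apply: pure_map; first exact: bos_lin.
move=> [[l B] F] [pl pB]; rewrite bosNE; apply: pure_kt; split=> // k q.
by rewrite /= mset1DE pB.
Qed.

Section OneVariable.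
Variables (s : bool) (i : 'I_N).
Local Notation S := (expcr (su s i) : nat -> V -> V).

Lemma expcrE a v : S a v = (a%:R : C)^-1 *: (sg R s *: X i (- a%:Z) v).
Proof. by rewrite /expcr heis_su. Qed.

Let S00 a : S a 0 = 0.
Proof. by rewrite expcrE (lin0 (bos_lin _ _ _)) !scaler0. Qed.

Let S0 v : S 0%N v = 0.
Proof. by rewrite expcrE invr0 scale0r. Qed.

Lemma eX_kt n b : pureb b -> eX s i n (kt b) =
  if n is Negz a then expcoef S a (tr (su s i) (kt b)) else 0.
Proof.
case: b => [[m B] F] [/= m0 B0]; rewrite eXE vopE trE.
have f0 : form (su s i) m = 0.
  rewrite /form /dotr m0 !big1 ?addr0 // => j _; rewrite mxE; last by rewrite mulr0.
  by rewrite mul0r.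
have c0 : cocycle R (su s i) m = 1.
  by rewrite /cocycle /dotr big1 ?expr0 // => j _; rewrite mxE mul0r.
rewrite f0 rpred0 c0 vscale1r [su s i + m]addrC.
have ea c : expan (su s i) c (kt (m + su s i, B, F)) = 0.
  rewrite /expan heis_su fieldZ; case: c => [|c]; first by rewrite invr0 scale0r oppr0.
  by rewrite bosPE B0 muln0 scale0r !scaler0 oppr0.
have e0 c : expan (su s i) c (0 : V) = 0.
  by rewrite /expan heis_su fieldZ (lin0 (bos_lin _ _ _)) !scaler0 oppr0.
rewrite (@lfsum1 _ _ _ 0%N) => [|c c0']; last first.
  case: (_ - _) => // a; rewrite (expcoef_kill e0 _ ea) (negPf c0').
  exact: expcoef_0.
rewrite (expcoef_kill e0 _ ea) eqxx.
have -> : 0%:Z - n - 1 - numq 0 = - n - 1 by rewrite (numq_int 0); lia.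
case: n => a.
  by have -> : - a%:Z - 1 = Negz a by lia.
by have -> : - Negz a - 1 = a by lia.
Qed.

Lemma eX_pos (r : nat) v : pure v -> eX s i r v = 0.
Proof.
move=> pv; refine (pure_ext (vop_lin _ _) (@lin_zero _ _ V) pv _) => b pb.
exact: (eX_kt r pb).
Qed.

(** The coefficients of 1, z and z^2 of the creation exponential, here and in the next two lemmas,
    are all that the states require. *)
Lemma eX_m1 v : pure v -> eX s i (Negz 0) v = tr (su s i) v.
Proof.
move=> pv; refine (pure_ext (vop_lin _ _) (tr_lin _) pv _) => b pb.
by apply: etrans (eX_kt (Negz 0) pb) _; rewrite expcoef0.
Qed.

Lemma eX_m2 v : pure v -> eX s i (Negz 1) v = sg R s *: X i (Negz 0) (tr (su s i) v).
Proof.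
move=> pv; refine (pure_ext (vop_lin _ _)
  (lin_scale (sg R s) (lin_comp (bos_lin false i (Negz 0)) (tr_lin (su s i)))) pv _) => b pb.
apply: etrans (eX_kt (Negz 1) pb) _; rewrite (expcoef1 S00) expcrE invr1 vscale1r.
by [].
Qed.

Lemma eX_m3 v : pure v -> eX s i (Negz 2) v = 2%:R^-1 *:
  (sg R s *: X i (Negz 1) (tr (su s i) v)
   + X i (Negz 0) (X i (Negz 0) (tr (su s i) v))).
Proof.
move=> pv; have lt := tr_lin (R := R) (su s i).
refine (pure_ext (vop_lin _ _) (lin_scale 2%:R^-1 (lin_add
    (lin_scale (sg R s) (lin_comp (bos_lin false i (Negz 1)) lt))
    (lin_comp (bos_lin false i (Negz 0)) (lin_comp (bos_lin false i (Negz 0)) lt))))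
  pv _) => b pb.
apply: etrans (eX_kt (Negz 2) pb) _; rewrite (expcoef2 S00 S0) /comp.
set w := tr _ _.
have -> : S 2%N w = 2%:R^-1 *: (sg R s *: X i (Negz 1) w) by rewrite expcrE.
have E1 w' : S 1%N w' = sg R s *: X i (Negz 0) w' by rewrite expcrE invr1 vscale1r.
rewrite (E1 w) (E1 _) (linZ (bos_lin _ _ _)) sgK.
by vring.
Qed.
End OneVariable.

Local Notation v0 := (vk 0).

Lemma vacE : vac R N = v0. Proof. by rewrite -ktE. Qed.

(** The field applied to the vacuum is regular at z = 0. Asking only that zero be preserved, instead
    of [good], makes the notion apply to vertex operators as well. *)
Definition creative (a : field) := (forall n, a n 0 = 0) /\ forall r : nat, a r v0 = 0.

Lemma nop_trunc K s (a b : field) n v :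
  (forall j : nat, (K <= j)%N -> nterm s a b n v j = 0) ->
  nop s a b n v = \sum_(j < K) nterm s a b n v j.
Proof. by move=> h; rewrite nopE (lfsumE h). Qed.

Lemma sum2 (F : nat -> V) : \sum_(j < 2) F j = F 0%N + F 1%N.
Proof. by rewrite !big_ord_recr big_ord0 /= add0r. Qed.

Lemma sum3 (F : nat -> V) : \sum_(j < 3) F j = F 0%N + F 1%N + F 2%N.
Proof. by rewrite !big_ord_recr big_ord0 /= add0r. Qed.

Lemma nop_m1 s (a b : field) v : (forall n, a n 0 = 0) -> (forall n, b n 0 = 0) ->
  (forall r : nat, b r.+1 v = 0) -> (forall r : nat, a r.+2 v = 0) ->
  nop s a b (Negz 0) v = a (Negz 0) (b (Negz 0) v) + a (Negz 1) (b 0%:Z v)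
    + (sg R s *: b (Negz 1) (a 0%:Z v) + sg R s *: b (Negz 2) (a 1%:Z v)).
Proof.
move=> a0 b0 bv av; rewrite (@nop_trunc 2) => [|[|[|j]] // _].
  by apply: etrans (sum2 (nterm s a b (Negz 0) v)) _; rewrite /nterm; vring.
rewrite /nterm av b0 scaler0 addr0.
by rewrite -[Negz 0 + j.+2%:Z]/(j.+1%:Z) bv a0.
Qed.

Lemma nop_m2 s (a b : field) v : (forall n, a n 0 = 0) -> (forall n, b n 0 = 0) ->
  (forall r : nat, b r.+1 v = 0) -> (forall r : nat, a r v = 0) ->
  nop s a b (Negz 1) v = a (Negz 0) (b (Negz 1) v) + (a (Negz 1) (b (Negz 0) v)
    + a (Negz 2) (b 0%:Z v)).
Proof.
move=> a0 b0 bv av; rewrite (@nop_trunc 3) => [|[|[|[|j]]] // _].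
  apply: etrans (sum3 (nterm s a b (Negz 1) v)) _; rewrite /nterm.
  by rewrite -> (av 0%N), (av 1%N), (av 2%N), !b0; vring.
rewrite /nterm av b0 scaler0 addr0.
by rewrite -[Negz 1 + j.+3%:Z]/(j.+1%:Z) bv a0.
Qed.

Lemma creative_state s (a b : field) : creative a -> creative b ->
  nop s a b (Negz 0) v0 = a (Negz 0) (b (Negz 0) v0).
Proof.
move=> [a0 av] [b0 bv]; apply: etrans (nop_m1 s a0 b0 (fun r => bv r.+1) (fun r => av r.+2)) _.
rewrite -> (av 0%N), (av 1%N), (bv 0%N), !b0, !a0; vring.
Qed.

Lemma creative_nop s (a b : field) : creative a -> creative b -> creative (nop s a b).
Proof.
move=> [a0 av] [b0 bv]; split=> [n|r]; rewrite nopE lfsum0 // => j; rewrite /nterm.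
  by rewrite !(a0, b0) scaler0 addr0.
by rewrite av b0 scaler0 addr0 -PoszD bv a0.
Qed.

Lemma creative_deriv (a : field) : creative a -> creative (deriv a).
Proof.
move=> [a0 av]; split=> [n|[|r]]; rewrite /Defs.deriv; first by rewrite a0 scaler0.
  by rewrite oppr0 scale0r.
have -> : r.+1%:Z - 1 = r%:Z by rewrite intS addrC addKr.
by rewrite av scaler0.
Qed.

Lemma creativeD (a b : field) : creative a -> creative b -> creative (a + b).
Proof.
by move=> [a0 av] [b0 bv]; split=> [n|r]; rewrite fieldD ?a0 ?b0 ?av ?bv addr0.
Qed.

Lemma creativeZ k (a : field) : creative a -> creative (k *: a).
Proof. by move=> [a0 av]; split=> [n|r]; rewrite fieldZ ?a0 ?av scaler0. Qed.

Lemma creativeN (a : field) : creative a -> creative (- a).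
Proof. by move=> ca; rewrite -scaleN1r; apply: creativeZ. Qed.

Lemma creative_fer s j : creative (fer s j).
Proof. by split=> [n|r]; [exact: (lin0 (fer_lin _ _ _))|exact: fer_vk]. Qed.

Lemma creative_bos s j : creative (bos s j).
Proof.
split=> [n|[|r]]; [exact: (lin0 (bos_lin _ _ _))| |exact: bos_vk].
have z : (if s then (0 : momentum N).1 0 j else (0 : momentum N).2 0 j) = 0.
  by case: (s); rewrite mxE.
by rewrite bos0E z rmorph0 scale0r.
Qed.

Lemma creative_chi j : creative (chi j).
Proof. by apply: creative_nop; apply: creative_fer. Qed.

Lemma creative_eX s j : creative (eX s j).
Proof.
split=> [n|r]; first exact: (lin0 (vop_lin _ _)).
by rewrite eX_pos //; apply: pure_vk.
Qed.

End States.

Ltac creative_field :=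
  lazymatch goal with
  | |- creative (Defs.nop _ _ _) => apply creative_nop; creative_field
  | |- creative (Defs.deriv _) => apply creative_deriv; creative_field
  | |- creative (@GRing.add _ _ _) => apply creativeD; creative_field
  | |- creative (@GRing.opp _ _) => apply creativeN; creative_field
  | |- creative (@GRing.scale _ _ _ _) => apply creativeZ; creative_field
  | |- creative (@Defs.fer _ _ _ _) => apply creative_fer
  | |- creative (@Defs.bos _ _ _ _) => apply creative_bos
  | |- creative (@Defs.chi _ _ _) => apply creative_chi
  | |- creative (@Defs.eX _ _ _ _) => apply creative_eX
  | |- creative _ => assumption
  end.

Ltac pure_vector :=
  lazymatch goal with
  | |- pure (@Defs.fer _ _ _ _ _ _) => apply pure_fer; pure_vector
  | |- pure (@Defs.bos _ _ _ _ _ _) => apply pure_X; pure_vector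
  | |- pure _ => apply pure_vk
  end.

(** * The states of the Landau-Ginzburg fields *)

Section LGStates.
Variables (R : realType) (N : nat).
Local Notation C := R[i].
Local Notation V := (fock R N).
Local Notation field := (field R N).
Local Notation deriv := (@Defs.deriv R N).
Local Notation bos := (@bos R N).
Local Notation fer := (@fer R N).
Local Notation X := (@bos false).
Local Notation A := (@bos true).
Local Notation P := (@fer false).
Local Notation Q := (@fer true).
Local Notation chi := (@chi R N).
Local Notation kt := (@sket R N).
Local Notation vk l := (kt (l, mset0, fset0)).
Local Notation eX := (@eX R N).
Local Notation tr := (@tr R N).
Local Notation ni := (N%:R^-1 : C).
Local Notation v0 := (vk 0).
Implicit Types (j : 'I_N) (l : momentum N) (v : V) (s : bool).

Section OneVariable.
Variable i : 'I_N.
Local Notation e := (vk (su false i)).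
Local Notation e' := (vk (su true i)).
Local Notation "'X_' r" := (X i (Negz r)) (at level 8, r at level 2).
Local Notation "'A_' r" := (A i (Negz r)) (at level 8, r at level 2).
Local Notation "'P_' r" := (P i (Negz r)) (at level 8, r at level 2).
Local Notation "'Q_' r" := (Q i (Negz r)) (at level 8, r at level 2).
Local Notation h := (A i - chi i).

Let gP j : good (P j) := fer_good R false j.
Let gQ j : good (Q j) := fer_good R true j.
Let gA j : good (A j) := bos_good R true j.

Let tr1 : tr (su true i) e = v0.
Proof.
rewrite trE; congr (kt (_, _, _)).
by apply: injective_projections; rewrite /= ?addr0 // addrN.
Qed.
Let tr2 : tr (su false i) e' = v0.
Proof.
rewrite trE; congr (kt (_, _, _)).
by apply: injective_projections; rewrite /= ?addr0 // addNr.
Qed.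
Let tr3 s : tr (su s i) v0 = vk (su s i).
Proof. by rewrite trE add0r. Qed.

Lemma bx_m1 : @bx R N i (Negz 0) v0 = e.
Proof. by rewrite /bx eX_m1 ?tr3 //; pure_vector. Qed.

Lemma bx_m2 : @bx R N i (Negz 1) v0 = X_ 0 e.
Proof. by rewrite /bx eX_m2 ?tr3 ?sg_false ?vscale1r //; pure_vector. Qed.

Lemma bdx_m1 : @bdx R N i (Negz 0) v0 = P_ 0 e.
Proof.
rewrite /bdx creative_state; [|creative_field|creative_field].
by rewrite eX_m1 ?tr_fer ?tr3 //; pure_vector.
Qed.

Lemma bpdx_m1 : @bpdx R N i (Negz 0) v0 = Q_ 0 e'.
Proof.
rewrite /bpdx creative_state; [|creative_field|creative_field].
by rewrite eX_m1 ?tr_fer ?tr3 //; pure_vector.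
Qed.

Lemma bpdx_m2 : @bpdx R N i (Negz 1) v0 = Q_ 1 e' - X_ 0 (Q_ 0 e').
Proof.
have [c0 cv] := creative_eX R true i; have [d0 dv] := creative_fer R true i.
apply: etrans (nop_m2 false c0 d0 (fun r => dv r.+1) cv) _.
have p1 : pure (Q_ 1 v0) by pure_vector.
have p0 : pure (Q_ 0 v0) by pure_vector.
rewrite -> (dv 0%N), (c0 (Negz 2)), (eX_m1 true i p1), (eX_m2 true i p0).
rewrite -> !tr_fer, tr3, sg_true; vring.
Qed.

Lemma chi_m1 : chi i (Negz 0) v0 = P_ 0 (Q_ 0 v0).
Proof. exact: (creative_state true (creative_fer R false i) (creative_fer R true i)). Qed.

Lemma chi_PE m n v : chi i m (P i n v) = P i n (chi i m v) + P i (m + n) v.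
Proof. by have -> := comm_move (@chi_P1 R N i m n v); rewrite sg_false; vring. Qed.

Lemma chi_bosE s j m n v : chi i m (bos s j n v) = bos s j n (chi i m v).
Proof.
by have -> := comm_move (@bos_chi R N s j i n m v); rewrite sg_false; vring.
Qed.

Lemma chi_vk (r : nat) l : chi i r (vk l) = 0.
Proof.
have [h _] : vacuum_free (chi i) by apply: vacuum_free_nop => //; apply: vacuum_free_fer.
exact: h.
Qed.

Lemma deriv_m1 (a : field) v : deriv a (Negz 0) v = a (Negz 1) v.
Proof. by rewrite /Defs.deriv -[(- Negz 0)%:~R]/(1 : C) vscale1r. Qed.

(** The identity :chi psi: = psi' evaluated on the vacuum replaces an expansion into modes. *)
Lemma chi_m1P : chi i (Negz 0) (P_ 0 v0) = P_ 1 v0.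
Proof.
have := congr1 (fun a : field => a (Negz 0) v0) (@nop_chiP R N i).
by rewrite (creative_state false (creative_chi R i) (creative_fer R false i)) deriv_m1.
Qed.

Lemma A0e : A i 0 e = e.
Proof. by rewrite bos0E /su /= mxE !eqxx rmorph1 vscale1r. Qed.

Lemma QP_e (r : nat) : Q i r (P_ 0 e) = (r == 0%N)%:R *: e.
Proof.
have := @fer_comm R N true false i i r (Negz 0) e.
rewrite fer_vk (lin0 (fer_lin _ _ _)) addr0 eqxx => ->.
by apply: eq_scale; congr (_%:R); case: r.
Qed.

Let hr0 n : h n 0 = 0 := lin0 (good_lin (goodB (gA i) (good_nop true (gP i) (gQ i))) n).
Let eX0 n : eX true i n 0 = 0 := lin0 (vop_lin _ n).

Lemma Achi_e (r : nat) : h r e = (r == 0%N)%:R *: e.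
Proof.
rewrite fieldD fieldN chi_vk subr0; case: r => [|r]; first by rewrite A0e vscale1r.
by rewrite bos_vk scale0r.
Qed.

(** The zero modes of X*_i and of chi_i both act by 1 here and cancel: d/dx_i has no contraction
    with dx_i. *)
Lemma Achi_P (r : nat) : h r (P_ 0 e) = 0.
Proof.
rewrite fieldD fieldN chi_PE chi_vk (lin0 (fer_lin _ _ _)) add0r bos_fer_comm.
case: r => [|r]; first by rewrite A0e subrr.
rewrite bos_vk (lin0 (fer_lin _ _ _)) sub0r.
have -> : r.+1%:Z + Negz 0 = r%:Z by rewrite NegzE intS addrC addKr.
by rewrite fer_vk oppr0.
Qed.

Lemma Achi_XE (r : nat) :
  h r (X_ 0 e) = (r%:~R * (r%:Z + Negz 0 == 0)%:R : C) *: e + X_ 0 (A i r e).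
Proof.
rewrite fieldD fieldN chi_bosE chi_vk (lin0 (bos_lin _ _ _)) subr0.
have c := @bos_comm R N true false i i r (Negz 0) e.
have E (u w z : V) (k k' : C) : u - w = k *: z -> k = k' -> u = k' *: z + w.
  by move=> /eqP; rewrite subr_eq => /eqP-> ->.
by apply: E c _; rewrite !eqxx.
Qed.

Let X0 n : X i n 0 = 0 := lin0 (bos_lin false i n).

Lemma Achi_X0 : h 0%:Z (X_ 0 e) = X_ 0 e.
Proof.
have E (u w z : V) : u = 0 *: z + w -> u = w by rewrite scale0r add0r.
have e0 : (0%:Z%:~R * (0%:Z + Negz 0 == 0)%:R : C) = 0 by rewrite mulr0.
have := Achi_XE 0; rewrite -> e0 => /E ->.
exact: congr1 A0e.
Qed.

Lemma Achi_X1 : h 1%:Z (X_ 0 e) = e.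
Proof.
have E (u w z : V) : u = 1 *: z + w -> w = 0 -> u = z by move=> -> ->; rewrite vscale1r addr0.
have e0 : (1%:Z%:~R * (1%:Z + Negz 0 == 0)%:R : C) = 1 by rewrite mulr1.
have := Achi_XE 1; rewrite -> e0 => h1; apply: E h1 _.
exact: etrans (congr1 _ (@bos_vk R N true i 0 _)) (X0 _).
Qed.

Lemma Achi_X2 (r : nat) : h r.+2 (X_ 0 e) = 0.
Proof.
have E (u w z : V) : u = 0 *: z + w -> w = 0 -> u = 0 by rewrite scale0r add0r => ->.
have e0 : (r.+2%:Z%:~R * (r.+2%:Z + Negz 0 == 0)%:R : C) = 0 by rewrite mulr0.
have := Achi_XE r.+2; rewrite -> e0 => h1; apply: E h1 _.
exact: etrans (congr1 _ (@bos_vk R N true i r.+1 _)) (X0 _).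
Qed.

Let hE n v : h n v = A i n v - chi i n v. Proof. by []. Qed.

(** The nonnegative modes of e^{-X_i} kill a [pure] vector, so beyond the leading term only the
    contractions of X*_i - chi_i with w at modes 0 and 1 contribute. *)
Lemma bpx_eval w : pure w -> (forall r : nat, h r.+2 w = 0) ->
  @bpx R N i (Negz 0) w = h (Negz 0) (tr (su true i) w)
    + (eX true i (Negz 1) (h 0%:Z w) + eX true i (Negz 2) (h 1%:Z w)).
Proof.
move=> pw hw.
apply: etrans (nop_m1 false hr0 eX0 (fun r => eX_pos true i r.+1 pw) hw) _.
rewrite -> (eX_pos true i 0 pw), hr0, sg_false, (eX_m1 true i pw).
by vring.
Qed.

Lemma bpx_P : @bpx R N i (Negz 0) (P_ 0 e) = A_ 0 (P_ 0 v0) - P_ 1 v0.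
Proof.
have pw : pure (P_ 0 e) by pure_vector.
have h0 : h 0%:Z (P_ 0 e) = 0 := Achi_P 0.
have h1 : h 1%:Z (P_ 0 e) = 0 := Achi_P 1.
have h2 (r : nat) : h r.+2 (P_ 0 e) = 0 := Achi_P r.+2.
apply: etrans (bpx_eval pw h2) _.
rewrite -> h0, h1, (eX0 (Negz 1)), (eX0 (Negz 2)), tr_fer, tr1, hE, chi_m1P.
by vring.
Qed.

Lemma QP_v0 : P_ 0 (Q_ 0 v0) = - Q_ 0 (P_ 0 v0).
Proof.
have := @fer_comm R N false true i i (Negz 0) (Negz 0) v0.
by rewrite -[_ == -1]/false andbF scale0r => /eqP; rewrite addr_eq0 => /eqP.
Qed.

Lemma bpx_e : @bpx R N i (Negz 0) e = A_ 0 v0 + Q_ 0 (P_ 0 v0) - X_ 0 v0.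
Proof.
have pw : pure e by pure_vector.
have h2 (r : nat) : h r.+2 e = 0 by rewrite Achi_e scale0r.
rewrite -> (bpx_eval pw h2), (Achi_e 0), (Achi_e 1), scale0r, vscale1r, eX0.
rewrite -> (eX_m2 true i pw), tr1, hE, chi_m1, QP_v0, sg_true.
by vring.
Qed.

Lemma bpx_X : @bpx R N i (Negz 0) (X_ 0 e) = A_ 0 (X_ 0 v0) + X_ 0 (Q_ 0 (P_ 0 v0))
  - 2%:R^-1 *: (X_ 0 (X_ 0 v0) + X_ 1 v0).
Proof.
have pe : pure e by pure_vector.
have pw : pure (X_ 0 e) by pure_vector.
rewrite -> (bpx_eval pw Achi_X2), Achi_X0, Achi_X1, (eX_m2 true i pw), (eX_m3 true i pe).
rewrite -> tr_bosN, tr1, hE, chi_bosE, chi_m1, QP_v0, (linN (bos_lin _ _ _)), sg_true.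
by vfield.
Qed.

Lemma bpdx_P1 : @bpdx R N i (Negz 0) (P_ 0 e) = Q_ 0 (P_ 0 v0) - X_ 0 v0.
Proof.
have pe : pure e by pure_vector.
have pw : pure (P_ 0 e) by pure_vector.
have pq : pure (Q_ 0 (P_ 0 e)) by pure_vector.
have q1 (r : nat) : Q i r.+1 (P_ 0 e) = 0 by rewrite QP_e scale0r.
have q0 : Q i 0%:Z (P_ 0 e) = e by rewrite QP_e vscale1r.
have fl n := lin0 (@fer_lin R N true i n).
apply: etrans (nop_m1 false eX0 fl q1 (fun r => eX_pos true i r.+2 pw)) _.
rewrite -> q0, (eX_pos true i 0 pw), (eX_pos true i 1 pw), (fl (Negz 1)), (fl (Negz 2)).
rewrite -> (eX_m1 true i pq), (eX_m2 true i pe), !tr_fer, tr1, sg_true, sg_false.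
by vring.
Qed.

Lemma bpdx_P2 : @bpdx R N i (Negz 1) (P_ 0 e) = Q_ 1 (P_ 0 v0) - X_ 0 (Q_ 0 (P_ 0 v0))
  + 2%:R^-1 *: (X_ 0 (X_ 0 v0) - X_ 1 v0).
Proof.
have pe : pure e by pure_vector.
have pw : pure (P_ 0 e) by pure_vector.
have pq0 : pure (Q_ 0 (P_ 0 e)) by pure_vector.
have pq1 : pure (Q_ 1 (P_ 0 e)) by pure_vector.
have q1 (r : nat) : Q i r.+1 (P_ 0 e) = 0 by rewrite QP_e scale0r.
have q0 : Q i 0%:Z (P_ 0 e) = e by rewrite QP_e vscale1r.
have fl n := lin0 (@fer_lin R N true i n).
apply: etrans (nop_m2 false eX0 fl q1 (fun r => eX_pos true i r pw)) _.
rewrite -> q0, (eX_m1 true i pq1), (eX_m2 true i pq0), (eX_m3 true i pe), !tr_fer, tr1, sg_true.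
by vring.
Qed.

Let cbx : creative (@bx R N i). Proof. rewrite /bx; creative_field. Qed.
Let cbdx : creative (@bdx R N i). Proof. rewrite /bdx; creative_field. Qed.
Let cbpx : creative (@bpx R N i). Proof. rewrite /bpx; creative_field. Qed.
Let cbpdx : creative (@bpdx R N i). Proof. rewrite /bpdx; creative_field. Qed.

Lemma sumG_state : nop false (@bpx R N i) (bdx i) (Negz 0) v0 = sumG i (Negz 0) v0.
Proof.
rewrite -> (creative_state false cbpx cbdx), bdx_m1, bpx_P.
have ca : creative (A i) by creative_field. have cp : creative (P i) by creative_field.
rewrite -[RHS]/(nop false (A i) (P i) (Negz 0) v0 - deriv (P i) (Negz 0) v0).
by rewrite -> deriv_m1, (creative_state false ca cp).
Qed.

Lemma sumQ_state : (- (ni *: nop false (@bx R N i) (deriv (bpdx i)))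
   - (ni - 1) *: nop false (deriv (bx i)) (bpdx i)) (Negz 0) v0 = sumQ i (Negz 0) v0.
Proof.
have p0 : pure (Q_ 0 e') by pure_vector.
have p1 : pure (Q_ 1 e') by pure_vector.
have px : pure (X_ 0 (Q_ 0 e')) by pure_vector.
have s1 : nop false (@bx R N i) (deriv (bpdx i)) (Negz 0) v0 = Q_ 1 v0 - X_ 0 (Q_ 0 v0).
  rewrite -> (creative_state false cbx (creative_deriv cbpdx)), deriv_m1, bpdx_m2.
  apply: etrans (linB (vop_lin (su false i) (Negz 0)) _ _) _.
  apply: (congr2 (fun u w : V => u - w)).
    refine (etrans (eX_m1 false i p1) _).
    rewrite -> tr_fer.
    rewrite -> tr2.
    reflexivity.
  refine (etrans (eX_m1 false i px) _).
  rewrite -> tr_bosN.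
  rewrite -> tr_fer, tr2.
  reflexivity.
have s2 : nop false (deriv (@bx R N i)) (bpdx i) (Negz 0) v0 = X_ 0 (Q_ 0 v0).
  rewrite -> (creative_state false (creative_deriv cbx) cbpdx), deriv_m1, bpdx_m1.
  refine (etrans (eX_m2 false i p0) _).
  rewrite -> tr_fer, tr2, sg_false.
  exact: vscale1r.
have ca : creative (X i) by creative_field. have cp : creative (Q i) by creative_field.
rewrite -[LHS]/(- (ni *: nop false (@bx R N i) (deriv (bpdx i)) (Negz 0) v0)
  - (ni - 1) *: nop false (deriv (@bx R N i)) (bpdx i) (Negz 0) v0).
rewrite -[RHS]/(nop false (X i) (Q i) (Negz 0) v0 - ni *: deriv (Q i) (Negz 0) v0).
rewrite -> s1, s2, deriv_m1, (creative_state false ca cp).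
by vring.
Qed.

(** Both products contain psi* psi - X, with coefficients -1/N and 1/N - 1; their sum -1 accounts
    for the term X + chi of J. *)
Lemma sumJ_state : (- (ni *: nop false (@bpx R N i) (bx i))
   + (ni - 1) *: nop true (bpdx i) (bdx i)) (Negz 0) v0 = sumJ i (Negz 0) v0.
Proof.
rewrite -[LHS]/(- (ni *: nop false (@bpx R N i) (bx i) (Negz 0) v0)
  + (ni - 1) *: nop true (@bpdx R N i) (bdx i) (Negz 0) v0).
rewrite -[RHS]/(- (ni *: A_ 0 v0) + X_ 0 v0 + chi i (Negz 0) v0).
rewrite -> (creative_state false cbpx cbx), (creative_state true cbpdx cbdx).
rewrite -> bx_m1, bdx_m1, bpx_e, bpdx_P1, chi_m1, QP_v0.
by vring.
Qed.

Lemma XA_v0 : X_ 0 (A_ 0 v0) = A_ 0 (X_ 0 v0).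
Proof.
have E (u w z : V) (k : C) : u - w = k *: z -> k = 0 -> u = w.
  by move=> /eqP; rewrite subr_eq => /eqP-> ->; rewrite scale0r add0r.
by refine (E _ _ _ _ (@bos_comm R N false true i i (Negz 0) (Negz 0) v0) _); rewrite andbF mulr0.
Qed.

(** The terms quadratic in X_i and the terms X_i psi* psi of the two products cancel; the two halves
    of X_i' add up to -X_i'. *)
Lemma sumL_state : (nop false (@bpx R N i) (deriv (bx i))
   + nop true (deriv (bpdx i)) (bdx i)) (Negz 0) v0 = sumL i (Negz 0) v0.
Proof.
have cx : creative (X i) by creative_field. have ca : creative (A i) by creative_field.
have cp : creative (P i) by creative_field.
have cq : creative (deriv (Q i)) by creative_field.
rewrite -[LHS]/(nop false (@bpx R N i) (deriv (bx i)) (Negz 0) v0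
  + nop true (deriv (@bpdx R N i)) (bdx i) (Negz 0) v0).
rewrite -[RHS]/(nop false (X i) (A i) (Negz 0) v0 - deriv (X i) (Negz 0) v0
  + nop true (deriv (Q i)) (P i) (Negz 0) v0).
rewrite -> (creative_state false cbpx (creative_deriv cbx)).
rewrite -> (creative_state true (creative_deriv cbpdx) cbdx), !deriv_m1, bx_m2, bdx_m1.
rewrite -> bpx_X, bpdx_P2, (creative_state false cx ca).
rewrite -> (creative_state true cq cp), !deriv_m1.
by rewrite -> XA_v0; vfield.
Qed.

End OneVariable.

Lemma stateofE (a : field) : stateof a = a (Negz 0) v0.
Proof. by rewrite /stateof vacE. Qed.

Lemma state_G : stateof (@LG_G R N) = @totG R N (Negz 0) v0.
Proof.
rewrite -> stateofE; unfold LG_G, totG.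
apply: etrans (field_sum _ _ _ _ _) (etrans _ (esym (field_sum _ _ _ _ _))).
refine (eq_bigr _ (fun i _ => sumG_state i)).
Qed.

Lemma state_Q : stateof (@LG_Q R N) = @totQ R N (Negz 0) v0.
Proof.
rewrite -> stateofE; unfold LG_Q, totQ.
apply: etrans (field_sum _ _ _ _ _) (etrans _ (esym (field_sum _ _ _ _ _))).
refine (eq_bigr _ (fun i _ => sumQ_state i)).
Qed.

Lemma state_J : stateof (@LG_J R N) = @totJ R N (Negz 0) v0.
Proof.
rewrite -> stateofE; unfold LG_J, totJ.
apply: etrans (field_sum _ _ _ _ _) (etrans _ (esym (field_sum _ _ _ _ _))).
refine (eq_bigr _ (fun i _ => sumJ_state i)).
Qed.

Lemma state_L : stateof (@LG_L R N) = @totL R N (Negz 0) v0.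
Proof.
rewrite -> stateofE; unfold LG_L, totL.
apply: etrans (field_sum _ _ _ _ _) (etrans _ (esym (field_sum _ _ _ _ _))).
refine (eq_bigr _ (fun i _ => sumL_state i)).
Qed.

End LGStates.

(** * The state-field correspondence *)

Section StateField.
Variables (R : realType) (N : nat).
Local Notation V := (fock R N).
Local Notation field := (field R N).
Local Notation deriv := (@Defs.deriv R N).
Local Notation idf := (@idf R N).
Local Notation bos := (@bos R N).
Local Notation fer := (@fer R N).
Local Notation kt := (@sket R N).
Local Notation vk l := (kt (l, mset0, fset0)).
Local Notation vop := (@vop R N).
Local Notation Y := (@Y R N).
Local Notation v0 := (vk 0).
Local Notation lb N := (label N).
Implicit Types (i j : 'I_N) (l : momentum N) (v : V) (s t : bool) (x y : lb N).

Lemma Y_lin : lin (Y : V -> field). Proof. exact: lext_lin. Qed.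

Lemma Y_kt b : Y (kt b) = @basisY R N b. Proof. exact: lext_kt. Qed.

Lemma divderiv0 (a : field) : divderiv 0 a = a.
Proof. by rewrite /divderiv fact0 invr1 /= scale1r. Qed.

Lemma divderiv1 (a : field) : divderiv 1 a = deriv a.
Proof. by rewrite /divderiv invr1 /= scale1r. Qed.

Lemma good_divderiv r (a : field) : good a -> good (divderiv r a).
Proof. by move=> ga; apply: goodZ; elim: r => //= r; apply: good_deriv. Qed.

Local Notation le := (fun x y : label N => (choice.pickle x <= choice.pickle y)%N).

Let le_total : total le. Proof. by move=> x y; apply: leq_total. Qed.
Let le_trans : transitive le. Proof. by move=> x y z; apply: leq_trans. Qed.
Let le_anti : antisymmetric le.
Proof. by move=> x y; rewrite -eqn_leq => /eqP; apply: (pcan_inj choice.pickleK). Qed.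

Lemma sort_fset0 : sort le (enum_fset (fset0 : {fset label N})) = [::].
Proof.
apply: etrans (_ : sort le [::] = _); last by [].
apply/(perm_sortP le_total le_trans le_anti); apply: uniq_perm => //.
Qed.

Lemma sort_fset1 x : sort le (enum_fset (x |` fset0)%fset) = [:: x].
Proof.
apply: etrans (_ : sort le [:: x] = _); last by [].
apply/(perm_sortP le_total le_trans le_anti); apply: uniq_perm => //.
  exact: fset_uniq.
move=> z.
by rewrite -[LHS]/(z \in (x |` fset0)%fset) !inE orbF.
Qed.

Lemma sort_fset2 x y : x != y -> sort le (enum_fset (x |` (y |` fset0))%fset) =
  if (choice.pickle x < choice.pickle y)%N then [:: x; y] else [:: y; x].
Proof.
move=> xy; apply: etrans (_ : sort le [:: x; y] = _).
  apply/(perm_sortP le_total le_trans le_anti); apply: uniq_perm; first exact: fset_uniq.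
    by rewrite /= inE xy.
  by move=> z; rewrite -[LHS]/(z \in (x |` (y |` fset0))%fset) !inE orbF.
have nxy : choice.pickle x != choice.pickle y.
  by apply: contra xy => /eqP /(pcan_inj choice.pickleK) ->.
by rewrite ltn_neqAle nxy /sort /=; case: leqP.
Qed.

Lemma enum_mset1 x : enum_mset (x +` mset0)%mset = [:: x].
Proof. apply: perm_small_eq => //.
have -> : (x +` mset0)%mset = seq_mset [:: x] by rewrite -[mset0]seq_mset_id enum_mset0 -mset_cons.
exact: perm_eq_seq_mset. Qed.

Definition dfer x : field := divderiv x.2 (fer x.1.1 x.1.2).
Definition dbos x : field := divderiv x.2 (bos x.1.1 x.1.2).

Lemma good_dfer x : good (dfer x).
Proof. by apply: good_divderiv; apply: fer_good. Qed.
Lemma good_dbos x : good (dbos x).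
Proof. by apply: good_divderiv; apply: bos_good. Qed.

Lemma basisY_vk l : @basisY R N (l, mset0, fset0) = vop l.
Proof. by rewrite /basisY enum_mset0 sort_fset0. Qed.

Lemma Y_vk l : Y (vk l) = vop l.
Proof. by rewrite Y_kt basisY_vk. Qed.

Lemma fer_vkN s i r l : fer s i (Negz r) (vk l) = kt (l, mset0, ((s, i, r) |` fset0)%fset).
Proof. by rewrite ferNE in_fset0 /fsign /= vscale1r. Qed.

Lemma Y_fer s i r l :
  Y (fer s i (Negz r) (vk l)) = nop false (dfer (s, i, r)) (vop l).
Proof. by rewrite fer_vkN Y_kt /basisY enum_mset0 sort_fset1. Qed.

(** [basisY] lists fermions in the order of [pickle], which is not known for given labels. Both
    orders have to be allowed; the sign of the basis vector compensates in the second. *)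
Lemma Y_fer_fer s i r t j q l : (s, i, r) != (t, j, q) ->
  Y (fer s i (Negz r) (fer t j (Negz q) (vk l))) =
  let x := (s, i, r) : label N in let y := (t, j, q) : label N in
  if (choice.pickle x < choice.pickle y)%N
  then nop true (dfer x) (nop false (dfer y) (vop l))
  else - nop true (dfer y) (nop false (dfer x) (vop l)).
Proof.
move=> xy.
have nin : (s, i, r) \notin ((t, j, q) |` fset0 : {fset label N})%fset by rewrite in_fset1U in_fset0 orbF.
rewrite fer_vkN ferNE (negPf nin) (linZ Y_lin) Y_kt /basisY enum_mset0.
rewrite sort_fset2 //= fsignU1 ?in_fset0 // /xsign /fsign /= mulr1.
case: ltngtP => [_|_|/(pcan_inj choice.pickleK) e]; last by case/eqP: xy.
  by rewrite expr1 scaleN1r.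
by rewrite expr0 scale1r.
Qed.

Lemma Y_bos s i r l F :
  Y (bos s i (Negz r) (kt (l, mset0, F))) = nop false (dbos (s, i, r)) (Y (kt (l, mset0, F))).
Proof. by rewrite bosNE !Y_kt /basisY enum_mset1 enum_mset0. Qed.

Lemma Y_bos_fer s i r t j q l : Y (bos s i (Negz r) (fer t j (Negz q) (vk l))) =
  nop false (dbos (s, i, r)) (nop false (dfer (t, j, q)) (vop l)).
Proof.
refine (etrans (congr1 (fun u => Y (bos s i (Negz r) u)) (fer_vkN t j q l)) _).
refine (etrans (Y_bos _ _ _ _ _) (congr1 (nop false _) _)).
exact: etrans (esym (congr1 Y (fer_vkN t j q l))) (Y_fer t j q l).
Qed.

Lemma enum_mset2 x y : enum_mset (x +` (y +` mset0))%mset = [:: x; y] \/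
  enum_mset (x +` (y +` mset0))%mset = [:: y; x].
Proof.
have p : perm_eq (enum_mset (x +` (y +` mset0))%mset) [:: x; y].
  have -> : (x +` (y +` mset0))%mset = seq_mset [:: x; y].
    by rewrite -[mset0]seq_mset_id enum_mset0 -!mset_cons.
  exact: perm_eq_seq_mset.
have := perm_size p; move: p; case: (enum_mset _) => [|a [|b [|? ?]]] // p _.
move: (perm_mem p a); rewrite !inE eqxx /= => /esym /orP[]/eqP e; subst a; [left|right].
  by move: p; rewrite perm_cons => /perm_mem/(_ b); rewrite !inE eqxx => /esym/eqP ->.
have : perm_eq [:: y; b] [:: y; x].
  by apply: perm_trans p _; rewrite (perm_catC [:: x] [:: y]).
by rewrite perm_cons => /perm_mem/(_ b); rewrite !inE eqxx => /esym/eqP ->.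
Qed.

Lemma nop_v0 (a : field) : good a -> nop false a (vop 0) = a.
Proof. by move=> ga; rewrite vop0 nop_idr. Qed.

Lemma Y_v0 : Y v0 = idf.
Proof. by rewrite Y_vk vop0. Qed.

Lemma Y_fer0 s i r : Y (fer s i (Negz r) v0) = dfer (s, i, r).
Proof. exact: etrans (Y_fer s i r 0) (nop_v0 (good_dfer _)). Qed.

Lemma Y_bos0 s i r : Y (bos s i (Negz r) v0) = dbos (s, i, r).
Proof. by rewrite Y_bos Y_v0 nop_idr //; apply: good_dbos. Qed.

Lemma Y_bos_fer0 s i r t j q : Y (bos s i (Negz r) (fer t j (Negz q) v0)) =
  nop false (dbos (s, i, r)) (dfer (t, j, q)).
Proof.
refine (etrans (Y_bos_fer _ _ _ _ _ _ _) (congr1 (nop false _) _)).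
exact: nop_v0 (good_dfer _).
Qed.

(** The anticommutation [sw] makes the two possible orders of the labels give the same field.
    [Y_bos_bos0] treats the unspecified order of a multiset in the same way. *)
Lemma Y_fer_fer0 s i r t j q : (s, i, r) != (t, j, q) ->
  nop true (dfer (t, j, q)) (dfer (s, i, r)) = - nop true (dfer (s, i, r)) (dfer (t, j, q)) ->
  Y (fer s i (Negz r) (fer t j (Negz q) v0)) = nop true (dfer (s, i, r)) (dfer (t, j, q)).
Proof.
move=> xy sw; refine (etrans (Y_fer_fer 0 xy) _); cbv zeta.
case: ifP => _.
  exact (congr1 (nop true _) (nop_v0 (good_dfer (t, j, q)))).
refine (etrans (congr1 (fun a : field => - nop true _ a) (nop_v0 (good_dfer (s, i, r)))) _).
exact (etrans (congr1 (fun a : field => - a) sw) (opprK _)).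
Qed.

Lemma basisY_bos_bos x y :
  nop false (dbos y) (dbos x) = nop false (dbos x) (dbos y) ->
  @basisY R N (0, (x +` (y +` mset0))%mset, fset0) = nop false (dbos x) (dbos y).
Proof.
move=> sw; have e (a b : label N) : bosY [:: a; b] (ferY (sort le (enum_fset fset0)) (vop 0)) =
    nop false (dbos a) (dbos b).
  rewrite sort_fset0; move: a b => [[s i] r] [[t j] q].
  exact (congr1 (nop false _) (nop_v0 (good_dbos (t, j, q)))).
case: (enum_mset2 x y) => E.
  exact (etrans (congr1 (fun m => bosY m _) E) (e x y)).
exact (etrans (congr1 (fun m => bosY m _) E) (etrans (e y x) sw)).
Qed.

Lemma Y_bos_bos0 s i r t j q :
  nop false (dbos (t, j, q)) (dbos (s, i, r)) = nop false (dbos (s, i, r)) (dbos (t, j, q)) ->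
  Y (bos s i (Negz r) (bos t j (Negz q) v0)) = nop false (dbos (s, i, r)) (dbos (t, j, q)).
Proof.
move=> sw; have e1 := bosNE R t j q 0 mset0 fset0.
have e2 := bosNE R s i r 0 ((t, j, q) +` mset0)%mset fset0.
refine (etrans (congr1 (fun u => Y (bos s i (Negz r) u)) e1) _).
refine (etrans (congr1 Y e2) (etrans (Y_kt _) _)).
exact: basisY_bos_bos.
Qed.

End StateField.

(** * From states to fields: equality of the two structures *)

Section LandauGinzburgFields.
Variables (R : realType) (N : nat).
Local Notation C := R[i].
Local Notation V := (fock R N).
Local Notation field := (field R N).
Local Notation deriv := (@Defs.deriv R N).
Local Notation idf := (@idf R N).
Local Notation bos := (@bos R N).
Local Notation fer := (@fer R N).
Local Notation X := (@bos false).
Local Notation A := (@bos true).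
Local Notation P := (@fer false).
Local Notation Q := (@fer true).
Local Notation chi := (@chi R N).
Local Notation kt := (@sket R N).
Local Notation vk l := (kt (l, mset0, fset0)).
Local Notation Y := (@Y R N).
Local Notation sumG := (@sumG R N).
Local Notation sumQ := (@sumQ R N).
Local Notation sumJ := (@sumJ R N).
Local Notation sumL := (@sumL R N).
Local Notation ni := (N%:R^-1 : C).
Local Notation v0 := (vk 0).
Implicit Types (i j : 'I_N) (l : momentum N) (v : V) (s t : bool).

Let gP i : good (P i) := fer_good R false i.

Section OneVariable.
Variable i : 'I_N.
Let cX : creative (X i). Proof. exact: creative_bos. Qed.
Let cA : creative (A i). Proof. exact: creative_bos. Qed.
Let cP : creative (P i). Proof. exact: creative_fer. Qed.
Let cQ : creative (Q i). Proof. exact: creative_fer. Qed.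

Lemma sumG_v0 : sumG i (Negz 0) v0 = A i (Negz 0) (P i (Negz 0) v0) - P i (Negz 1) v0.
Proof.
rewrite -[LHS]/(nop false (A i) (P i) (Negz 0) v0 - deriv (P i) (Negz 0) v0).
by rewrite -> deriv_m1, (creative_state false cA cP).
Qed.

Lemma sumQ_v0 : sumQ i (Negz 0) v0 = X i (Negz 0) (Q i (Negz 0) v0) - ni *: Q i (Negz 1) v0.
Proof.
rewrite -[LHS]/(nop false (X i) (Q i) (Negz 0) v0 - ni *: deriv (Q i) (Negz 0) v0).
by rewrite -> deriv_m1, (creative_state false cX cQ).
Qed.

Lemma sumJ_v0 : sumJ i (Negz 0) v0 =
  - (ni *: A i (Negz 0) v0) + X i (Negz 0) v0 + P i (Negz 0) (Q i (Negz 0) v0).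
Proof.
rewrite -[LHS]/(- (ni *: A i (Negz 0) v0) + X i (Negz 0) v0 + chi i (Negz 0) v0).
by rewrite -> chi_m1.
Qed.

Lemma sumL_v0 : sumL i (Negz 0) v0 =
  X i (Negz 0) (A i (Negz 0) v0) - X i (Negz 1) v0 + Q i (Negz 1) (P i (Negz 0) v0).
Proof.
rewrite -[LHS]/(nop false (X i) (A i) (Negz 0) v0 - deriv (X i) (Negz 0) v0
  + nop true (deriv (Q i)) (P i) (Negz 0) v0).
by rewrite -> (creative_state true (creative_deriv cQ) cP), !deriv_m1, (creative_state false cX cA).
Qed.

Lemma dfer0 s : @dfer R N (s, i, 0%N) = fer s i. Proof. exact: divderiv0. Qed.
Lemma dfer1 s : @dfer R N (s, i, 1%N) = deriv (fer s i). Proof. exact: divderiv1. Qed.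
Lemma dbos0 s : @dbos R N (s, i, 0%N) = bos s i. Proof. exact: divderiv0. Qed.
Lemma dbos1 s : @dbos R N (s, i, 1%N) = deriv (bos s i). Proof. exact: divderiv1. Qed.

Lemma brk_dQP : brk true (deriv (Q i)) (P i) 0 (- idf) 0 0.
Proof. by refine (brk_eq (brk_derivl (gP i) (@QP1 R N i)) _ _ _ _); brk_goal. Qed.

Lemma nop_PdQ : nop true (P i) (deriv (Q i)) = - nop true (deriv (Q i)) (P i).
Proof.
refine (etrans (nop_swap _ _ brk_dQP) _); [good_field|good_field|].
by rewrite !(fderivN, deriv_idf, fderiv0, scaler0, oppr0); fring.
Qed.

Lemma Y_fer0_0 s : Y (fer s i (Negz 0) v0) = fer s i.
Proof. exact (etrans (Y_fer0 R s i 0) (dfer0 s)). Qed.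
Lemma Y_fer0_1 s : Y (fer s i (Negz 1) v0) = deriv (fer s i).
Proof. exact (etrans (Y_fer0 R s i 1) (dfer1 s)). Qed.
Lemma Y_bos0_0 s : Y (bos s i (Negz 0) v0) = bos s i.
Proof. exact (etrans (Y_bos0 R s i 0) (dbos0 s)). Qed.
Lemma Y_bos0_1 s : Y (bos s i (Negz 1) v0) = deriv (bos s i).
Proof. exact (etrans (Y_bos0 R s i 1) (dbos1 s)). Qed.
Lemma Y_bos_fer0_0 s t : Y (bos s i (Negz 0) (fer t i (Negz 0) v0)) = nop false (bos s i) (fer t i).
Proof. exact (etrans (Y_bos_fer0 R s i 0 t i 0) (congr2 (nop false) (dbos0 s) (dfer0 t))). Qed.

Lemma Y_chi : Y (P i (Negz 0) (Q i (Negz 0) v0)) = chi i.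
Proof.
refine (etrans (Y_fer_fer0 _ _) (congr2 (nop true) (dfer0 _) (dfer0 _))); first by [].
refine (etrans (congr2 (nop true) (dfer0 _) (dfer0 _)) (etrans (nop_QP R i) (congr1 -%R _))).
exact (esym (congr2 (nop true) (dfer0 _) (dfer0 _))).
Qed.

Lemma Y_dQP : Y (Q i (Negz 1) (P i (Negz 0) v0)) = nop true (deriv (Q i)) (P i).
Proof.
refine (etrans (Y_fer_fer0 _ _) (congr2 (nop true) (dfer1 _) (dfer0 _))); first by [].
refine (etrans (congr2 (nop true) (dfer0 _) (dfer1 _)) (etrans nop_PdQ (congr1 -%R _))).
exact (esym (congr2 (nop true) (dfer1 _) (dfer0 _))).
Qed.

Lemma Y_XA : Y (X i (Negz 0) (A i (Negz 0) v0)) = nop false (X i) (A i).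
Proof.
refine (etrans (Y_bos_bos0 _) (congr2 (nop false) (dbos0 _) (dbos0 _))).
refine (etrans (congr2 (nop false) (dbos0 _) (dbos0 _)) (etrans (nop_AX R i) _)).
exact (esym (congr2 (nop false) (dbos0 _) (dbos0 _))).
Qed.

Let YB u v : Y (u - v) = Y u - Y v := linB (@Y_lin R N) u v.
Let YD u v : Y (u + v) = Y u + Y v := linD (@Y_lin R N) u v.
Let YZ c v : Y (c *: v) = c *: Y v := linZ (@Y_lin R N) c v.
Let YN v : Y (- v) = - Y v := linN (@Y_lin R N) v.

Lemma Y_sumG : Y (sumG i (Negz 0) v0) = sumG i.
Proof. rewrite -> sumG_v0, YB, Y_bos_fer0_0, Y_fer0_1. reflexivity. Qed.

Lemma Y_sumQ : Y (sumQ i (Negz 0) v0) = sumQ i.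
Proof. rewrite -> sumQ_v0, YB, YZ, Y_bos_fer0_0, Y_fer0_1. reflexivity. Qed.

Lemma Y_sumJ : Y (sumJ i (Negz 0) v0) = sumJ i.
Proof. rewrite -> sumJ_v0, YD, YD, YN, YZ, (Y_bos0_0 false), (Y_bos0_0 true), Y_chi. reflexivity. Qed.

Lemma Y_sumL : Y (sumL i (Negz 0) v0) = sumL i.
Proof. rewrite -> sumL_v0, YD, YB, Y_XA, Y_bos0_1, Y_dQP. reflexivity. Qed.

End OneVariable.

Lemma Y_sum (F : 'I_N -> field) : (forall i, Y (F i (Negz 0) v0) = F i) ->
  Y ((\sum_i F i) (Negz 0) v0) = \sum_i F i.
Proof.
move=> YF; rewrite -> field_sum; rewrite (lin_sum (@Y_lin R N)).
by apply: eq_bigr => i _; apply: YF.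
Qed.

Lemma geomE : N2_geom R N = N2Data (@totG R N) (@totQ R N) (@totJ R N) (@totL R N).
Proof. by rewrite -(geom_G R N) -(geom_Q R N) -(geom_J R N) -(geom_L R N). Qed.

(** An equality of records of fields on the entire Fock space, so that the coincidence on [LGorb]
    becomes reflexivity. *)
Lemma LG_geom : N2_LG R N = N2_geom R N.
Proof.
rewrite geomE /N2_LG.
have e (a a' b b' c c' d d' : field) : a = a' -> b = b' -> c = c' -> d = d' ->
  N2Data a b c d = N2Data a' b' c' d' by move=> -> -> -> ->.
apply: e.
- exact (etrans (congr1 Y (state_G R N)) (Y_sum Y_sumG)).
- exact (etrans (congr1 Y (state_Q R N)) (Y_sum Y_sumQ)).
- exact (etrans (congr1 Y (state_J R N)) (Y_sum Y_sumJ)).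
exact (etrans (congr1 Y (state_L R N)) (Y_sum Y_sumL)).
Qed.

End LandauGinzburgFields.

(** * Invariant states *)

Section Invariants.
Variables (R : realType) (N : nat).
Local Notation C := R[i].
Local Notation V := (fock R N).
Local Notation field := (field R N).
Local Notation Y := (@Y R N).
Local Notation LambdaChT := (@LambdaChT R N).
Local Notation zetaN := (@zetaN R N).
Implicit Types (i j : 'I_N) (v : V) (s t : bool).

(** What [wtY] asks of an arbitrary [Y u]: that an eigenvalue can be pulled out of its argument. *)
Definition homogeneous (a : field) := forall n (k : C) v, a n (k *: v) = k *: a n v.

Lemma hom_nop s (a b : field) : homogeneous a -> homogeneous b -> homogeneous (nop s a b).
Proof.
move=> ha hb n k v; rewrite !nopE -lfsumZ; apply: eq_lfsum => j.
by rewrite /nterm !(ha, hb); vring.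
Qed.

Lemma hom_deriv (a : field) : homogeneous a -> homogeneous (deriv a).
Proof. by move=> ha n k v; rewrite /deriv ha; vring. Qed.

Lemma homZ c (a : field) : homogeneous a -> homogeneous (c *: a).
Proof. by move=> ha n k v; rewrite !fieldZ ha; vring. Qed.

Lemma hom_lin (a : field) : (forall n, lin (a n)) -> homogeneous a.
Proof. by move=> la n k v; apply: linZ. Qed.

Lemma hom_divderiv r (a : field) : homogeneous a -> homogeneous (divderiv r a).
Proof.
move=> ha; have h : homogeneous (iter r (@deriv R N) a).
  by elim: r => [//|r IH]; exact (hom_deriv IH).
exact (homZ _ h).
Qed.

Lemma hom_basisY b : homogeneous (@basisY R N b).
Proof.
case: b => [[l B] F]; rewrite /basisY.
have : homogeneous (@ferY R N (sort (fun x y : label N =>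
    (choice.pickle x <= choice.pickle y)%N) (enum_fset F)) (@vop R N l)).
  elim: (sort _ _) => [|[[t j] r] s IH] /=; first exact (hom_lin (@vop_lin R N l)).
  exact (hom_nop _ (hom_divderiv r (hom_lin (@fer_lin R N t j))) IH).
move: (ferY _ _) => a ha; elim: (enum_mset B) => [//|[[t j] r] s IH] /=.
exact (hom_nop _ (hom_divderiv r (hom_lin (@bos_lin R N t j))) IH).
Qed.

Lemma hom_Y u : homogeneous (Y u).
Proof.
move=> n k v; rewrite /Defs.Y !field_sum scaler_sumr; apply: eq_bigr => b _.
by rewrite !fieldZ hom_basisY; vring.
Qed.

Lemma LambdaChT_vac : LambdaChT (vac R N).
Proof. by move=> U [_ Uv _ _] _. Qed.

Lemma LambdaChT_lin c u v : LambdaChT u -> LambdaChT v -> LambdaChT (c *: u + v).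
Proof.
by move=> hu hv U vU gU; have [_ _ lU _] := vU; apply: lU; [apply: hu|apply: hv].
Qed.

Lemma LambdaChT_Y u n v : LambdaChT u -> LambdaChT v -> LambdaChT (Y u n v).
Proof.
by move=> hu hv U vU gU; have [_ _ _ yU] := vU; apply: yU; [apply: hu|apply: hv].
Qed.

(** The common eigenspace with eigenvalue c of all g satisfying [ZN_generator]; for c = 1 it is
    [LambdaChT_ZN]. Since eigenvalues multiply under [Y], invariance of a state follows from a
    factorisation into generating states. *)
Definition wt (c : C) : set V :=
  [set v : V | LambdaChT v /\ forall g, ZN_generator g -> g v = c *: v].

Lemma wt_vac : wt 1 (vac R N).
Proof. by split=> [|g [_ -> _ _]]; [apply: LambdaChT_vac|rewrite scale1r]. Qed.

Lemma wt_lin a c u v : wt c u -> wt c v -> wt c (a *: u + v).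
Proof.
move=> [hu gu] [hv gv]; split=> [|g hg]; first exact: LambdaChT_lin.
have [gl _ _ _ _] := hg; rewrite gl // gu // gv //; vring.
Qed.

Lemma LambdaChT0 : LambdaChT 0.
Proof.
have := LambdaChT_lin (-1) LambdaChT_vac LambdaChT_vac.
by rewrite scaleN1r addNr.
Qed.

Lemma wt0 c : wt c 0.
Proof.
split=> [|g [gl gv _ _]]; first exact: LambdaChT0.
have := gl (-1) _ _ LambdaChT_vac LambdaChT_vac.
by rewrite !scaleN1r gv !addNr scaler0.
Qed.

Lemma wtZ a c u : wt c u -> wt c (a *: u).
Proof. by move=> hu; have := wt_lin a hu (wt0 c); rewrite addr0. Qed.

Lemma wtD c u v : wt c u -> wt c v -> wt c (u + v).
Proof. by move=> hu hv; have := wt_lin 1 hu hv; rewrite scale1r. Qed.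

Lemma wtN c u : wt c u -> wt c (- u).
Proof. by move=> hu; have := wtZ (-1) hu; rewrite scaleN1r. Qed.

Lemma wt_sum c (F : 'I_N -> V) : (forall i, wt c (F i)) -> wt c (\sum_i F i).
Proof. by move=> h; refine (big_ind (wt c) (wt0 c) (fun u v => @wtD c u v) (fun i _ => h i)). Qed.

Lemma wtY c d u n v : wt c u -> wt d v -> wt (c * d) (Y u n v).
Proof.
move=> [hu gu] [hv gv]; split=> [|g hg]; first exact: LambdaChT_Y.
have [_ _ gY _ _] := hg; rewrite gY // gu // gv // hom_Y (linZ (@Y_lin R N)) fieldZ.
by rewrite scalerA mulrC.
Qed.

Lemma zeta_neq0 : zetaN != 0.
Proof.
apply/negP => /eqP [c0 s0].
have := @cos2Dsin2 R (pi *+ 2 / N%:R); rewrite c0 s0 expr0n /= addr0 => /eqP.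
by rewrite eq_sym oner_eq0.
Qed.

Lemma wt_bx i : wt zetaN (stateof (@bx R N i)).
Proof.
split=> [U vU gU|g [_ _ _ g1 _]]; first by have [h _ _ _] := gU i; exact h.
by have [h _] := g1 i; exact h.
Qed.
Lemma wt_bdx i : wt zetaN (stateof (@bdx R N i)).
Proof.
split=> [U vU gU|g [_ _ _ g1 _]]; first by have [_ h _ _] := gU i; exact h.
by have [_ h] := g1 i; exact h.
Qed.
Lemma wt_bpx i : wt zetaN^-1 (stateof (@bpx R N i)).
Proof.
split=> [U vU gU|g [_ _ _ _ g1]]; first by have [_ _ h _] := gU i; exact h.
by have [h _] := g1 i; exact h.
Qed.
Lemma wt_bpdx i : wt zetaN^-1 (stateof (@bpdx R N i)).
Proof.
split=> [U vU gU|g [_ _ _ _ g1]]; first by have [_ _ _ h] := gU i; exact h.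
by have [_ h] := g1 i; exact h.
Qed.

Lemma wt1E v : wt 1 v <-> LambdaChT_ZN v.
Proof. by split=> -[hv gv]; split=> // g /gv ->; rewrite ?scale1r. Qed.

End Invariants.

(** * Invariance of the states of the N = 2 fields *)

Section Memberships.
Variables (R : realType) (N : nat).
Hypothesis N0 : (0 < N)%N.
Local Notation C := R[i].
Local Notation V := (fock R N).
Local Notation field := (field R N).
Local Notation idf := (@idf R N).
Local Notation bos := (@bos R N).
Local Notation fer := (@fer R N).
Local Notation X := (@bos false).
Local Notation A := (@bos true).
Local Notation P := (@fer false).
Local Notation Q := (@fer true).
Local Notation chi := (@chi R N).
Local Notation kt := (@sket R N).
Local Notation vk l := (kt (l, mset0, fset0)).
Local Notation Y := (@Y R N).
Local Notation eX := (@eX R N).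
Local Notation tr := (@tr R N).
Local Notation sumG := (@sumG R N).
Local Notation sumQ := (@sumQ R N).
Local Notation sumL := (@sumL R N).
Local Notation totG := (@totG R N).
Local Notation totQ := (@totQ R N).
Local Notation totJ := (@totJ R N).
Local Notation totL := (@totL R N).
Local Notation wt := (@wt R N).
Local Notation zetaN := (@zetaN R N).
Local Notation ni := (N%:R^-1 : C).
Local Notation v0 := (vk 0).
Implicit Types (i j : 'I_N) (l : momentum N) (v : V) (s t : bool).

Section OneVariable.
Variable i : 'I_N.
Local Notation e := (vk (su false i)).
Local Notation e' := (vk (su true i)).
Local Notation "'X_' r" := (X i (Negz r)) (at level 8, r at level 2).
Local Notation "'A_' r" := (A i (Negz r)) (at level 8, r at level 2).
Local Notation "'P_' r" := (P i (Negz r)) (at level 8, r at level 2).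
Local Notation "'Q_' r" := (Q i (Negz r)) (at level 8, r at level 2).

Let tr1 : tr (su true i) e = v0.
Proof.
rewrite trE; congr (kt (_, _, _)).
by apply: injective_projections; rewrite /= ?addr0 // addrN.
Qed.
Let tr2 : tr (su false i) e' = v0.
Proof.
rewrite trE; congr (kt (_, _, _)).
by apply: injective_projections; rewrite /= ?addr0 // addNr.
Qed.
Let pe : pure e. Proof. pure_vector. Qed.
Let pP : pure (P_ 0 e). Proof. pure_vector. Qed.
Let pQ : pure (Q_ 0 e'). Proof. pure_vector. Qed.
Let cfer s : creative (fer s i). Proof. exact: creative_fer. Qed.
Let fl s n : fer s i n 0 = 0 := lin0 (@fer_lin R N s i n).
Let bl s n : bos s i n 0 = 0 := lin0 (@bos_lin R N s i n).
Let eX0 s n : eX s i n 0 = 0 := lin0 (@vop_lin R N (su s i) n).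

Let we : wt zetaN e.
Proof. by have := wt_bx R i; rewrite stateofE bx_m1. Qed.
Let wP : wt zetaN (P_ 0 e).
Proof. by have := wt_bdx R i; rewrite stateofE bdx_m1. Qed.
Let wQ : wt zetaN^-1 (Q_ 0 e').
Proof. by have := wt_bpdx R i; rewrite stateofE bpdx_m1. Qed.

Let zz : zetaN * zetaN^-1 = 1 := mulfV (zeta_neq0 R N).
Let zz' : zetaN^-1 * zetaN = 1 := mulVf (zeta_neq0 R N).

(** psi*_i is the state of the product of x_i and d/d(dx_i), whose eigenvalues are inverse to each
    other. *)
Lemma wt_Q : wt 1 (Q_ 0 v0).
Proof.
have w := wtY (Negz 0) we wQ; rewrite zz in w.
suff E : Y e (Negz 0) (Q_ 0 e') = Q_ 0 v0 by move: w; rewrite -> E.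
refine (etrans (congr1 (fun a : field => a (Negz 0) (Q_ 0 e')) (Y_vk R _)) _).
refine (etrans (eX_m1 false i pQ) _).
rewrite -> tr_fer.
rewrite -> tr2.
reflexivity.
Qed.

Let YQe' : Y (Q_ 0 e') = nop false (Q i) (eX true i).
Proof.
exact (etrans (Y_fer R true i 0 (su true i)) (congr1 (fun a => nop false a _) (dfer0 R i true))).
Qed.

Let QPe r : Q i r.+1 (P_ 0 e) = 0. Proof. by rewrite QP_e scale0r. Qed.
Let QPe0 : Q i 0%:Z (P_ 0 e) = e. Proof. by rewrite QP_e vscale1r. Qed.

Lemma QeX_P : nop false (Q i) (eX true i) (Negz 0) (P_ 0 e) = Q_ 0 (P_ 0 v0) - X_ 0 v0.
Proof.
refine (etrans (nop_m1 false (fl true) (eX0 true) (fun r => eX_pos true i r.+1 pP) (fun r => QPe r.+1)) _).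
rewrite -> (eX_pos true i 0 pP), (QPe 0), QPe0, (fl true (Negz 1)), (eX0 true (Negz 2)).
rewrite -> (eX_m1 true i pP), (eX_m2 true i pe), tr_fer, tr1, sg_true, sg_false.
by vring.
Qed.

(** The state of X_i + chi_i, obtained as minus that of the normally ordered product of d/d(dx_i)
    and dx_i. *)
Lemma wt_K : wt 1 (X_ 0 v0 + P_ 0 (Q_ 0 v0)).
Proof.
have w := wtN (wtY (Negz 0) wQ wP); rewrite zz' in w.
rewrite -> YQe', QeX_P in w.
have E := QP_v0 R i; rewrite -> E.
have -> : X_ 0 v0 + - Q_ 0 (P_ 0 v0) = - (Q_ 0 (P_ 0 v0) - X_ 0 v0) by vring.
exact w.
Qed.

Lemma wt_v0 : wt 1 v0.
Proof. by rewrite -vacE; apply: wt_vac. Qed.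

Lemma wt_Q1 : wt 1 (Q_ 1 v0).
Proof. by have := wtY (Negz 1) wt_Q wt_v0; rewrite mulr1 Y_fer0_0. Qed.

(** Multiplying X_i + chi_i by psi*_i gives :X psi*: - psi*', because :chi psi*: = - psi*'. The
    invariant state of psi*' then adjusts the coefficient -1 to -1/N. *)
Lemma wt_sumQ : wt 1 (sumQ i (Negz 0) v0).
Proof.
have w := wtY (Negz 0) wt_K wt_Q; rewrite mulr1 in w.
have c : chi i (Negz 0) (Q_ 0 v0) = - Q_ 1 v0.
  have E := congr1 (fun a : field => a (Negz 0) v0) (@nop_chiQ R N i).
  have E1 := creative_state false (creative_chi R i) (cfer true).
  refine (etrans (esym E1) (etrans E _)).
  exact (congr1 -%R (deriv_m1 (Q i) v0)).
have E : Y (X_ 0 v0 + P_ 0 (Q_ 0 v0)) (Negz 0) (Q_ 0 v0) = X_ 0 (Q_ 0 v0) - Q_ 1 v0.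
  refine (etrans (congr1 (fun a : field => a (Negz 0) (Q_ 0 v0)) (linD (@Y_lin R N) _ _)) _).
  rewrite -> (Y_bos0_0 R i false), (Y_chi R i).
  exact (congr1 (fun u : V => X_ 0 (Q_ 0 v0) + u) c).
rewrite -> E in w; rewrite -> sumQ_v0.
have -> : X_ 0 (Q_ 0 v0) - ni *: Q_ 1 v0 = (X_ 0 (Q_ 0 v0) - Q_ 1 v0) + (1 - ni) *: Q_ 1 v0.
  by vring.
exact (wtD w (wtZ (1 - ni) wt_Q1)).
Qed.

Let h0 (r : nat) : (A i - chi i) r v0 = 0.
Proof.
have [_ ca] := creative_bos R true i; have [_ cc] := creative_chi R i.
by rewrite fieldD fieldN ca cc subr0.
Qed.

Lemma chi_e' : chi i (Negz 0) e' = P_ 0 (Q_ 0 e').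
Proof.
refine (etrans (nop_m1 true (fl false) (fl true) (fun r => fer_vk R true i r.+1 _)
  (fun r => fer_vk R false i r.+2 _)) _).
have q0 := fer_vk R true i 0 (su true i); have p0 := fer_vk R false i 0 (su true i).
have p1 := fer_vk R false i 1 (su true i).
rewrite -> q0, p0, p1, (fl false (Negz 1)), (fl true (Negz 1)), (fl true (Negz 2)).
by vring.
Qed.

Lemma bpx_m1 : @bpx R N i (Negz 0) v0 = A_ 0 e' - P_ 0 (Q_ 0 e').
Proof.
have pv : pure v0 by pure_vector.
refine (etrans (bpx_eval pv (fun r => h0 r.+2)) _).
have t0 : tr (su true i) v0 = e' by rewrite trE add0r.
rewrite -> (h0 0), (h0 1), (eX0 true (Negz 1)), (eX0 true (Negz 2)), t0.
have E : (A i - chi i) (Negz 0) e' = A_ 0 e' - chi i (Negz 0) e' by [].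
rewrite -> E, chi_e'; vring.
Qed.

Let A0P : A i 0%:Z (P_ 0 e) = P_ 0 e.
Proof. exact (etrans (@bos_fer_comm R N true false i i 0 (Negz 0) e) (congr1 (P i (Negz 0)) (A0e R i))). Qed.

Let A1P (r : nat) : A i r.+1 (P_ 0 e) = 0.
Proof.
refine (etrans (@bos_fer_comm R N true false i i r.+1 (Negz 0) e) _).
exact (etrans (congr1 (P i (Negz 0)) (bos_vk R true i r _)) (fl false _)).
Qed.

Lemma AeX_P : nop false (A i) (eX true i) (Negz 0) (P_ 0 e) = A_ 0 (P_ 0 v0) - X_ 0 (P_ 0 v0).
Proof.
refine (etrans (nop_m1 false (bl true) (eX0 true) (fun r => eX_pos true i r.+1 pP) (fun r => A1P r.+1)) _).
rewrite -> (eX_pos true i 0 pP), (A1P 0), A0P, (bl true (Negz 1)), (eX0 true (Negz 2)).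
rewrite -> (eX_m1 true i pP), (eX_m2 true i pP), tr_fer, tr1, sg_true, sg_false.
by vring.
Qed.

Lemma nop_nonneg t (a b : field) w (r : nat) : (forall n, a n 0 = 0) -> (forall n, b n 0 = 0) ->
  (forall q : nat, b q w = 0) -> (forall q : nat, a q.+1 w = 0) ->
  nop t a b r w = sg R t *: b (r%:Z - 1) (a 0%:Z w).
Proof.
move=> a0 b0 bw aw; rewrite nopE (@lfsum1 _ _ _ 0%N) => [|[//|j] _]; rewrite /nterm.
  have -> : r%:Z - 0%:Z = r by lia.
  by rewrite bw a0 add0r.
by rewrite -PoszD bw a0 aw b0 scaler0 addr0.
Qed.

Let P0P (r : nat) : P i r (P_ 0 e) = 0.
Proof.
have E (u w : V) (k : C) : u + w = k *: e -> w = 0 -> k = 0 -> u = 0.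
  by move=> h w0 k0; move: h; rewrite w0 k0 addr0 scale0r.
refine (E _ _ _ (@fer_comm R N false false i i r (Negz 0) e) _ _); last by [].
exact (etrans (congr1 (P i (Negz 0)) (fer_vk R false i r _)) (fl false _)).
Qed.

Lemma PP_v0 v : P_ 0 (P_ 0 v) = 0.
Proof.
have E (u : V) : u + u = 0 *: v -> u = 0.
  move=> h; have -> : u = 2%:R^-1 *: (u + u) by vfield.
  by rewrite h scale0r scaler0.
exact (E _ (@fer_comm R N false false i i (Negz 0) (Negz 0) v)).
Qed.

Lemma PX_v0 : P_ 0 (X_ 0 v0) = X_ 0 (P_ 0 v0).
Proof. exact (esym (@bos_fer_comm R N false false i i (Negz 0) (Negz 0) v0)). Qed.

Lemma PQP_v0 : P_ 0 (Q_ 0 (P_ 0 v0)) = 0.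
Proof.
have := congr1 (Q_ 0) (PP_v0 v0); rewrite fl => h.
have E (u w z : V) (k : C) : u + w = k *: z -> w = 0 -> k = 0 -> u = 0.
  by move=> h' w0 k0; move: h'; rewrite w0 k0 addr0 scale0r.
refine (E _ _ _ _ (@fer_comm R N false true i i (Negz 0) (Negz 0) (P_ 0 v0)) h _).
by rewrite andbF.
Qed.

Lemma PeX_e : nop false (P i) (eX true i) (Negz 1) e = P_ 1 v0 - X_ 0 (P_ 0 v0).
Proof.
refine (etrans (nop_m2 false (fl false) (eX0 true) (fun r => eX_pos true i r.+1 pe)
  (fun r => fer_vk R false i r _)) _).
have x0 := eX_pos true i 0 pe.
have h : P_ 0 (eX true i (Negz 1) e) = - X_ 0 (P_ 0 v0).
  refine (etrans (congr1 (P_ 0) (etrans (eX_m2 true i pe) (congr1 (fun u => sg R true *: X_ 0 u) tr1))) _).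
  refine (etrans (linZ (@fer_lin R N false i (Negz 0)) _ _) _).
  refine (etrans (congr1 (fun u => sg R true *: u) PX_v0) _).
  by rewrite sg_true; exact: scaleN1r.
rewrite -> x0, h, (fl false (Negz 2)), (eX_m1 true i pe), tr1.
by vring.
Qed.

Lemma PeX_P : nop false (P i) (eX true i) (Negz 0) (P_ 0 e) = 0.
Proof.
refine (etrans (nop_m1 false (fl false) (eX0 true) (fun r => eX_pos true i r.+1 pP) (fun r => P0P r.+2)) _).
have x0 := eX_pos true i 0 pP.
rewrite -> x0, (P0P 0), (P0P 1), (fl false (Negz 1)), (eX0 true (Negz 1)), (eX0 true (Negz 2)).
rewrite -> (eX_m1 true i pP), tr_fer, tr1, PP_v0, sg_false.
by vring.
Qed.

Let nop0 t (a b : field) : (forall n, a n 0 = 0) -> (forall n, b n 0 = 0) ->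
  forall n, nop t a b n 0 = 0.
Proof.
move=> a0 b0 n; rewrite nopE; apply: lfsum0 => j; rewrite /nterm.
by rewrite [X in a _ X]b0 [X in b _ X]a0 a0 b0 scaler0 addr0.
Qed.

(** The triple product of psi, psi* and e^{-X_i} is evaluated here in one order and in [QPeX_P] in
    the other, since [pickle] decides which of them [Y_PQe'] meets. *)
Lemma PQeX_P : nop true (P i) (nop false (Q i) (eX true i)) (Negz 0) (P_ 0 e)
  = P_ 1 v0 - X_ 0 (P_ 0 v0).
Proof.
have c0 := nop0 false (fl true) (eX0 true).
have cr (r : nat) := nop_nonneg false r (fl true) (eX0 true) (fun q => eX_pos true i q pP) QPe.
have c1 : nop false (Q i) (eX true i) 0%:Z (P_ 0 e) = v0.
  refine (etrans (cr 0) (etrans (congr1 (fun u => sg R false *: eX true i (0%:Z - 1) u) QPe0) _)).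
  refine (etrans (congr1 (fun u => sg R false *: u) (etrans (eX_m1 true i pe) tr1)) _).
  by rewrite sg_false; exact: vscale1r.
have c2 (r : nat) : nop false (Q i) (eX true i) r.+1 (P_ 0 e) = 0.
  refine (etrans (cr r.+1) _); have -> : r.+1%:Z - 1 = r by rewrite intS addrC addKr.
  refine (etrans (congr1 (fun u => sg R false *: eX true i r u) QPe0) _).
  refine (etrans (congr1 (fun u => sg R false *: u) (eX_pos true i r pe)) _).
  exact: scaler0.
refine (etrans (nop_m1 true (fl false) c0 c2 (fun r => P0P r.+2)) _).
rewrite -> c1, (P0P 0), (P0P 1), QeX_P, (c0 (Negz 1)), (c0 (Negz 2)).
rewrite -> (linB (@fer_lin R N false i (Negz 0))), PQP_v0, PX_v0.
by vring.
Qed.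

Lemma QPeX_P : nop true (Q i) (nop false (P i) (eX true i)) (Negz 0) (P_ 0 e)
  = - (P_ 1 v0 - X_ 0 (P_ 0 v0)).
Proof.
have d0 := nop0 false (fl false) (eX0 true).
have dr (r : nat) : nop false (P i) (eX true i) r (P_ 0 e) = 0.
  refine (etrans (nop_nonneg false r (fl false) (eX0 true) (fun q => eX_pos true i q pP) (fun q => P0P q.+1)) _).
  refine (etrans (congr1 (fun u => sg R false *: eX true i (r%:Z - 1) u) (P0P 0)) _).
  refine (etrans (congr1 (fun u => sg R false *: u) (eX0 true _)) _).
  exact: scaler0.
refine (etrans (nop_m1 true (fl true) d0 (fun r => dr r.+1) (fun r => QPe r.+1)) _).
have d1 : nop false (P i) (eX true i) 0%:Z (P_ 0 e) = 0 := dr 0.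
have q1 := QPe 0.
rewrite -> d1, q1, QPe0, PeX_P, PeX_e, (fl true (Negz 0)), (fl true (Negz 1)), (d0 (Negz 2)), sg_true.
by vring.
Qed.

Lemma Y_PQe' : Y (P_ 0 (Q_ 0 e')) (Negz 0) (P_ 0 e) = P_ 1 v0 - X_ 0 (P_ 0 v0).
Proof.
have np : ((false, i, 0%N) : label N) != (true, i, 0%N) by [].
refine (etrans (congr1 (fun a : field => a (Negz 0) (P_ 0 e)) (Y_fer_fer R (su true i) np)) _).
cbv zeta; case: ifP => _.
  refine (etrans _ PQeX_P); refine (congr1 (fun a : field => a (Negz 0) (P_ 0 e)) _).
  exact (congr2 (nop true) (dfer0 R i false) (congr1 (fun a => nop false a _) (dfer0 R i true))).
refine (etrans _ (etrans (congr1 -%R QPeX_P) (opprK _))).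
refine (congr1 (fun a : field => (- a) (Negz 0) (P_ 0 e)) _).
exact (congr2 (nop true) (dfer0 R i true) (congr1 (fun a => nop false a _) (dfer0 R i false))).
Qed.

(** The summand of G is the product of d/dx_i and dx_i, with inverse eigenvalues. *)
Lemma wt_sumG : wt 1 (sumG i (Negz 0) v0).
Proof.
have wp : wt zetaN^-1 (A_ 0 e' - P_ 0 (Q_ 0 e')).
  by have := wt_bpx R i; rewrite stateofE bpx_m1.
have w := wtY (Negz 0) wp wP; rewrite zz' in w.
suff E : Y (A_ 0 e' - P_ 0 (Q_ 0 e')) (Negz 0) (P_ 0 e) = sumG i (Negz 0) v0.
  by move: w; rewrite -> E.
refine (etrans (congr1 (fun a : field => a (Negz 0) (P_ 0 e)) (linB (@Y_lin R N) _ _)) _).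
have YA : Y (A_ 0 e') (Negz 0) (P_ 0 e) = A_ 0 (P_ 0 v0) - X_ 0 (P_ 0 v0).
  refine (etrans (congr1 (fun a : field => a (Negz 0) (P_ 0 e)) _) AeX_P).
  refine (etrans (Y_bos R true i 0 (su true i) fset0) _).
  exact (congr2 (nop false) (dbos0 R i true) (Y_vk R _)).
refine (etrans (congr2 (fun u w : V => u - w) YA Y_PQe') (esym (etrans (sumG_v0 R i) _))).
by vring.
Qed.

End OneVariable.

Lemma creative_sum (F : 'I_N -> field) : (forall i, creative (F i)) -> creative (\sum_i F i).
Proof.
move=> h; split=> [n|r]; rewrite field_sum; apply: big1 => i _; first exact: (h i).1.
exact: (h i).2.
Qed.

Lemma creative_totQ : creative totQ.
Proof. by apply: creative_sum => i; rewrite /sumQ; creative_field. Qed.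
Lemma creative_totL : creative totL.
Proof. by apply: creative_sum => i; rewrite /sumL; creative_field. Qed.

Lemma wt_tot (F : 'I_N -> field) : (forall i, wt 1 (F i (Negz 0) v0)) ->
  wt 1 ((\sum_i F i) (Negz 0) v0).
Proof. by move=> h; rewrite field_sum; apply: wt_sum. Qed.

Lemma wt_totG : wt 1 (totG (Negz 0) v0).
Proof. exact (wt_tot wt_sumG). Qed.

Lemma wt_totQ : wt 1 (totQ (Negz 0) v0).
Proof. exact (wt_tot wt_sumQ). Qed.

Lemma Y_totG : Y (totG (Negz 0) v0) = totG. Proof. exact (Y_sum (@Y_sumG R N)). Qed.
Lemma Y_totQ : Y (totQ (Negz 0) v0) = totQ. Proof. exact (Y_sum (@Y_sumQ R N)). Qed.
Lemma Y_totJ : Y (totJ (Negz 0) v0) = totJ. Proof. exact (Y_sum (@Y_sumJ R N)). Qed.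
Lemma Y_totL : Y (totL (Negz 0) v0) = totL. Proof. exact (Y_sum (@Y_sumL R N)). Qed.

Let QG m : totQ m (totG (Negz 0) v0) = sg R true *: totG (Negz 0) (totQ m v0)
  + (totL (m + Negz 0) v0 + m%:~R *: (- totJ) (m + Negz 0 - 1) v0
  + (m * (m - 1))%:~R *: ((N%:R * (2%:R^-1 - ni)) *: idf) (m + Negz 0 - 2) v0
  + (m * (m - 1) * (m - 2))%:~R *: (0 : field) (m + Negz 0 - 3) v0).
Proof. exact (comm_move (@totQG R N m (Negz 0) v0)). Qed.

Let sgG0 (c : C) (u : V) : u = 0 -> c *: totG (Negz 0) u = 0.
Proof.
move=> ->; have l := gG R N.
have E (w : V) : w = 0 -> c *: w = 0 by move=> ->; vring.
exact (E _ (lin0 (good_lin l _))).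
Qed.

(** In the bracket of Q and G at m = 1 the term with L is a nonnegative mode on the vacuum and the
    higher terms carry the factor m - 1; only -J is left. *)
Lemma totQ1_G : totQ 1 (totG (Negz 0) v0) = - totJ (Negz 0) v0.
Proof.
refine (etrans (QG 1) _).
have E (a b c d e : V) (k1 k2 k3 : C) : a = 0 -> b = 0 -> k1 = 1 -> k2 = 0 -> k3 = 0 ->
    a + (b + k1 *: c + k2 *: d + k3 *: e) = c.
  by move=> -> -> -> -> ->; rewrite !scale0r !addr0 !add0r vscale1r.
refine (etrans (E _ _ _ _ _ _ _ _ (sgG0 _ (creative_totQ.2 1%N)) (creative_totL.2 0%N) _ _ _) _).
- by [].
- by rewrite subrr mulr0.
- by rewrite subrr mulr0 mul0r.
by [].
Qed.

Lemma totQ0_G : totQ 0 (totG (Negz 0) v0) = totL (Negz 0) v0.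
Proof.
refine (etrans (QG 0) _).
have E (a b c d e : V) (k1 k2 k3 : C) : a = 0 -> k1 = 0 -> k2 = 0 -> k3 = 0 ->
    a + (b + k1 *: c + k2 *: d + k3 *: e) = b.
  by move=> -> -> -> ->; rewrite !scale0r !addr0 !add0r.
exact (E _ _ _ _ _ _ _ _ (sgG0 _ (creative_totQ.2 0%N)) erefl erefl erefl).
Qed.

Lemma wt_totJ : wt 1 (totJ (Negz 0) v0).
Proof.
have w := wtN (wtY 1 wt_totQ wt_totG); rewrite mulr1 Y_totQ in w.
by rewrite -> totQ1_G in w; rewrite opprK in w.
Qed.

Lemma wt_totL : wt 1 (totL (Negz 0) v0).
Proof.
have w := wtY 0 wt_totQ wt_totG; rewrite mulr1 Y_totQ in w.
by rewrite -> totQ0_G in w.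
Qed.

Definition totA : field := \sum_i A i.

Lemma Y_totA : Y (totA (Negz 0) v0) = totA.
Proof. exact (Y_sum (fun i => Y_bos0_0 R i true)). Qed.

Lemma wt_totA : wt 1 (totA (Negz 0) v0).
Proof.
have wK := wt_sum wt_K.
have w := wtZ N%:R (wtD wK (wtN wt_totJ)).
suff E : N%:R *: (\sum_i (X i (Negz 0) v0 + P i (Negz 0) (Q i (Negz 0) v0)) - totJ (Negz 0) v0)
    = totA (Negz 0) v0 by exact (eq_ind _ (fun u => wt 1 u) w _ E).
rewrite /totJ /totA !field_sum -sumrB scaler_sumr; apply: eq_bigr => i _.
have n0 : N%:R != 0 :> C by rewrite pnatr_eq0 -lt0n.
have J := sumJ_v0 R i; rewrite -> J.
have E (a x p : V) : N%:R *: (x + p - (- (ni *: a) + x + p)) = a.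
  have -> : x + p - (- (ni *: a) + x + p) = ni *: a by vring.
  by rewrite scalerA mulfV // scale1r.
exact: E.
Qed.

Lemma wt_closed u n v : wt 1 u -> wt 1 v -> wt 1 (Y u n v).
Proof. by move=> hu hv; have := wtY n hu hv; rewrite mulr1. Qed.

Lemma totG_closed n v : wt 1 v -> wt 1 (totG n v).
Proof. by move=> hv; have := wt_closed n wt_totG hv; rewrite Y_totG. Qed.
Lemma totQ_closed n v : wt 1 v -> wt 1 (totQ n v).
Proof. by move=> hv; have := wt_closed n wt_totQ hv; rewrite Y_totQ. Qed.
Lemma totJ_closed n v : wt 1 v -> wt 1 (totJ n v).
Proof. by move=> hv; have := wt_closed n wt_totJ hv; rewrite Y_totJ. Qed.
Lemma totL_closed n v : wt 1 v -> wt 1 (totL n v).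
Proof. by move=> hv; have := wt_closed n wt_totL hv; rewrite Y_totL. Qed.
Lemma totA_closed n v : wt 1 v -> wt 1 (totA n v).
Proof. by move=> hv; have := wt_closed n wt_totA hv; rewrite Y_totA. Qed.
Lemma Q_closed i n v : wt 1 v -> wt 1 (Q i n v).
Proof. by move=> hv; have := wt_closed n (wt_Q i) hv; rewrite Y_fer0_0. Qed.

End Memberships.

(** * Twisted sectors *)

Section Twisting.
Variables (R : realType) (N : nat).
Local Notation C := R[i].
Local Notation V := (fock R N).
Local Notation field := (field R N).
Local Notation deriv := (@Defs.deriv R N).
Local Notation bos := (@bos R N).
Local Notation fer := (@fer R N).
Local Notation X := (@bos false).
Local Notation A := (@bos true).
Local Notation P := (@fer false).
Local Notation Q := (@fer true).
Local Notation chi := (@chi R N).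
Local Notation sumQ := (@sumQ R N).
Local Notation sumL := (@sumL R N).
Local Notation totG := (@totG R N).
Local Notation totQ := (@totQ R N).
Local Notation totJ := (@totJ R N).
Local Notation totL := (@totL R N).
Local Notation totA := (@totA R N).
Local Notation wt := (@wt R N).
Local Notation ni := (N%:R^-1 : C).
Implicit Types (i j : 'I_N) (l : momentum N) (v : V) (s t : bool).

Let gX i : good (X i) := bos_good R false i.
Let gA i : good (A i) := bos_good R true i.
Let gP i : good (P i) := fer_good R false i.
Let gQ i : good (Q i) := fer_good R true i.

(* The field z^{-1}. *)
Definition idz : field := fun n v => if n == 0 then v else 0.

Lemma good_idz : good idz.
Proof.
split=> [n|v]; last by exists 1 => -[[|n]|n].
by move=> k u w; rewrite /idz; case: ifP => // _; rewrite scaler0 addr0.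
Qed.

Lemma nop_idz (a : field) n v : good a -> nop false idz a n v = a (n - 1) v.
Proof.
move=> ga; rewrite nopE (@lfsum1 _ _ _ 0%N) /nterm /idz => [|[//|j] _]; last first.
  by rewrite (lin0 (good_lin ga _)) scaler0 add0r.
by rewrite sg_false vscale1r add0r; congr (a _ _); lia.
Qed.

Section Intertwining.
Variable T : V -> V.
Hypothesis lT : lin T.

(** T carries a' to a; when T is a shift to a twisted sector, a' is the field a as seen from the
    untwisted one. *)
Definition tw (a a' : field) := forall n v, a n (T v) = T (a' n v).

Lemma tw_nop s a a' b b' : good a' -> good b' -> tw a a' -> tw b b' ->
  tw (nop s a b) (nop s a' b').
Proof.
move=> ga gb ta tb n v; rewrite !nopE (lfsum_lin lT (lfin_nop s n v ga gb)).
apply: eq_lfsum => j; rewrite /= /nterm (linD lT) (linZ lT).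
by rewrite tb !ta tb.
Qed.

Lemma tw_deriv a a' : tw a a' -> tw (deriv a) (deriv a').
Proof. by move=> ta n v; rewrite /Defs.deriv ta (linZ lT). Qed.

Lemma twD a a' b b' : tw a a' -> tw b b' -> tw (a + b) (a' + b').
Proof. by move=> ta tb n v; rewrite !fieldD ta tb (linD lT). Qed.

Lemma twZ k a a' : tw a a' -> tw (k *: a) (k *: a').
Proof. by move=> ta n v; rewrite !fieldZ ta (linZ lT). Qed.

Lemma twN a a' : tw a a' -> tw (- a) (- a').
Proof. by move=> ta n v; rewrite !fieldN ta (linN lT). Qed.

Lemma tw_sum (F F' : 'I_N -> field) : (forall i, tw (F i) (F' i)) ->
  tw (\sum_i F i) (\sum_i F' i).
Proof.
by move=> tF n v; rewrite !field_sum (lin_sum lT); apply: eq_bigr => i _; apply: tF.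
Qed.

(** Two cases: k = 0 for the momentum projection, and k = n/N for the shift by n X*_orb, since the
    zero mode of X_i reads off the X*_i-coordinate of the momentum. *)
Variable k : C.
Hypothesis tX : forall i, tw (X i) (X i + k *: idz).
Hypothesis tA : forall i, tw (A i) (A i).
Hypothesis tF : forall s i, tw (fer s i) (fer s i).

Let gXk i : good (X i + k *: idz). Proof. by apply: goodD => //; apply/goodZ/good_idz. Qed.

Lemma tw_totG : tw totG totG.
Proof.
apply: tw_sum => i; apply: twD; last by apply: twN; apply: tw_deriv; apply: tF.
exact (tw_nop false (gA i) (gP i) (tA i) (tF false i)).
Qed.

Lemma tw_totQ : tw totQ (\sum_i (nop false (X i + k *: idz) (Q i) - ni *: deriv (Q i))).
Proof.
apply: tw_sum => i; apply: twD.
  exact (tw_nop false (gXk i) (gQ i) (tX i) (tF true i)).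
by apply: twN; apply: twZ; apply: tw_deriv; apply: tF.
Qed.

Lemma tw_chi i : tw (chi i) (chi i).
Proof. exact (tw_nop true (gP i) (gQ i) (tF false i) (tF true i)). Qed.

Lemma tw_totJ : tw totJ (\sum_i (- (ni *: A i) + (X i + k *: idz) + chi i)).
Proof.
apply: tw_sum => i; apply: twD (tw_chi i); apply: twD (tX i).
by apply: twN; apply: twZ; apply: tA.
Qed.

Lemma tw_totL : tw totL (\sum_i (nop false (X i + k *: idz) (A i)
  - deriv (X i + k *: idz) + nop true (deriv (Q i)) (P i))).
Proof.
apply: tw_sum => i; apply: twD; last first.
  exact (tw_nop true (good_deriv (gQ i)) (gP i) (tw_deriv (tF true i)) (tF false i)).
apply: twD; last by apply: twN; apply: tw_deriv; apply: tX.
exact (tw_nop false (gXk i) (gA i) (tX i) (tA i)).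
Qed.
End Intertwining.

Section TwistedFields.
Hypothesis N0 : (0 < N)%N.
Variable k : C.

Let gI : good (k *: idz). Proof. by apply/goodZ/good_idz. Qed.

Lemma wt_idz c n v : wt c v -> wt c (idz n v).
Proof. by move=> hv; rewrite /idz; case: ifP => _; [exact hv|exact (@wt0 R N c)]. Qed.

Lemma twistedQ_closed n v : wt 1 v ->
  wt 1 ((\sum_i (nop false (X i + k *: idz) (Q i) - ni *: deriv (Q i)) : field) n v).
Proof.
move=> hv.
have E : \sum_i (nop false (X i + k *: idz) (Q i) - ni *: deriv (Q i))
    = totQ + \sum_i k *: nop false idz (Q i) :> field.
  rewrite /totQ -big_split; apply: eq_bigr => i _.
  rewrite /sumQ (nopDl false (gX i) gI (gQ i)) (nopZl _ _ _ (gQ i)).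
  exact: addrAC.
rewrite E fieldD; refine (wtD (totQ_closed n hv) _); rewrite field_sum.
refine (wt_sum _) => i; rewrite fieldZ (nop_idz _ _ (gQ i)).
exact (wtZ k (Q_closed i (n - 1) hv)).
Qed.

Lemma twistedJ_closed n v : wt 1 v ->
  wt 1 ((\sum_i (- (ni *: A i) + (X i + k *: idz) + chi i) : field) n v).
Proof.
move=> hv.
have E : \sum_i (- (ni *: A i) + (X i + k *: idz) + chi i)
    = totJ + \sum_(i < N) k *: idz :> field.
  rewrite /totJ -big_split; apply: eq_bigr => i _.
  have E (a b c d : field) : a + (b + c) + d = a + b + d + c by fring.
  exact: E.
rewrite E fieldD; refine (wtD (totJ_closed N0 n hv) _); rewrite field_sum.
refine (wt_sum _) => i; rewrite fieldZ.
exact (wtZ k (wt_idz n hv)).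
Qed.

Lemma twistedL_closed n v : wt 1 v ->
  wt 1 ((\sum_i (nop false (X i + k *: idz) (A i)
  - deriv (X i + k *: idz) + nop true (deriv (Q i)) (P i)) : field) n v).
Proof.
move=> hv.
have E : \sum_i (nop false (X i + k *: idz) (A i)
    - deriv (X i + k *: idz) + nop true (deriv (Q i)) (P i))
    = totL + ((\sum_(i < N) k *: nop false idz (A i)) + \sum_(i < N) - deriv (k *: idz)) :> field.
  rewrite /totL -big_split -big_split; apply: eq_bigr => i _.
  rewrite /sumL (nopDl false (gX i) gI (gA i)) (nopZl _ _ _ (gA i)) fderivD.
  have E (a b c d e : field) : a + b - (c + d) + e = a - c + e + (b - d).
    by fring.
  exact: E.
rewrite E !fieldD; refine (wtD (totL_closed N0 n hv) (wtD _ _)); rewrite field_sum.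
  have -> : \sum_i (k *: nop false idz (A i)) n v = k *: totA (n - 1) v.
    rewrite /totA field_sum scaler_sumr; apply: eq_bigr => i _.
    by rewrite fieldZ (nop_idz _ _ (gA i)).
  exact (wtZ k (totA_closed N0 (n - 1) hv)).
refine (wt_sum _) => i; rewrite fieldN.
exact (wtN (wtZ (- n)%:~R (wtZ k (wt_idz (n - 1) hv)))).
Qed.
End TwistedFields.

End Twisting.

(** * Stability of the orbifold space and the final assembly *)

Section Orbifold.
Variables (R : realType) (N : nat).
Hypothesis N0 : (0 < N)%N.
Local Notation C := R[i].
Local Notation V := (fock R N).
Local Notation field := (field R N).
Local Notation deriv := (@Defs.deriv R N).
Local Notation bos := (@bos R N).
Local Notation fer := (@fer R N).
Local Notation X := (@bos false).
Local Notation A := (@bos true).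
Local Notation P := (@fer false).
Local Notation Q := (@fer true).
Local Notation kt := (@sket R N).
Local Notation tr := (@tr R N).
Local Notation totG := (@totG R N).
Local Notation totQ := (@totQ R N).
Local Notation totJ := (@totJ R N).
Local Notation totL := (@totL R N).
Local Notation wt := (@wt R N).
Local Notation idz := (@idz R N).
Implicit Types (i j : 'I_N) (l : momentum N) (v : V) (s t : bool).

(** X*_orb has no component along the X_j, and the cocycle pairs the dual part of the left momentum
    with exactly that component: its value is 1. *)
Lemma mulexpE n v : mulexp (nXorb N n) v = tr (nXorb N n) v.
Proof.
move: v; apply: linP; [exact: lext_lin|exact: tr_lin|] => -[[l B] F].
rewrite trE; refine (etrans (lext_kt _ _) _); rewrite -ktE.
have -> : cocycle R l (nXorb N n) = 1; last exact: vscale1r.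
by rewrite /cocycle /dotr big1 ?expr0 // => j _; rewrite mxE mulr0.
Qed.

Section Shift.
Variable n : nat.
Local Notation T := (tr (nXorb N n)).
Local Notation k := (ratr (n%:R / N%:R) : C).

Lemma shift_A i : tw T (A i) (A i).
Proof.
case=> [[|r]|r] v; [|exact: esym (tr_bosP _ _ _ _ _)|exact: esym (tr_bosN _ _ _ _ _)].
rewrite tr_bos0 mxE rmorph0; vring.
Qed.

Lemma shift_X i : tw T (X i) (X i + k *: idz).
Proof.
move=> m v; rewrite fieldD fieldZ (linD (@tr_lin R N _)) (linZ (@tr_lin R N _)) /idz.
case: m => [[|r]|r].
- by rewrite tr_bos0 mxE.
- by rewrite (lin0 (@tr_lin R N _)) scaler0 addr0 tr_bosP.
by rewrite (lin0 (@tr_lin R N _)) scaler0 addr0 tr_bosN.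
Qed.

Lemma shift_fer s i : tw T (fer s i) (fer s i).
Proof. by move=> m v; rewrite tr_fer. Qed.
End Shift.

Section MomentumProjection.
Variable S : set (momentum N).
(** Lying in a given [latticeFock] restricts momenta only, so it amounts to being fixed by such a
    projection, with which the free fields commute. *)
Definition mproj : V -> V := lext (fun b => if `[< S b.1.1 >] then kt b else 0).

Lemma mproj_lin : lin mproj. Proof. exact: lext_lin. Qed.

Lemma mprojE l B F : mproj (kt (l, B, F)) = if `[< S l >] then kt (l, B, F) else 0.
Proof. exact: lext_kt. Qed.

Lemma coef_mproj b v : coef b (mproj v) = (`[< S b.1.1 >])%:R * coef b v.
Proof.
apply: (coef_diag (w := fun b : basis N => (`[< S b.1.1 >])%:R)); first exact: mproj_lin.
move=> [[l B] F]; rewrite mprojE; case: ifP => _; last by rewrite scale0r.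
by rewrite vscale1r.
Qed.

Lemma mproj_bos s i : tw mproj (bos s i) (bos s i).
Proof.
move=> n; apply: linP.
- exact: (lin_comp (bos_lin s i n) mproj_lin).
- exact: (lin_comp mproj_lin (bos_lin s i n)).
move=> [[l B] F]; have [c [B' E]] := bos_kt R s i n l B.
rewrite E (linZ mproj_lin) !mprojE; case: ifP => _; first by rewrite E.
by rewrite scaler0 (lin0 (bos_lin _ _ _)).
Qed.

Lemma mproj_fer s i : tw mproj (fer s i) (fer s i).
Proof.
move=> n; apply: linP.
- exact: (lin_comp (fer_lin s i n) mproj_lin).
- exact: (lin_comp mproj_lin (fer_lin s i n)).
move=> [[l B] F]; have [c [F' E]] := fer_kt R s i n F.
rewrite E (linZ mproj_lin) !mprojE; case: ifP => _; first by rewrite E.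
by rewrite scaler0 (lin0 (fer_lin _ _ _)).
Qed.

Lemma mproj_fix v : mproj v = v <-> forall b, b \in monalg.msupp v -> S b.1.1.
Proof.
split=> [pv b|h].
  rewrite -monalg.mcoeff_neq0 => vb; apply: contrapT => nS; case/negP: vb.
  have := coef_mproj b v; rewrite pv asboolF // mul0r => e; exact/eqP.
apply: coefP => b; rewrite coef_mproj; have [->|c0] := eqVneq (coef b v) 0; first by rewrite mulr0.
by rewrite asboolT ?mul1r //; apply: h; rewrite -monalg.mcoeff_neq0.
Qed.
End MomentumProjection.

Definition orb_momenta : set (momentum N) := [set l | latZorb l.1 /\ latdual (@latZorb N) l.2].

(** The field [a' n] is what a becomes on the sector with e^{n X*_orb} after the exponential is
    removed; it is enough that its modes preserve the invariants of the untwisted sector. *)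
Lemma acts_on_LGorb (a : field) (a' : nat -> field) :
  good a -> tw (mproj orb_momenta) a a -> (forall n, tw (tr (nXorb N n)) a (a' n)) ->
  (forall n m v, wt 1 v -> wt 1 (a' n m v)) -> acts_on (LGorb R N) a.
Proof.
move=> ga pa ta wa v [vL [u uZ vE]]; split=> [m|]; last exact: ga.2.
split.
  have /mproj_fix h : forall b, b \in monalg.msupp v -> orb_momenta b.1.1 by exact: vL.
  by apply/(mproj_fix orb_momenta); rewrite -pa h.
(* The correction depends on the sector, hence a different field for each component. *)
exists (fun n : 'I_N => a' n m (u n)) => [n|].
  by apply/wt1E; apply: wa; apply/wt1E.
rewrite vE (lin_sum (good_lin ga m)); apply: eq_bigr => n _.
exact (etrans (congr1 (a m) (mulexpE _ _)) (etrans (ta n m (u n)) (esym (mulexpE _ _)))).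
Qed.

Lemma proj_X S i : tw (mproj S) (X i) (X i + 0 *: idz).
Proof. by rewrite scale0r addr0; apply: mproj_bos. Qed.

Lemma untwist i : X i + 0 *: idz = X i :> field.
Proof. by rewrite scale0r addr0. Qed.

Section Action.
Let S := orb_momenta.
Let lp := @mproj_lin S.
Let pX i : tw (mproj S) (X i) (X i + 0 *: idz) := @proj_X S i.
Let pA i : tw (mproj S) (A i) (A i) := @mproj_bos S true i.
Let pF s i : tw (mproj S) (fer s i) (fer s i) := @mproj_fer S s i.
Let lt n := @tr_lin R N (nXorb N n).

Lemma acts_G : acts_on (LGorb R N) totG.
Proof.
refine (acts_on_LGorb (a' := fun _ => totG) (gG R N) _ _ _).
- exact (tw_totG lp pA pF).
- by move=> n; exact (tw_totG (@lt n) (@shift_A n) (@shift_fer n)).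
by move=> _ m v; exact: totG_closed.
Qed.

Lemma acts_Q : acts_on (LGorb R N) totQ.
Proof.
refine (acts_on_LGorb (gQQ R N) _
  (fun n => tw_totQ (@lt n) (@shift_X n) (@shift_fer n)) _).
(* The general intertwining result at k = 0 produces X_i + 0 z^{-1}, which is rewritten to X_i under
   the sum. *)
- refine (eq_ind _ (tw (mproj S) totQ) (tw_totQ lp pX pF) _ _).
  refine (eq_bigr _ (fun i _ => _)).
  exact (congr1 (fun a : field => nop false a (Q i) - (N%:R^-1 : C) *: deriv (Q i)) (untwist i)).
by move=> n m v; exact: twistedQ_closed.
Qed.

Lemma acts_J : acts_on (LGorb R N) totJ.
Proof.
refine (acts_on_LGorb (gJ R N) _
  (fun n => tw_totJ (@lt n) (@shift_X n) (@shift_A n) (@shift_fer n)) _).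
- refine (eq_ind _ (tw (mproj S) totJ) (tw_totJ lp pX pA pF) _ _).
  refine (eq_bigr _ (fun i _ => _)).
  exact (congr1 (fun a : field => - ((N%:R^-1 : C) *: A i) + a + @chi R N i) (untwist i)).
by move=> n m v; exact: twistedJ_closed.
Qed.

Lemma acts_L : acts_on (LGorb R N) totL.
Proof.
refine (acts_on_LGorb (gL R N) _
  (fun n => tw_totL (@lt n) (@shift_X n) (@shift_A n) (@shift_fer n)) _).
- refine (eq_ind _ (tw (mproj S) totL) (tw_totL lp pX pA pF) _ _).
  refine (eq_bigr _ (fun i _ => _)).
  exact (congr1 (fun a : field => nop false a (A i) - deriv a + nop true (deriv (Q i)) (P i)) (untwist i)).
by move=> n m v; exact: twistedL_closed.
Qed.
End Action.

Lemma N2_brackets (W : set V) :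
  acts_on W totG -> acts_on W totQ -> acts_on W totJ -> acts_on W totL ->
  N2_structure W (N2Data totG totQ totJ totL).
Proof.
move=> aG aQ aJ aL; split; first by split.
have trim s (a b e0 e1 e2 : field) k cs : brk s a b e0 e1 e2 0 ->
    [:: e0; e1; e2] = cs ++ nseq k 0 -> has_bracket W s a b cs.
  by move=> h e; apply: (@has_bracket_trim _ _ _ _ _ _ _ k); rewrite -e; exact: brk_has_bracket.
(* This is 3(N - 2), written as 3 times the central term of the bracket of J with itself; then c/6 =
   N(1/2 - 1/N) agrees with the brackets of L with J and of Q with G. *)
exists (3%:R * (N%:R * (1 - 2%:R * (N%:R^-1)))).
have e3 : 3%:R * (N%:R * (1 - 2%:R * N%:R^-1)) / 3%:R = N%:R * (1 - 2%:R * N%:R^-1) :> C.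
  by rewrite mulrC mulKf // pnatr_eq0.
have e6 : 3%:R * (N%:R * (1 - 2%:R * N%:R^-1)) / 6%:R = N%:R * (2%:R^-1 - N%:R^-1) :> C.
  by field; rewrite pnatr_eq0 -lt0n.
have c3 := @cstfieldE R N (3%:R * (N%:R * (1 - 2%:R * N%:R^-1)) / 3%:R).
have c6 := @cstfieldE R N (3%:R * (N%:R * (1 - 2%:R * N%:R^-1)) / 6%:R).
rewrite e3 in c3; rewrite e6 in c6; rewrite e3 e6 c3 c6; split; split.
- exact: (trim _ _ _ _ _ _ 1%N _ (@totLL R N)).
- exact: (trim _ _ _ _ _ _ 1%N _ (@totJJ R N)).
- exact: (trim _ _ _ _ _ _ 1%N _ (@totLG R N)).
- exact: (trim _ _ _ _ _ _ 2%N _ (@totJG R N)).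
- exact: (trim _ _ _ _ _ _ 1%N _ (@totLQ R N)).
- exact: (trim _ _ _ _ _ _ 2%N _ (@totJQ R N)).
- exact: (trim _ _ _ _ _ _ 0%N _ (@totLJ R N)).
- exact: (trim _ _ _ _ _ _ 0%N _ (@totQG R N)).
- exact: (trim _ _ _ _ _ _ 3%N _ (@totGG R N)).
exact: (trim _ _ _ _ _ _ 3%N _ (@totQQ R N)).
Qed.

Lemma N2_geom_structure : N2_structure (LGorb R N) (N2_geom R N).
Proof. by rewrite geomE; apply: N2_brackets; [exact acts_G|exact acts_Q|exact acts_J|exact acts_L]. Qed.

End Orbifold.

Theorem lemma5p2p14 (R : realType) (N : nat) (hN : (2 <= N)%N)
    (f : {mpoly R[i][N]})
    (hom_f : f \is N.-homog)
    (isolated_f : forall v : 'I_N -> R[i],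
       (forall i, (f^`M(i)).@[v] = 0) <-> (forall i, v i = 0)) :
  [/\ N2_structure (LGorb R N) (N2_LG R N),
      N2_structure (LGorb R N) (N2_geom R N)
    & N2_coincide (LGorb R N) (N2_LG R N) (N2_geom R N)].
Proof.
have geom := @N2_geom_structure R N (ltnW hN).
by rewrite LG_geom; split.
Qed.
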